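(* Let $r,s\in\mathbb N$ (positive integers), let $v,w$ be homotopy bands and $u$ a (finite) homotopy string over the gentle algebra $\Lambda$, and let $\lambda,\mu\in\mathbf k^*$ be such that $B_{w,\mu,1}\not\cong\Sigma B_{v,\lambda,1}$ in $\mathsf D$. Let $\delta_{B_{v,\lambda,1},B_{w,\mu,1}}$ be $1$ if $B_{v,\lambda,1}\cong B_{w,\mu,1}$ and $0$ otherwise. Then (1) $\hom_{\mathsf D}(B_{v,\lambda,r},B_{w,\mu,s})=\min\{r,s\}\cdot\delta_{B_{v,\lambda,1},B_{w,\mu,1}}+rs\cdot\mathrm{rad}_{\mathsf D}(B_{v,\lambda,1},B_{w,\mu,1})$; (2) $\hom_{\mathsf D}(B_{v,\lambda,r},P_u)=r\cdot\hom_{\mathsf D}(B_{v,\lambda,1},P_u)$ and $\hom_{\mathsf D}(P_u,B_{v,\lambda,r})=r\cdot\hom_{\mathsf D}(P_u,B_{v,\lambda,1})$.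
   Context: **Setting.** $\mathbf k$ is an algebraically closed field, $\Gamma=(\Gamma_0,\Gamma_1)$ a finite connected quiver and $\Lambda\cong\mathbf k\Gamma/I$ a (finite-dimensional) bound path algebra which is gentle: (1) each vertex is the source of at most two arrows and the target of at most two arrows; (2) for each arrow $a$ there is at most one arrow $b$ with $ab\notin I$ and at most one arrow $c$ with $ca\notin I$ (among composable pairs); (3) for each arrow $a$ there is at most one arrow $b$ with $ab\in I$ and at most one arrow $c$ with $ca\in I$ (among composable pairs); (4) $I$ is generated by paths of length $2$. Paths are composed from right to left ($pq$ means first $q$, then $p$); $s(p),t(p)$ are source and target. Modules are left modules; $P(x)$ is the indecomposable projective at $x\in\Gamma_0$. A path $p$ from $x$ to $y$ (without subpath in $I$) is identified with the basis element $P(y)\to P(x)$, $u\mapsto up$, of $\mathrm{Hom}_\Lambda(P(y),P(x))$; maps are composed from left to right (matrices act on row vectors). $\mathsf D=\mathsf D^b(\mathrm{mod}\,\Lambda)$, identified with $\mathsf K^{-,b}(\mathrm{proj}\,\Lambda)$; $\Sigma$ is the shift. $\hom_{\mathsf D}(X,Y)=\dim_{\mathbf k}\mathrm{Hom}_{\mathsf D}(X,Y)$, and $\mathrm{rad}_{\mathsf D}(X,Y)$ is the dimension of the space of non-isomorphisms $X\to Y$. **Homotopy strings.** A homotopy letter is a triple $(p,i,j)$, $p$ a path with no subpath in $I$, $i,j\in\mathbb Z$, $|i-j|\le1$: direct if $i<j$, inverse if $i>j$ (then $p$ has positive length), trivial if $i=j$ (then $p$ is stationary). For an inverse letter, $s(p,i,j)=t(p)$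 and $t(p,i,j)=s(p)$; otherwise $s(p,i,j)=s(p)$, $t(p,i,j)=t(p)$. The composition $(p,i,j)(p',i',j')$ is defined if $j=i'$ and $s(p,i,j)=t(p',i',j')$. A homotopy string is a trivial letter, or a sequence $w=w_n\cdots w_1$, $w_r=(w_r,i_r,j_r)$, of pairwise composable nontrivial letters such that for consecutive letters $w_rw_{r-1}$: if both are direct, the path $w_rw_{r-1}$ has a subpath in $I$; if both are inverse, the path $w_{r-1}w_r$ has a subpath in $I$; if $w_r$ is direct and $w_{r-1}$ inverse, the two paths do not start with the same arrow; if $w_r$ is inverse and $w_{r-1}$ direct, they do not end with the same arrow. The vertices of $w$ are $n,n-1,\dots,0$; letter $w_r$ joins vertex $r$ to vertex $r-1$; vertex $r\ge1$ has degree $i_r$ and vertex $0$ degree $j_1$; $\varphi_w(r)=t(w_r)$ (letter target) for $r\ge1$, $\varphi_w(0)=s(w_1)$. The string complex $P_w$ has in degree $i$ the module $\bigoplus P(\varphi_w(r))$ over vertices $r$ of degree $i$; a direct letter $w_r$ gives the differential component $w_r:P(\varphi_w(r))\to P(\varphi_w(r-1))$, an inverse letter gives $w_r:P(\varphi_w(r-1))\to P(\varphi_w(r))$. For a trivial string $(1_x,i,i)$, $P_w$ is $P(x)$ in degree $i$. **Homotopy bands.** A homotopy band is a nontrivial homotopy string $w=w_n\cdots w_1$ with $s(w)=t(w)$, $i_n=j_1$, one of $w_n,w_1$ direct and the other inverse, not a proper power of another homotopy string, and such that its powers are homotopy strings. For $\lambda\in\mathbf k^*$, the one-dimensional band complex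 $B_{w,\lambda,1}=(B^i_{w,\lambda,1},D^i)$ is defined like $P_w$ but with vertices $1,\dots,n$ (vertex $0$ identified with vertex $n$), the differential component given by $w_1$ being multiplied by $\lambda$ (for $n=2$ the only nonzero differential component is $\lambda w_1+w_2$). For $r\ge1$, the $r$-dimensional band complex $B_{w,\lambda,r}$ has $i$-th term $(B^i_{w,\lambda,1})^r$ and differential the $r\times r$ block matrix with $D^i$ on the diagonal, $A^i$ on the superdiagonal and $0$ elsewhere, where $A^i$ is obtained from $D^i$ by replacing the contribution $\lambda w_1$ by $w_1$ and every other contribution by $0$. *)

(* Defs.v *)
From HB Require Import structures.
From mathcomp Require Import all_boot all_order all_algebra all_field.
From mathcomp Require Import zify boolp.

Set Implicit Arguments.
Unset Strict Implicit.
Unset Printing Implicit Defensive.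

Import Order.TTheory GRing.Theory Num.Theory.
Local Open Scope ring_scope.

Section Span.
Variables (k : fieldType) (V : vectType k).

Definition is_span (S : V -> Prop) (U : {vspace V}) : Prop :=
  (forall f, S f -> f \in U) /\
  (forall W : {vspace V}, (forall f, S f -> f \in W) -> (U <= W)%VS).

Lemma is_span_seq (S : V -> Prop) :
  exists2 t : seq V, (forall f, f \in t -> S f) & is_span S <<t>>%VS.
Proof.
pose P n := `[< exists2 t : seq V, (forall f, f \in t -> S f)
                                 & \dim <<t>>%VS = n >].
have exP : exists n, P n.
  by exists (\dim <<[::] : seq V>>%VS); apply/asboolP; exists [::].
have bP n : P n -> (n <= \dim {: V})%N.
  by move=> /asboolP[t _ <-]; exact: dimvS (subvf _).
case: (ex_maxnP exP bP) => n /asboolP[t tS tn] nmax.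
exists t => //; split=> [f Sf|W SW]; last by apply/span_subvP => f /tS /SW.
have sub : (<<t>> <= <<f :: t>>)%VS by rewrite span_cons addvSr.
have /nmax le : P (\dim <<f :: t>>%VS).
  by apply/asboolP; exists (f :: t) => // g; rewrite inE => /predU1P[->//|/tS].
have /eqP -> : <<t>>%VS == <<f :: t>>%VS by rewrite eqEdim sub tn.
by rewrite memv_span ?mem_head.
Qed.

Lemma is_span_ex (S : V -> Prop) : exists U, is_span S U.
Proof. by have [t _ tS] := is_span_seq S; exists <<t>>%VS. Qed.

Definition vspan (S : V -> Prop) : {vspace V} := projT1 (cid (is_span_ex S)).

Lemma vspanP (S : V -> Prop) : is_span S (vspan S).
Proof. exact: projT2 (cid (is_span_ex S)). Qed.

Lemma vspan_subspace (S : V -> Prop) :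
    S 0 -> (forall (c : k) f g, S f -> S g -> S (c *: f + g)) ->
  forall f, f \in vspan S <-> S f.
Proof.
move=> S0 Slin f; have [SU Umin] := vspanP S.
split=> [fS|]; last exact: SU.
have [t tS [St _]] := is_span_seq S.
have {fS} ft : f \in <<t>>%VS by apply: subvP fS; exact: Umin.
rewrite (coord_span (X := in_tuple t) ft).
elim/big_ind: _ => // [x y Sx Sy|i _]; first by rewrite -[x]scale1r;
  exact: Slin.
by rewrite -[X in S X]addr0; apply: Slin => //; apply: tS; exact: mem_nth.
Qed.

(* The dimension of the image of the span of S in V / span N. *)
Definition dim_mod (S N : V -> Prop) : nat :=
  (\dim (vspan S + vspan N)%VS - \dim (vspan N))%N.

End Span.

(* A finite quiver together with elements of A for its stationary paths and
   its arrows. *)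
Record quiver_in (k : fieldType) (A : falgType k) := QuiverIn {
  vert : finType;
  arr : finType;
  src : arr -> vert;
  tgt : arr -> vert;
  idem : vert -> A;
  gen : arr -> A }.

Section Quiver.
Variables (k : fieldType) (A : falgType k) (G : quiver_in A).

(* (x, [:: a_n; ...; a_1]) stands for the path a_n ... a_1 starting at x; as
   paths are composed from right to left, the head of the list is the last
   arrow and the last element of the list is the first arrow. *)
Definition qpath : Type := (vert G * seq (arr G))%type.
HB.instance Definition _ := Choice.on qpath.

Definition psrc (p : qpath) : vert G := p.1.
Definition ptgt (p : qpath) : vert G := if p.2 is a :: _ then tgt a else p.1.

Fixpoint walk (x : vert G) (s : seq (arr G)) : bool :=
  if s is a :: s' then (src a == ptgt (x, s')) && walk x s' else true.

Definition is_path (p : qpath) : bool := walk p.1 p.2.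

(* pq, first q, then p. *)
Definition pcat (p q : qpath) : qpath := (psrc q, p.2 ++ q.2).

(* The image in A of a path of the quiver. *)
Definition ev (p : qpath) : A := foldr (fun a u => gen a * u) (idem p.1) p.2.

(* Since I is the kernel of the map from the path algebra to A, a path lies in
   I iff its image is 0; as I is an ideal, a path lies in I iff one of its
   subpaths does. *)
Definition in_ideal (p : qpath) : bool := ev p == 0.

Definition connected_quiver : Prop :=
  forall x y : vert G,
    connect (fun x y => [exists a, [&& src a == x & tgt a == y]
                                || [&& src a == y & tgt a == x]]) x y.

(* By the universal property of path algebras, the first three clauses say
   that ev extends to a unital algebra homomorphism from the path algebra to
   A; the last one says that it is onto. *)
Definition presents : Prop :=
  [/\ forall x y : vert G,
        idem x * idem y = (if x == y then idem x else 0),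
      \sum_(x : vert G) idem x = 1,
      forall a : arr G, idem (tgt a) * gen a * idem (src a) = gen a
    & forall u : A, exists (s : seq qpath) (c : qpath -> k),
        all is_path s /\ u = \sum_(p <- s) c p *: ev p].

(* The ideal of the path algebra generated by a set of paths is spanned by the
   paths having a subpath in this set.  So the kernel I is generated by paths
   of length 2 iff all paths with a nonzero coefficient in an element of I
   have a subpath ab of length 2 in I. *)
Definition quadratic_monomial : Prop :=
  forall (s : seq qpath) (c : qpath -> k), uniq s -> all is_path s ->
    \sum_(p <- s) c p *: ev p = 0 ->
  forall p, p \in s -> c p != 0 ->
  exists (q1 q2 : seq (arr G)) (a b : arr G),
    p.2 = q1 ++ [:: a; b] ++ q2 /\ in_ideal (src b, [:: a; b]).

Definition composable (a b : arr G) : bool := src a == tgt b.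
Definition zero_rel (a b : arr G) : bool :=
  composable a b && in_ideal (src b, [:: a; b]).
Definition nonzero_rel (a b : arr G) : bool :=
  composable a b && ~~ in_ideal (src b, [:: a; b]).

Definition gentle : Prop :=
  [/\ forall x : vert G, (#|[set a : arr G | src a == x]| <= 2)%N
                      /\ (#|[set a : arr G | tgt a == x]| <= 2)%N,
      forall a : arr G,
        (#|[set b | nonzero_rel a b]| <= 1)%N
        /\ (#|[set c | nonzero_rel c a]| <= 1)%N,
      forall a : arr G,
        (#|[set b | zero_rel a b]| <= 1)%N
        /\ (#|[set c | zero_rel c a]| <= 1)%N
    & quadratic_monomial].

(* A is the bound path algebra kG/I of a finite connected quiver, and it is
   gentle. *)
Definition gentle_algebra : Prop :=
  [/\ connected_quiver, presents & gentle].

Definition proj (x : vert G) : pred A := fun u => u * idem x == u.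

(* Hom(P(y), P(x)), identified with e_y A e_x: its element p is the map
   u |-> up.  See projhomP. *)
Definition projhom (y x : vert G) : pred A :=
  fun p => idem y * p * idem x == p.

Lemma projhomP (y x : vert G) (f : A -> A) : presents ->
    (forall a u, proj y u -> f (a * u) = a * f u) ->
    (forall u, proj y u -> proj x (f u)) ->
  exists! p : A, projhom y x p /\ (forall u, proj y u -> f u = u * p).
Proof.
move=> [idemM _ _ _] flin fproj.
have ey : proj y (idem y) by rewrite /proj idemM eqxx.
have fE u : proj y u -> f u = u * f (idem y).
  by move=> /[dup] /eqP uy _; rewrite -flin // uy.
exists (f (idem y)); split=> [|q [/eqP qE qf]].
  by split=> //; apply/eqP; rewrite -fE // (eqP (fproj _ ey)).
by rewrite qf // -qE !mulrA idemM eqxx.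
Qed.

(* D^b(mod A) is K^{-,b}(proj A); the complexes needed here are bounded
   complexes of finite direct sums of modules P(x).  Such a complex is given by
   the finite set of its summands, where the summand a is P(cvert a) placed in
   degree cdeg a, and the matrix of its differential. Matrices act on row
   vectors from the right, so that the entry (a, b) is a map from the summand a
   to the summand b. *)
Record complex := Complex {
  cidx : finType;
  cvert : cidx -> vert G;
  cdeg : cidx -> int;
  cdiff : {ffun cidx * cidx -> A} }.

Definition mor (X Y : complex) := {ffun cidx X * cidx Y -> A}.
HB.instance Definition _ X Y := Vector.on (mor X Y).

(* Families of maps X^i -> Y^(i + m). *)
Definition homogeneous (X Y : complex) (m : int) (f : mor X Y) : Prop :=
  forall a b, projhom (cvert a) (cvert b) (f (a, b))
    /\ (f (a, b) != 0 -> cdeg b = cdeg a + m).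

(* First f, then g. *)
Definition mcomp (X Y Z : complex) (f : mor X Y) (g : mor Y Z) : mor X Z :=
  [ffun ac => \sum_(b : cidx Y) f (ac.1, b) * g (b, ac.2)].

Definition mid (X : complex) : mor X X :=
  [ffun ab => if ab.1 == ab.2 then idem (cvert ab.1) else 0].

Definition diff (X : complex) : mor X X := cdiff X.

Definition is_complex (X : complex) : Prop :=
  homogeneous 1 (diff X) /\ mcomp (diff X) (diff X) = 0.

Definition chain_map (X Y : complex) (f : mor X Y) : Prop :=
  homogeneous 0 f /\ mcomp f (diff Y) = mcomp (diff X) f.

Definition null_homotopic (X Y : complex) (f : mor X Y) : Prop :=
  exists h : mor X Y, homogeneous (- 1) h /\
    f = mcomp (diff X) h + mcomp h (diff Y).

Definition homotopic (X Y : complex) (f g : mor X Y) : Prop :=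
  null_homotopic (f - g : mor X Y).

Definition isoD_map (X Y : complex) (f : mor X Y) : Prop :=
  chain_map f /\ exists g : mor Y X,
    [/\ chain_map g, homotopic (mcomp f g) (mid X)
      & homotopic (mcomp g f) (mid Y)].

Definition isoD (X Y : complex) : Prop := exists f : mor X Y, isoD_map f.

Definition homD (X Y : complex) : nat :=
  dim_mod (@chain_map X Y) (@null_homotopic X Y).

(* The dimension of the space of non-isomorphisms from X to Y (of its span, if
   the non-isomorphisms are not closed under addition, which does not happen
   if X and Y have local endomorphism rings). *)
Definition radD (X Y : complex) : nat :=
  dim_mod (fun f : mor X Y => chain_map f /\ ~ isoD_map f)
          (@null_homotopic X Y).

Definition shift (X : complex) : complex :=
  @Complex (cidx X) (@cvert X) (fun a => cdeg a - 1) (- cdiff X).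

Record letter := Letter { lpath : qpath; li : int; lj : int }.

Definition direct (l : letter) : bool := li l < lj l.
Definition inverse (l : letter) : bool := lj l < li l.

Definition lsrc (l : letter) : vert G :=
  if inverse l then ptgt (lpath l) else psrc (lpath l).
Definition ltgt (l : letter) : vert G :=
  if inverse l then psrc (lpath l) else ptgt (lpath l).

Definition nontrivial_letter (l : letter) : bool :=
  [&& is_path (lpath l), ~~ in_ideal (lpath l), `|li l - lj l| <= 1,
      li l != lj l & (lpath l).2 != [::]].

Definition same_first (p q : qpath) : bool :=
  ohead (rev p.2) == ohead (rev q.2).
Definition same_last (p q : qpath) : bool := ohead p.2 == ohead q.2.

(* l' l is a homotopy string, for nontrivial letters l' and l. *)
Definition linked (l' l : letter) : bool :=
  [&& lj l' == li l, lsrc l' == ltgt l,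
      direct l' && direct l ==> in_ideal (pcat (lpath l') (lpath l)),
      inverse l' && inverse l ==> in_ideal (pcat (lpath l) (lpath l')),
      direct l' && inverse l ==> ~~ same_first (lpath l') (lpath l)
    & inverse l' && direct l ==> ~~ same_last (lpath l') (lpath l)].

(* The word w_n ... w_1 is represented by the list [:: w_1; ...; w_n]. *)
Definition letters_linked (w : seq letter) : bool :=
  all nontrivial_letter w && sorted (fun l l' => linked l' l) w.

Definition nontrivial_string (w : seq letter) : bool :=
  ~~ nilp w && letters_linked w.

(* A homotopy string is given by the vertex and the degree at its end 0, and by
   the list [:: w_1; ...; w_n] of its nontrivial letters. If this list is empty
   then it is the trivial string (1_x, i, i), x = sbase, i = sdeg. *)
Record hstring := HString {
  sbase : vert G; sdeg : int; sletters : seq letter }.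

Definition is_hstring (u : hstring) : bool :=
  letters_linked (sletters u) &&
  (if sletters u is w1 :: _ then (sbase u == lsrc w1) && (sdeg u == lj w1)
   else true).

Definition power (w : seq letter) (m : nat) : seq letter :=
  flatten (nseq m w).

(* last w1 w' is w_n. *)
Definition is_band (w : seq letter) : Prop :=
  nontrivial_string w /\
  (if w is w1 :: w' then
     let wn := last w1 w' in
     [&& lsrc w1 == ltgt wn, li wn == lj w1
       & direct wn && inverse w1 || inverse wn && direct w1]
   else false) /\
  (forall (v : seq letter) (m : nat), nontrivial_string v -> (1 < m)%N ->
     w <> power v m) /\
  (forall m : nat, (0 < m)%N -> nontrivial_string (power w m)).

(* The matrix whose only entry is the path of l, where l joins the vertices hi
   and lo of a string (hi = r, lo = r - 1 for l = w_r). *)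
Definition contrib (N : finType) (l : letter) (hi lo a b : N) : A :=
  if (a, b) == (if direct l then (hi, lo) else (lo, hi)) then ev (lpath l)
  else 0.

Definition nth_letter (w : seq letter) (q : 'I_(size w)) : letter :=
  tnth (in_tuple w) q.

Definition string_complex (u : hstring) : complex :=
  let w := sletters u in
  @Complex 'I_(size w).+1
    (fun r => if unlift ord0 r is Some q then ltgt (nth_letter q) else sbase u)
    (fun r => if unlift ord0 r is Some q then li (nth_letter q) else sdeg u)
    [ffun ab => \sum_(q < size w)
       contrib (nth_letter q) (lift ord0 q) (widen_ord (leqnSn _) q)
         ab.1 ab.2].

(* The index q : 'I_n represents the vertex q + 1 of the band w_n ... w_1; the
   letter w_(q + 1) joins it to the vertex represented by ord_pred q, where
   the vertex 0 is the vertex n. *)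
Definition band_contrib (w : seq letter) (q a b : 'I_(size w)) : A :=
  contrib (nth_letter q) q (ord_pred q) a b.

Definition band_diff (w : seq letter) (lam : k) (a b : 'I_(size w)) : A :=
  \sum_(q < size w)
    (if q == 0%N :> nat then lam else 1) *: band_contrib q a b.

Definition band_super (w : seq letter) (a b : 'I_(size w)) : A :=
  \sum_(q < size w | q == 0%N :> nat) band_contrib q a b.

(* B_(w, lam, r); the index (i, q) is the i-th copy of the vertex q + 1. *)
Definition band_complex (w : seq letter) (lam : k) (r : nat) : complex :=
  @Complex ('I_r * 'I_(size w))%type
    (fun iq => ltgt (nth_letter iq.2))
    (fun iq => li (nth_letter iq.2))
    [ffun xy : ('I_r * 'I_(size w)) * ('I_r * 'I_(size w)) =>
       if xy.2.1 == xy.1.1 then band_diff lam xy.1.2 xy.2.2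
       else if xy.2.1 == xy.1.1.+1 :> nat then band_super xy.1.2 xy.2.2
       else 0].

Section Complexes.
Hypothesis presG : presents.

Lemma idem_ev (p : qpath) : idem (ptgt p) * ev p = ev p.
Proof.
case: presG => idemM _ genE _; case: p => x [|a s] /=; rewrite /ev /ptgt /=.
  by rewrite idemM eqxx.
by rewrite mulrA -genE !mulrA idemM eqxx.
Qed.

Lemma ev_idem (p : qpath) : ev p * idem (psrc p) = ev p.
Proof.
case: presG => idemM _ _ _; case: p => x s; rewrite /ev /=.
by elim: s => [|a s IH] /=; [rewrite idemM eqxx|rewrite -mulrA IH].
Qed.

Lemma ev_pcat (p q : qpath) : psrc p = ptgt q -> ev (pcat p q) = ev p * ev q.
Proof.
case: p => x s pq; rewrite /pcat {1}/ev /= foldr_cat -/(ev q).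
rewrite -[in LHS]idem_ev -pq [in RHS]/ev /=.
by rewrite /psrc /=; elim: s {pq} => [|a s /= ->]; rewrite ?mulrA.
Qed.

Section Contrib.
Variables (N Q : finType) (l : Q -> letter) (hi lo : Q -> N).
Variables (vt : N -> vert G) (dg : N -> int).
Hypothesis nt : forall q, nontrivial_letter (l q).

Let inverseE q : inverse (l q) = ~~ direct (l q).
Proof.
case/and5P: (nt q) => _ _ _ + _; rewrite /inverse /direct -leNgt le_eqVlt.
by rewrite eq_sym => /negPf ->.
Qed.

Lemma contrib_hom q a b :
    vt (hi q) = ltgt (l q) -> vt (lo q) = lsrc (l q) ->
    dg (hi q) = li (l q) -> dg (lo q) = lj (l q) ->
  projhom (vt a) (vt b) (contrib (l q) (hi q) (lo q) a b)
  /\ (contrib (l q) (hi q) (lo q) a b != 0 -> dg b = dg a + 1).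
Proof.
rewrite /ltgt /lsrc inverseE /contrib /projhom.
case/and5P: (nt q) => _ _ dist neq _.
have: direct (l q) = (li (l q) < lj (l q)) by [].
case: (direct (l q)) => /= dir vhi vlo dhi dlo;
  case: (@eqP _ (a, b)) => [[-> ->]|_];
  rewrite ?(mulr0, mul0r, eqxx) //;
  rewrite ?(vhi, vlo, dhi, dlo) idem_ev ev_idem eqxx; split=> // _; move: dist neq dir; lia.
Qed.

Lemma contribM q q' a c :
    injective hi -> injective lo ->
    (forall q q', lo q = hi q' -> linked (l q) (l q')) ->
  \sum_(b : N) contrib (l q) (hi q) (lo q) a b
               * contrib (l q') (hi q') (lo q') b c = 0.
Proof.
move=> hinj linj lk; apply: big1 => b _; rewrite /contrib.
case: eqP => [|_]; last by rewrite mul0r.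
case: eqP => [|_]; last by rewrite mulr0.
case d: (direct (l q)); case d': (direct (l q')) => -[eb _] [_ eb'].
- have /and5P[_ /eqP st] : linked (l q) (l q') by apply: lk; rewrite -eb'.
  rewrite d d' /= => /eqP id0 _ _; rewrite -ev_pcat //.
  by move: st; rewrite /lsrc /ltgt !inverseE d d'.
- have e : q = q' by apply: linj; rewrite -eb'.
  by rewrite e d' in d.
- have e : q = q' by apply: hinj; rewrite -eb'.
  by rewrite e d' in d.
- have /and5P[_ /eqP st _] : linked (l q') (l q) by apply: lk; rewrite -eb.
  rewrite !inverseE d d' /= => /eqP id0 _; rewrite -ev_pcat //.
  by move: st; rewrite /lsrc /ltgt !inverseE d d'.
Qed.

End Contrib.

Lemma nth_letterE (w : seq letter) (l0 : letter) (q : 'I_(size w)) :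
  nth_letter q = nth l0 w q.
Proof. by rewrite /nth_letter (tnth_nth l0). Qed.

Lemma nt_nth_letter (w : seq letter) (q : 'I_(size w)) :
  letters_linked w -> nontrivial_letter (nth_letter q).
Proof.
case/andP => nt _; have l0 := nth_letter q.
by rewrite (nth_letterE l0); apply: (all_nthP l0 nt); exact: ltn_ord.
Qed.

Lemma string_complexP (u : hstring) : is_hstring u ->
  is_complex (string_complex u).
Proof.
case: u => x i w /andP[/= ll base].
have nt := fun q => nt_nth_letter q ll.
have lk (q q' : 'I_(size w)) : widen_ord (leqnSn _) q = lift ord0 q' ->
    linked (nth_letter q) (nth_letter q').
  move=> /(congr1 val) /=; rewrite /bump /= add1n => qq'.
  have l0 := nth_letter q; rewrite !(nth_letterE l0) qq'.
  case/andP: ll => _ /(sortedP l0); apply.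
  by rewrite -[X in (X < _)%N]qq'.
have base0 (q : 'I_(size w)) : q = 0%N :> nat ->
    x = lsrc (nth_letter q) /\ i = lj (nth_letter q).
  move=> q0; case: w q q0 base {ll nt lk} => [[//]|w1 w'] q q0.
  by rewrite (nth_letterE w1) q0 => /andP[/eqP -> /eqP ->].
have hi_inj : injective (lift (ord0 : 'I_(size w).+1)) by exact: lift_inj.
have lo_inj : injective (widen_ord (leqnSn (size w))).
  by move=> q q' /(congr1 val) /= /val_inj.
set X := string_complex _; split=> [a b|].
  rewrite /diff /= ffunE /=.
  have E q : projhom (cvert (a : cidx X)) (cvert (b : cidx X))
        (contrib (nth_letter q) (lift ord0 q) (widen_ord (leqnSn _) q) a b)
      /\ (contrib (nth_letter q) (lift ord0 q) (widen_ord (leqnSn _) q) a b != 0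
          -> cdeg (b : cidx X) = cdeg (a : cidx X) + 1).
    apply: (contrib_hom (l := @nth_letter w) (vt := @cvert X)
      (dg := @cdeg X)) => //=.
    - by rewrite liftK.
    - case: unliftP => [q' /lk /and3P[_ /eqP ->]//|/(congr1 val) /= q0].
      by case: (base0 q q0).
    - by rewrite liftK.
    - case: unliftP => [q' /lk /and3P[/eqP ->]//|/(congr1 val) /= q0].
      by case: (base0 q q0).
  split.
    rewrite /projhom mulr_sumr mulr_suml; apply/eqP/eq_bigr => q _.
    by have [/eqP + _] := E q.
  case: (boolP [exists q, contrib (nth_letter q) (lift ord0 q)
    (widen_ord (leqnSn _) q) a b != 0]) => [/existsP[q qn0] _|].
    by have [_] := E q; exact.
  by rewrite negb_exists => /forallP n0; rewrite big1 ?eqxx // => q _;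
     apply/eqP; rewrite -[_ == _]negbK.
apply/ffunP => -[a c]; rewrite !ffunE /=.
under eq_bigr => b _ do rewrite /diff /= !ffunE /= big_distrlr.
rewrite exchange_big big1 //= => q _; rewrite exchange_big big1 //= => q' _.
exact: contribM.
Qed.

Lemma ord_pred_inj n : injective (@ord_pred n).
Proof. exact: can_inj (@ord_predK n). Qed.

Lemma band_linked (w : seq letter) (q : 'I_(size w)) : is_band w ->
  linked (nth_letter q) (nth_letter (ord_pred q)).
Proof.
move=> [_ [_ [_ /(_ 2%N isT) /andP[_ /andP[_]]]]].
rewrite /power /= cats0; have l0 := nth_letter q.
move=> /(sortedP l0) /(_ (q + size w).-1).
have n0 : (0 < size w)%N by case: (size w) q => [[]|].
rewrite size_cat prednK ?addn_gt0 ?n0 ?orbT // ltn_add2r ltn_ord => /(_ isT).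
rewrite !nth_cat !(nth_letterE l0) /= ltnNge leq_addl /= addnK.
case: ifP => lt; first by rewrite modn_small.
have e : (q + size w).-1 = (((q + size w).-1 - size w) + size w)%N.
  by rewrite subnK // leqNgt lt.
rewrite [in ((q + size w).-1 %% _)%N]e modnDr modn_small //.
by have := ltn_ord q; lia.
Qed.

Lemma band_complexP (w : seq letter) (lam : k) (r : nat) : is_band w ->
  is_complex (band_complex w lam r).
Proof.
move=> bw; have lk q := band_linked q bw.
have ll : letters_linked w by case: bw => /andP[].
have nt := fun q => nt_nth_letter q ll.
pose C q (i j : 'I_r) : k :=
  if j == i then (if q == 0%N :> nat then lam else 1)
  else if j == i.+1 :> nat then (q == 0%N :> nat)%:R else 0.
set X := band_complex _ _ _.
have XE (x y : cidx X) : cdiff X (x, y) =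
    \sum_(q < size w) C q x.1 y.1 *: band_contrib q x.2 y.2.
  rewrite ffunE /= /C; case: eqP => // _; case: eqP => _.
    rewrite /band_super big_mkcond; apply: eq_bigr => q _.
    by case: eqP => _; rewrite ?scale1r ?scale0r.
  by rewrite big1 // => q _; rewrite scale0r.
split=> [x y|].
  rewrite /diff XE.
  have E q : projhom (cvert x) (cvert y) (band_contrib q x.2 y.2)
      /\ (band_contrib q x.2 y.2 != 0 -> cdeg y = cdeg x + 1).
    apply: (contrib_hom (l := @nth_letter w) (hi := id) (lo := @ord_pred _)
      (vt := fun q => ltgt (nth_letter q))
      (dg := fun q => li (nth_letter q))) => //.
      by have /and3P[_ /eqP ->] := lk q.
    by have /and3P[/eqP ->] := lk q.
  split.
    rewrite /projhom mulr_sumr mulr_suml; apply/eqP/eq_bigr => q _.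
    by have [/eqP + _] := E q; rewrite -scalerAr -scalerAl => ->.
  case: (boolP [exists q, band_contrib q x.2 y.2 != 0]) => [/existsP[q qn0] _|].
    by have [_] := E q; exact.
  rewrite negb_exists => /forallP n0; rewrite big1 ?eqxx // => q _.
  by move/negPn/eqP: (n0 q) => ->; rewrite scaler0.
apply/ffunP => -[x z]; rewrite !ffunE.
under eq_bigr => y _ do rewrite /diff /= !XE /= big_distrlr.
rewrite exchange_big big1 //= => q _; rewrite exchange_big big1 //= => q' _.
rewrite -(pair_bigA _ (fun j b => (C q x.1 j *: band_contrib q x.2 b) *
  (C q' j z.1 *: band_contrib q' b z.2))) /= big1 // => j _.
under eq_bigr => b _ do rewrite -scalerAl -scalerAr scalerA.
rewrite -scaler_sumr (contribM (l := @nth_letter w) (hi := id)) ?scaler0 //.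
  exact: ord_pred_inj.
by move=> p p' <-.
Qed.

End Complexes.

End Quiver.

(* Main.v *)
Require Import Defs.
From HB Require Import structures.
From mathcomp Require Import all_boot all_order all_algebra all_field.
From mathcomp Require Import zify ring boolp.
Import Order.TTheory GRing.Theory Num.Theory.
Local Open Scope ring_scope.

Set Implicit Arguments.
Unset Strict Implicit.
Unset Printing Implicit Defensive.

(* The Hom complex of two string or band complexes X and Y has a basis of
   triples (a, b, p), where a and b are vertices of X and Y and p is a nonzero
   path, and each letter of X or Y joins at most two of them under the
   differential.  For a pair of letters with the same path ("matched"), the
   identity at one end is linked through this path to the identity at the other
   end, so the matched pairs form walks.

   If a walk ends, a potential along it exists, and conjugating by powers of
   the normalised Jordan blocks given by this potential turns all blocks into
   scalars.  Hence the corresponding part of the Hom complex of B_(v,lam,r) and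
   B_(w,mu,s) is the sum of r s copies of the one for r = s = 1; a string
   counts as a band with 1 x 1 blocks.

   A walk which never ends (a "perpetual" one) exists only for two bands, and it
   identifies v with w up to rotation, inversion and a shift of degrees.  Its
   part of the Hom complex is given by families of matrices along the band
   which intertwine the blocks; such a family amounts to a matrix
   intertwining the Jordan block of lam with that of mu or its inverse.  So if
   lam is not the matching eigenvalue, this part is acyclic; otherwise, in
   degree 0, its contribution is min(r, s), and in degree -1 there would be an
   isomorphism between B_(w,mu,1) and the shift of B_(v,lam,1), which is
   excluded.

   A chain map of one-dimensional band complexes is an isomorphism iff its
   component along a perpetual walk is nonzero: its other components between
   identities strictly decrease the words read from the vertices of the bands. *)

(** * The path basis *)

(** No explicit basis of a space of morphisms in the derived category is built. The dimension of
    chain maps minus that of null-homotopic maps is computed, and both split along a projection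
    [ncp] of the Hom complex that commutes with composition with either differential. The obstacle
    to removing Jordan blocks by conjugation is monodromy: a potential exists only where no closed
    walk through identities imposes a relation. Basis elements with nontrivial paths cause no
    trouble, because such a path has at most one neighbouring letter on each side, so they form at
    worst squares, whose constants are free unless an identity is linked to them. That a perpetual
    walk identifies two whole bands rests on two facts: a band is no proper power, and it cannot
    read like its own inverse, since the two readings would meet. Isomorphisms can be detected on
    identity components because differentials consist of paths of positive length, so homotopies do
    not change these components. *)

Section PathBasis.
Variables (k : fieldType) (A : falgType k) (G : quiver_in A).
Hypothesis hG : gentle_algebra G.

Local Notation qpath := (qpath G).
Local Notation R := (@nonzero_rel _ _ G).

Let presG : presents G. Proof. by case: hG. Qed.

Definition npath (p : qpath) : bool := is_path p && ~~ in_ideal p.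

Lemma gen_idem (a : arr G) : gen a * idem (src a) = gen a.
Proof. by case: presG => idemM _ genE _; rewrite -[gen a]genE -mulrA idemM eqxx. Qed.

Lemma gen_gen_eq0 (a b : arr G) : composable a b -> ~~ R a b ->
  gen a * gen b = 0.
Proof. by rewrite /nonzero_rel => -> /=; rewrite negbK /in_ideal /ev /= gen_idem => /eqP. Qed.

(** [quadratic_monomial] applied to the one-term relation [1 *: ev p = 0] exhibits two consecutive
    arrows of [p] with zero product. *)
Lemma in_idealE (p : qpath) : is_path p -> in_ideal p = ~~ sorted R p.2.
Proof.
move=> pp; apply/idP/idP => [p0|]; last first.
  case: p pp => x; rewrite /is_path /in_ideal /ev /=.
  elim=> [|a [|b s] IH] //=.
  case/and3P => ab bs ws; rewrite negb_and => /orP[nR|ns].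
    by rewrite mulrA gen_gen_eq0 ?mul0r.
  by rewrite /= in IH; rewrite (eqP (IH _ ns)) ?mulr0 // bs ws.
case: hG => _ _ [_ _ _ qm]; apply/negP => sp.
have := qm [:: p] (fun=> 1) isT _ _ p (mem_head _ _) (oner_neq0 _).
rewrite /= pp big_seq1 scale1r => /(_ isT (eqP p0)) [q1 [q2 [a [b [e z]]]]].
move: sp; rewrite e => /cat_sorted2[_] /= /andP[].
by rewrite /nonzero_rel z andbF.
Qed.

Lemma npathE (p : qpath) : npath p = is_path p && sorted R p.2.
Proof. by rewrite /npath; case: (boolP (is_path p)) => //= /in_idealE ->; rewrite negbK. Qed.

Lemma npath_idem x : npath (x, [::]).
Proof. by rewrite npathE. Qed.

(** A path with nonzero coefficient in a relation contains two arrows with zero product, which a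
    nonzero path cannot. *)
Lemma npath_indep (s : seq qpath) (c : qpath -> k) : uniq s -> all npath s ->
  \sum_(p <- s) c p *: ev p = 0 -> forall p, p \in s -> c p = 0.
Proof.
move=> us /allP ns s0 p ps; apply/eqP/negPn/negP => cp.
case: hG => _ _ [_ _ _ qm].
have [|q1 [q2 [a [b [e z]]]]] := qm s c us _ s0 p ps cp.
  by apply/allP => q /ns /andP[].
move: (ns p ps); rewrite npathE e => /andP[_ /cat_sorted2[_]] /= /andP[].
by rewrite /nonzero_rel z andbF.
Qed.

Lemma evs_nth (s : seq qpath) (i : 'I_(size s)) :
  (map_tuple (@ev _ _ G) (in_tuple s))`_i = ev (tnth (in_tuple s) i).
Proof. by rewrite -tnth_nth tnth_map. Qed.

Lemma npath_free (s : seq qpath) : uniq s -> all npath s ->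
  free (map_tuple (@ev _ _ G) (in_tuple s)).
Proof.
move=> us ns; apply/freeP => c; rewrite /= => s0 i.
pose c' p := \sum_(j < size s | tnth (in_tuple s) j == p) c j.
have tinj : injective (tnth (in_tuple s)) by apply/tuple_uniqP.
have c'E j : c' (tnth (in_tuple s) j) = c j.
  rewrite /c' (bigD1 j) //= big1 ?addr0 // => j' /andP[/eqP /tinj ->].
  by rewrite eqxx.
rewrite -c'E; apply: (npath_indep us ns); last exact: mem_tnth.
rewrite big_tnth -[RHS]s0; apply: eq_bigr => j _.
by rewrite c'E -evs_nth.
Qed.

Lemma npath_size_dim (s : seq qpath) : uniq s -> all npath s ->
  (size s <= \dim {:A})%N.
Proof.
move=> us ns; have := npath_free us ns; rewrite /free size_map => /eqP <-.
by apply: dimvS; rewrite subvf.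
Qed.

Lemma ptgt_pcat (p q : qpath) : psrc p = ptgt q -> ptgt (pcat p q) = ptgt p.
Proof. by case: p q => [x [|a s]] [y t] //= <-. Qed.

Lemma is_path_pcat (p q : qpath) : psrc p = ptgt q ->
  is_path (pcat p q) = is_path p && is_path q.
Proof.
case: p q => [x s] [y t]; rewrite /is_path /pcat /psrc /=.
elim: s => [|a s IH] //= xy; rewrite IH // andbA; congr (_ && _ && _).
by case: s {IH} => [|b s] //=; rewrite -xy.
Qed.

Lemma npath_drop x s i : npath (x, s) -> npath (x, drop i s).
Proof.
rewrite -{1}(cat_take_drop i s) !npathE /= => /andP[+ /cat_sorted2[_ ->]].
rewrite andbT /is_path /=; elim: (take i s) => //= a s' IH /andP[_]; exact: IH.
Qed.

(** The initial subpaths of a nonzero path are nonzero and of different lengths, hence linearly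
    independent. The bound leaves only finitely many nonzero paths, so that [npaths] can list
    them. *)
Lemma npath_size (p : qpath) : npath p -> (size p.2 < \dim {:A})%N.
Proof.
case: p => x s /= ps.
rewrite -(size_iota 0 (size s).+1) -(size_map (fun i => (x, drop i s) : qpath)).
apply: npath_size_dim; last by apply/allP => _ /mapP[i _ ->]; exact: npath_drop.
rewrite map_inj_in_uniq ?iota_uniq // => i j; rewrite !mem_iota /= !add0n !ltnS.
by move=> ile jle [/(congr1 size)]; rewrite !size_drop; lia.
Qed.

Definition npaths : seq qpath :=
  [seq p <- [seq (x, val t) | x <- enum (vert G),
       t <- enum {: (\dim {:A}).-bseq (arr G)}] | npath p].

Lemma npaths_uniq : uniq npaths.
Proof.
apply/filter_uniq/allpairs_uniq; rewrite ?enum_uniq // => -[x t] [y t'] _ _ /=.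
by case=> -> /val_inj ->.
Qed.

Lemma mem_npaths p : (p \in npaths) = npath p.
Proof.
rewrite mem_filter; case: (boolP (npath p)) => // np /=.
case: p np => x s np; apply/allpairsP.
have ls : (size s <= \dim {:A})%N := ltnW (npath_size np).
by exists (x, Bseq ls); rewrite !mem_enum; split.
Qed.

Let XB := map_tuple (@ev _ _ G) (in_tuple npaths).

Let XB_free : free XB.
Proof. by apply: npath_free; [exact: npaths_uniq|apply/allP => p; rewrite mem_npaths]. Qed.

Let XB_span u : u \in <<XB>>%VS.
Proof.
case: presG => _ _ _ /(_ u) [s [c [/allP sp ->]]].
rewrite big_seq; apply: rpred_sum => p /sp pp; apply: rpredZ.
case: (boolP (npath p)) => np; last first.
  by move: np; rewrite /npath pp /= negbK => /eqP ->; exact: mem0v.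
by apply: memv_span; rewrite map_f //= mem_npaths.
Qed.

(** The sum has one term if [p] is a nonzero path and none otherwise, which makes the coefficient a
    total function of [p]. *)
Definition pcoef (p : qpath) (u : A) : k :=
  \sum_(i < size npaths | tnth (in_tuple npaths) i == p) coord XB i u.

Lemma pcoef_is_linear p : linear (pcoef p : A -> k^o).
Proof.
move=> c u v; rewrite /pcoef scaler_sumr -big_split /=.
by apply: eq_bigr => i _; rewrite linearP.
Qed.
HB.instance Definition _ p := GRing.isLinear.Build k A k^o *:%R (pcoef p)
  (pcoef_is_linear p).

Lemma pcoefD p u v : pcoef p (u + v) = pcoef p u + pcoef p v.
Proof. exact: linearD. Qed.
Lemma pcoefZ p c u : pcoef p (c *: u) = c * pcoef p u.
Proof. exact: linearZ. Qed.
Lemma pcoef0 p : pcoef p 0 = 0. Proof. exact: linear0. Qed.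
Lemma pcoefN p u : pcoef p (- u) = - pcoef p u. Proof. exact: linearN. Qed.
Lemma pcoef_sum p (I : Type) (r : seq I) (P : pred I) F :
  pcoef p (\sum_(i <- r | P i) F i) = \sum_(i <- r | P i) pcoef p (F i).
Proof. exact: linear_sum. Qed.

Lemma pcoef_npathF p u : ~~ npath p -> pcoef p u = 0.
Proof.
move=> np; rewrite /pcoef big_pred0 // => i; apply/eqP => e.
by move: np; rewrite -mem_npaths -e mem_tnth.
Qed.

Let tinj : injective (tnth (in_tuple npaths)).
Proof. by apply/tuple_uniqP; exact: npaths_uniq. Qed.

Let pcoef_tnth i u : pcoef (tnth (in_tuple npaths) i) u = coord XB i u.
Proof.
rewrite /pcoef (bigD1 i) //= big1 ?addr0 // => j /andP[/eqP /tinj ->].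
by rewrite eqxx.
Qed.

Lemma pcoefE u : u = \sum_(p <- npaths) pcoef p u *: ev p.
Proof.
rewrite {1}(coord_span (XB_span u)) [RHS]big_tnth; apply: eq_bigr => i _.
by rewrite pcoef_tnth evs_nth.
Qed.

Lemma pcoef_ev p q : npath q -> pcoef p (ev q) = (p == q)%:R.
Proof.
rewrite -mem_npaths => qB; rewrite /pcoef.
have [i qi] : exists i, q = tnth (in_tuple npaths) i by apply/tnthP.
have -> : ev q = XB`_i by rewrite evs_nth -qi.
under eq_bigr => j _ do rewrite (coord_free _ _ XB_free).
case: eqP => [->|ne].
  rewrite (bigD1 i) ?qi //= eqxx big1 ?addr0 // => j /andP[/eqP /tinj ->].
  by rewrite eqxx.
rewrite big1 // => j /eqP jp; case: eqP => // ij.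
by case: ne; rewrite -jp qi ij.
Qed.

Lemma pcoef_ext u v : (forall p, npath p -> pcoef p u = pcoef p v) -> u = v.
Proof.
move=> e; rewrite [u]pcoefE [v]pcoefE; rewrite big_seq [RHS]big_seq.
by apply: eq_bigr => p; rewrite mem_npaths => /e ->.
Qed.

Lemma ev_mul (p q : qpath) :
  ev p * ev q = if psrc p == ptgt q then ev (pcat p q) else 0.
Proof.
case: eqP => [e|/eqP e]; first by rewrite ev_pcat.
rewrite -(ev_idem presG p) -(idem_ev presG q) mulrA -(mulrA (ev p)).
by case: presG => -> _ _ _; rewrite (negPf e) mulr0 mul0r.
Qed.

Lemma pcat_npathl (p q : qpath) : psrc p = ptgt q -> npath (pcat p q) -> npath p.
Proof.
move=> e /andP[pp nz]; rewrite /npath; move: pp; rewrite is_path_pcat // => /andP[-> _].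
apply/eqP => p0; case/eqP: nz; have := ev_mul p q; rewrite e eqxx => <-.
by rewrite p0 mul0r.
Qed.

Lemma pcat_npathr (p q : qpath) : psrc p = ptgt q -> npath (pcat p q) -> npath q.
Proof.
move=> e /andP[pp nz]; rewrite /npath; move: pp; rewrite is_path_pcat // => /andP[_ ->].
apply/eqP => p0; case/eqP: nz; have := ev_mul p q; rewrite e eqxx => <-.
by rewrite p0 mulr0.
Qed.

Lemma pcat_injr (p q q' : qpath) : ptgt q = psrc p -> ptgt q' = psrc p ->
  pcat p q = pcat p q' -> q = q'.
Proof.
case: p q q' => [x s] [y t] [y' t'] _ _ [->] /eqP.
by rewrite eqseq_cat // eqxx /= => /eqP ->.
Qed.

Lemma pcat_injl (p p' q : qpath) : psrc p = ptgt q -> psrc p' = ptgt q ->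
  pcat p q = pcat p' q -> p = p'.
Proof.
case: p p' q => [x s] [x' s'] [y t]; rewrite /psrc /= => -> -> [] /eqP.
have [/eqP ss|ss] := eqVneq (size s) (size s').
  by rewrite eqseq_cat ?(eqP ss) // eqxx andbT => /eqP ->.
by move=> /eqP /(congr1 size); rewrite !size_cat => /addIn e; rewrite e eqxx in ss.
Qed.

Lemma pcoef_mulEl v p0 u : npath v -> npath p0 -> pcoef p0 (ev v * u) =
  \sum_(p <- npaths | (psrc v == ptgt p) && (p0 == pcat v p)) pcoef p u.
Proof.
move=> nv n0; rewrite {1}[u]pcoefE big_distrr pcoef_sum [RHS]big_mkcond /=.
rewrite big_seq [RHS]big_seq; apply: eq_bigr => p; rewrite mem_npaths => np.
rewrite -scalerAr pcoefZ ev_mul; case: eqP => [e|] /=; last by rewrite pcoef0 mulr0.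
case: (boolP (npath (pcat v p))) => [/pcoef_ev ->|nn].
  by case: eqP; rewrite ?mulr1 ?mulr0.
case: eqP => [e0|_]; first by rewrite -e0 n0 in nn.
suff -> : ev (pcat v p) = 0 by rewrite pcoef0 mulr0.
move: nn; rewrite /npath is_path_pcat //.
by case/andP: nv => -> _; case/andP: np => -> _ /=; rewrite negbK => /eqP.
Qed.

Lemma pcoef_mulEr v p0 u : npath v -> npath p0 -> pcoef p0 (u * ev v) =
  \sum_(p <- npaths | (psrc p == ptgt v) && (p0 == pcat p v)) pcoef p u.
Proof.
move=> nv n0; rewrite {1}[u]pcoefE big_distrl pcoef_sum [RHS]big_mkcond /=.
rewrite big_seq [RHS]big_seq; apply: eq_bigr => p; rewrite mem_npaths => np.
rewrite -scalerAl pcoefZ ev_mul; case: eqP => [e|] /=; last by rewrite pcoef0 mulr0.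
case: (boolP (npath (pcat p v))) => [/pcoef_ev ->|nn].
  by case: eqP; rewrite ?mulr1 ?mulr0.
case: eqP => [e0|_]; first by rewrite -e0 n0 in nn.
suff -> : ev (pcat p v) = 0 by rewrite pcoef0 mulr0.
move: nn; rewrite /npath is_path_pcat //.
by case/andP: nv => -> _; case/andP: np => -> _ /=; rewrite negbK => /eqP.
Qed.

Lemma pcoef_mull v p u : psrc v = ptgt p -> npath (pcat v p) ->
  pcoef (pcat v p) (ev v * u) = pcoef p u.
Proof.
move=> e n0; rewrite pcoef_mulEl ?(pcat_npathl e) //.
have pB : p \in npaths by rewrite mem_npaths (pcat_npathr e).
rewrite -big_filter (_ : filter _ _ = [:: p]) ?big_seq1 //.
rewrite -[RHS](filter_pred1_uniq npaths_uniq pB); apply: eq_filter => q /=.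
apply/andP/eqP => [[/eqP e1 /eqP e2]|->]; last by rewrite e !eqxx.
by apply/esym/(pcat_injr _ _ e2).
Qed.

Lemma pcoef_mulr v p u : psrc p = ptgt v -> npath (pcat p v) ->
  pcoef (pcat p v) (u * ev v) = pcoef p u.
Proof.
move=> e n0; rewrite pcoef_mulEr ?(pcat_npathr e) //.
have pB : p \in npaths by rewrite mem_npaths (pcat_npathl e).
rewrite -big_filter (_ : filter _ _ = [:: p]) ?big_seq1 //.
rewrite -[RHS](filter_pred1_uniq npaths_uniq pB); apply: eq_filter => q /=.
apply/andP/eqP => [[/eqP e1 /eqP e2]|->]; last by rewrite e !eqxx.
by apply/esym/(pcat_injl _ _ e2).
Qed.

Lemma pcoef_mull_neq0 v p0 u : npath v -> pcoef p0 (ev v * u) != 0 ->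
  exists p, [/\ psrc v = ptgt p, p0 = pcat v p, npath p0 & pcoef p u != 0].
Proof.
move=> nv; case: (boolP (npath p0)) => [n0|/pcoef_npathF ->]; last by rewrite eqxx.
rewrite pcoef_mulEl // => nz.
have /hasP[p _ /andP[/andP[/eqP e1 /eqP e2] cp]] : has (fun p =>
   ((psrc v == ptgt p) && (p0 == pcat v p)) && (pcoef p u != 0)) npaths.
  apply: contraNT nz => /hasPn h; apply/eqP.
  rewrite big_seq_cond big1 // => p /andP[/h + c]; rewrite c /= negbK => /eqP //.
by exists p.
Qed.

Lemma pcoef_mulr_neq0 v p0 u : npath v -> pcoef p0 (u * ev v) != 0 ->
  exists p, [/\ psrc p = ptgt v, p0 = pcat p v, npath p0 & pcoef p u != 0].
Proof.
move=> nv; case: (boolP (npath p0)) => [n0|/pcoef_npathF ->]; last by rewrite eqxx.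
rewrite pcoef_mulEr // => nz.
have /hasP[p _ /andP[/andP[/eqP e1 /eqP e2] cp]] : has (fun p =>
   ((psrc p == ptgt v) && (p0 == pcat p v)) && (pcoef p u != 0)) npaths.
  apply: contraNT nz => /hasPn h; apply/eqP.
  rewrite big_seq_cond big1 // => p /andP[/h + c]; rewrite c /= negbK => /eqP //.
by exists p.
Qed.

(** A diagonal operator in the path basis. It serves both to cut out part of the basis and to
    rescale coefficients path by path. *)
Definition mult (g : qpath -> k) (u : A) : A :=
  \sum_(p <- npaths) (g p * pcoef p u) *: ev p.

Lemma pcoef_mult g p u : pcoef p (mult g u) = g p * pcoef p u.
Proof.
case: (boolP (npath p)) => [np|np]; last by rewrite !pcoef_npathF ?mulr0.
rewrite /mult pcoef_sum (bigD1_seq p) ?npaths_uniq ?mem_npaths //=.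
rewrite pcoefZ pcoef_ev // eqxx mulr1 big_seq_cond big1 ?addr0 // => q.
by rewrite mem_npaths pcoefZ => /andP[nq /negPf qp]; rewrite pcoef_ev // eq_sym qp mulr0.
Qed.

Lemma projhom_coef (y x : vert G) (u : A) : projhom y x u <->
  forall p, pcoef p u != 0 -> ptgt p = y /\ psrc p = x.
Proof.
have idE z : idem z = ev (z, [::]) :> A by [].
split=> [/eqP <- p|h]; last first.
  apply/eqP; rewrite [in LHS](pcoefE u) big_distrr big_distrl [RHS]pcoefE /=.
  apply: eq_bigr => p _; have [->|cp] := eqVneq (pcoef p u) 0.
    by rewrite !scale0r mulr0 mul0r.
  have [<- <-] := h p cp.
  by rewrite -scalerAr -scalerAl idem_ev // ev_idem.
rewrite !idE => /(pcoef_mulr_neq0 (npath_idem x))[q [e1 e2 _]].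
case/(pcoef_mull_neq0 (npath_idem y)) => q' [e1' e2' _ _].
by subst p q; rewrite !ptgt_pcat.
Qed.

Lemma pcoef_idem p x : pcoef p (idem x) = (p == (x, [::]))%:R.
Proof. exact: pcoef_ev (npath_idem x). Qed.

End PathBasis.

(** * Classes of path ends *)

Section Ends.
Variables (k : fieldType) (A : falgType k) (G : quiver_in A).
Hypothesis hG : gentle_algebra G.

Local Notation qpath := (qpath G).
Local Notation R := (@nonzero_rel _ _ G).
Local Notation Z := (@zero_rel _ _ G).

Lemma sorted_npath a (s : seq (arr G)) : sorted R (a :: s) ->
  npath (src (last a s), a :: s).
Proof.
move=> sa; rewrite npathE // sa andbT /is_path /=.
elim: s a sa => [|b s IH] a /=; first by rewrite /ptgt /= eqxx.
case/andP => /andP[ab _] /IH ->; by rewrite andbT.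
Qed.

Lemma path_size a (s : seq (arr G)) : path R a s -> (size s < \dim {:A})%N.
Proof. by move=> /(@sorted_npath a s) /(npath_size hG) /=; exact: ltnW. Qed.

(** Going round such a cycle would give nonzero paths of any length, against the finite dimension of
    [A]. *)
Lemma no_cycle a (s : seq (arr G)) : ~~ path R a (rcons s a).
Proof.
apply/negP => c; set p := rcons s a in c.
have lp : last a p = a by rewrite last_rcons.
have H m : path R a (flatten (nseq m p)) /\ last a (flatten (nseq m p)) = a.
  elim: m => [|m [IH1 IH2]] //=; by rewrite cat_path c lp IH1 last_cat lp IH2.
have := path_size (H (\dim {:A})).1; rewrite ltnNge; apply/negP/negPn.
rewrite size_flatten /shape map_nseq sumn_nseq leq_pmull //.
by rewrite /p size_rcons.
Qed.

Lemma sorted_uniq (s : seq (arr G)) : sorted R s -> uniq s.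
Proof.
elim: s => //= a s IH ps; rewrite IH ?(path_sorted ps) // andbT.
apply/negP => /splitPr as_; case: as_ ps => s1 s2.
by rewrite -cat_rcons cat_path (negPf (no_cycle _ _)).
Qed.

Lemma R_funr a b c : R a b -> R a c -> b = c.
Proof.
case: hG => _ _ [_ /(_ a)[/card_le1_eqP h _] _ _] ab ac.
by apply: h; rewrite inE.
Qed.
Lemma R_funl a b c : R b a -> R c a -> b = c.
Proof.
case: hG => _ _ [_ /(_ a)[_ /card_le1_eqP h] _ _] ab ac.
by apply: h; rewrite inE.
Qed.
Lemma Z_funr a b c : Z a b -> Z a c -> b = c.
Proof.
case: hG => _ _ [_ _ /(_ a)[/card_le1_eqP h _] _] ab ac.
by apply: h; rewrite inE.
Qed.
Lemma Z_funl a b c : Z b a -> Z c a -> b = c.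
Proof.
case: hG => _ _ [_ _ /(_ a)[_ /card_le1_eqP h] _] ab ac.
by apply: h; rewrite inE.
Qed.

Lemma ZE a b : src a = tgt b -> Z a b = ~~ R a b.
Proof. by rewrite /zero_rel /nonzero_rel /composable => /eqP ->; rewrite negbK. Qed.

Lemma src3 (a b c : arr G) : src a = src b -> src b = src c ->
  [|| a == b, b == c | a == c].
Proof.
move=> ab bc; apply/negPn/negP; rewrite !negb_or => /and3P[nab nbc nac].
case: hG => _ _ [/(_ (src a))[h _] _ _ _].
have : uniq [:: a; b; c] by rewrite /= !inE negb_or nab nac nbc.
move=> /card_uniqP e; suff : (size [:: a; b; c] <= 2)%N by [].
rewrite -e; apply: leq_trans h; apply: subset_leq_card; apply/subsetP => d.
by rewrite !inE => /or3P[] /eqP ->; rewrite ?ab ?bc ?eqxx.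
Qed.

Lemma tgt3 (a b c : arr G) : tgt a = tgt b -> tgt b = tgt c ->
  [|| a == b, b == c | a == c].
Proof.
move=> ab bc; apply/negPn/negP; rewrite !negb_or => /and3P[nab nbc nac].
case: hG => _ _ [/(_ (tgt a))[_ h] _ _ _].
have : uniq [:: a; b; c] by rewrite /= !inE negb_or nab nac nbc.
move=> /card_uniqP e; suff : (size [:: a; b; c] <= 2)%N by [].
rewrite -e; apply: leq_trans h; apply: subset_leq_card; apply/subsetP => d.
by rewrite !inE => /or3P[] /eqP ->; rewrite ?ab ?bc ?eqxx.
Qed.

(* [(true, Some a)] is the end of a path at the target of its last arrow [a],
   [(false, Some a)] is the end at the source of its first arrow [a].  The ends
   at a vertex fall into at most two classes, the classes of [same]. *)
Definition pend : Type := (bool * option (arr G))%type.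

Definition end_at (x : vert G) (e : pend) : bool :=
  if e.2 is Some a then (if e.1 then tgt a else src a) == x else false.

Definition same (e f : pend) : bool :=
  match e.2, f.2 with
  | Some a, Some b =>
      if e.1 == f.1 then a == b else if e.1 then R b a else R a b
  | _, _ => false
  end.

Lemma same_refl x e : end_at x e -> same e e.
Proof. by case: e => b [a|] //=; rewrite /same /= !eqxx. Qed.

Lemma same_sym e f : same e f = same f e.
Proof.
case: e f => b [a|] [b' [a'|]] //; rewrite /same /=.
by rewrite eq_sym; case: eqP => [_|]; [rewrite eq_sym|case: b b' => [] []].
Qed.

Lemma same_trans e f g : same e f -> same f g -> same e g.
Proof.
case: e f g => b [a|] [b' [a'|]] [b'' [a''|]] //; rewrite /same /=.
case: b; case: b'; case: b'' => //=; try by [move=> /eqP-> | move=> + /eqP <-].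
- by move=> h1 h2; apply/eqP/(R_funr h1 h2).
- by move=> h1 h2; apply/eqP/(R_funl h1 h2).
Qed.

(** Pigeonhole from gentleness: at most two arrows start, or end, at [x]; and two arrows on one side
    of [x] that both have zero product with an arrow on the other side coincide. *)
Lemma same3 x e f g : end_at x e -> end_at x f -> end_at x g ->
  [|| same e f, same f g | same e g].
Proof.
have S a b : src a = x -> tgt b = x -> ~~ R a b -> Z a b.
  by move=> ea eb; rewrite ZE ?ea.
case: e f g => b [a|] [b' [a'|]] [b'' [a''|]] //; rewrite /end_at /same /=;
  case: b; case: b'; case: b'' => /= /eqP e1 /eqP e2 /eqP e3.
- by apply: tgt3; rewrite ?e1 ?e2.
- case: (boolP (R a'' a')) => [_|/(S _ _ e3 e2) z1]; rewrite ?orbT //=.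
  case: (boolP (R a'' a)) => [_|/(S _ _ e3 e1) z2]; rewrite ?orbT //=.
  by rewrite (Z_funr z1 z2) eqxx.
- case: (boolP (R a' a)) => [_|/(S _ _ e2 e1) z1]; rewrite ?orbT //=.
  case: (boolP (R a' a'')) => [_|/(S _ _ e2 e3) z2]; rewrite ?orbT //=.
  by rewrite (Z_funr z1 z2) eqxx.
- case: (boolP (R a' a)) => [_|/(S _ _ e2 e1) z1]; rewrite ?orbT //=.
  case: (boolP (R a'' a)) => [_|/(S _ _ e3 e1) z2]; rewrite ?orbT //=.
  by rewrite (Z_funl z1 z2) eqxx.
- case: (boolP (R a a')) => [_|/(S _ _ e1 e2) z1]; rewrite ?orbT //=.
  case: (boolP (R a a'')) => [_|/(S _ _ e1 e3) z2]; rewrite ?orbT //=.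
  by rewrite (Z_funr z1 z2) eqxx.
- case: (boolP (R a a')) => [_|/(S _ _ e1 e2) z1]; rewrite ?orbT //=.
  case: (boolP (R a'' a')) => [_|/(S _ _ e3 e2) z2]; rewrite ?orbT //=.
  by rewrite (Z_funl z1 z2) eqxx.
- case: (boolP (R a' a'')) => [_|/(S _ _ e2 e3) z1]; rewrite ?orbT //=.
  case: (boolP (R a a'')) => [_|/(S _ _ e1 e3) z2]; rewrite ?orbT //=.
  by rewrite (Z_funl z1 z2) eqxx.
- by apply: src3; rewrite ?e1 ?e2.
Qed.

Lemma same_other x e e' f f' : end_at x e -> end_at x e' -> end_at x f ->
  end_at x f' -> same e f -> ~~ same e e' -> ~~ same f f' -> same e' f'.
Proof.
move=> ae ae' af af' ef ne nf.
case/or3P: (same3 af ae' af') => // [fe'|ff']; last by rewrite ff' in nf.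
by rewrite (same_trans ef fe') in ne.
Qed.

Definition oend (p : qpath) : pend := (true, ohead p.2).
Definition iend (p : qpath) : pend := (false, ohead (rev p.2)).

Lemma oend_at p : p.2 != [::] -> end_at (ptgt p) (oend p).
Proof. by case: p => x [|a s] //= _; rewrite /end_at /= eqxx. Qed.

Lemma iend_at p : p.2 != [::] -> is_path p -> end_at (psrc p) (iend p).
Proof.
case: p => x s; case/lastP: s => [//|s a] _; rewrite /end_at /= rev_rcons /=.
rewrite /is_path /psrc /=; elim: s => [|b s IH] /=; last by case/andP.
by rewrite /ptgt /= andbT.
Qed.

Lemma oend_pcat (p q : qpath) : p.2 != [::] -> oend (pcat p q) = oend p.
Proof. by case: p => x [|a s]. Qed.

Lemma iend_pcat (p q : qpath) : q.2 != [::] -> iend (pcat p q) = iend q.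
Proof.
case: p q => x s [y t]; rewrite /iend /= rev_cat.
by case/lastP: t => // t a _; rewrite rev_rcons.
Qed.

(* The end of [p] at its source and the end of [q] at its target are in the
   same class iff [pq] is not in I. *)
Lemma npath_pcat (p q : qpath) : npath p -> npath q -> p.2 != [::] ->
  q.2 != [::] -> psrc p = ptgt q -> npath (pcat p q) = same (iend p) (oend q).
Proof.
move=> np nq p0 q0 e; move: (np) (nq); rewrite !npathE // is_path_pcat //.
case/andP => -> sp /andP[-> sq] /=; move: p0 q0 sp sq {np nq e}.
case: p q => x s [y [|b t]] //=; case/lastP: s => // s a _ _.
rewrite /same /iend /oend /= rev_rcons /= cat_rcons.
case: s => [|c s] /=; first by move=> _ ->; rewrite andbT.
by rewrite rcons_path cat_path /= => /andP[-> ->] ->; rewrite andbT.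
Qed.

(** Nonzero products determine the next arrow, so of two nonzero paths with the same last arrow one
    continues the other. If the first arrows also agree, the longer path would contain that arrow
    twice. *)
Lemma npath_ends_inj (p q : qpath) : npath p -> npath q -> p.2 != [::] ->
  q.2 != [::] -> oend p = oend q -> iend p = iend q -> p = q.
Proof.
wlog le : p q / (size p.2 <= size q.2)%N.
  move=> H np nq p0 q0 o i; case/orP: (leq_total (size p.2) (size q.2)) => le.
    exact: H.
  by apply/esym/H.
move=> np nq p0 q0 eo ei.
have e1 : psrc p = psrc q.
  case/andP: np (iend_at p0) => -> _ /(_ isT).
  case/andP: nq (iend_at q0) => -> _ /(_ isT); rewrite -ei /end_at.
  by case: (iend p).2 => // a /eqP <- /eqP <-.
move: np nq; rewrite !npathE // => /andP[_ sp] /andP[_ sq].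
have uq := sorted_uniq sq.
case: p q e1 p0 q0 sp sq uq eo ei le => x [|a s] [y [|b t]] //= -> _ _.
rewrite /oend /iend /= => sp sq uq [ab]; subst b => -[ei] le; congr (_, _ :: _).
have {}ei : last a s = last a t.
  by move: ei; rewrite !lastI !rev_rcons /= => -[].
have : exists t', t = s ++ t'.
  elim: s a t le sp sq {uq ei} => [|b s IH] a [|c t] //= le; try by exists t.
    by exists [::]. by exists (c :: t).
  move=> /andP[ab sp] /andP[ac st].
  rewrite (R_funr ab ac) in sp *.
  by have [t' ->] := IH _ _ le sp st; exists t'.
case=> t' et; subst t; case/lastP: t' ei uq {sq le} => [|t' c]; rewrite ?cats0 //.
rewrite -rcons_cat last_rcons => <-.
rewrite -[_ && _]/(uniq (rcons (a :: (s ++ t')) (last a s))) rcons_uniq.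
by rewrite -cat_cons mem_cat mem_last.
Qed.

Lemma npath_pcat_oend (p q : qpath) : p.2 != [::] -> q.2 != [::] ->
  npath (pcat p q) -> oend p <> oend q.
Proof.
case: p q => x [|a s] [y [|b t]] //= _ _.
rewrite npathE // => /andP[_ /sorted_uniq /=]; rewrite mem_cat inE.
by case/andP => + _ [ab]; rewrite ab eqxx orbT.
Qed.

Lemma npath_pcat_iend (p q : qpath) : p.2 != [::] -> q.2 != [::] ->
  npath (pcat p q) -> iend p <> iend q.
Proof.
case: p q => x s [y t]; case/lastP: s => // s a; case/lastP: t => // t b _ _.
rewrite npathE // => /andP[_ /sorted_uniq /=]; rewrite cat_uniq.
case/and3P => _ /hasPn h _; rewrite /iend /= !rev_rcons /= => -[ab].
by have := h b; rewrite mem_rcons inE eqxx -ab mem_rcons inE eqxx => /(_ isT).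
Qed.

End Ends.

(** * Walks of a partial injection *)

Section PartialWalk.
Variables (E T : finType) (m : pred E) (start finish : E -> T).
Hypothesis start_inj : {in m &, injective start}.
Hypothesis finish_inj : {in m &, injective finish}.

Definition wstep (e : E) : option E := [pick e' | m e' && (start e' == finish e)].
Definition witer (i : nat) (e : E) : option E := iter i (obind wstep) (Some e).
Definition perp (e : E) : bool := m e && `[< forall i, witer i e != None >].

Lemma witerS i e : witer i.+1 e = obind (witer i) (wstep e).
Proof.
rewrite /witer iterSr /=; case: (wstep e) => //=.
by elim: i => //= i ->.
Qed.

Lemma perp_next e : perp e -> exists2 e', perp e' & start e' = finish e /\ wstep e = Some e'.
Proof.
case/andP => me /asboolP pe; have := pe 1%N; rewrite witerS /=.
have : forall i, obind (witer i) (wstep e) != None by move=> i; rewrite -witerS.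
rewrite /wstep; case: pickP => // e' /andP[me' /eqP se'] h _; exists e' => //.
by rewrite /perp me'; apply/asboolP.
Qed.

(** The step map is injective on the finite set of elements whose walk never ends, hence a
    permutation of it; such walks therefore also extend backwards. *)
Lemma perp_prev e : perp e -> exists2 e', perp e' & finish e' = start e.
Proof.
pose P := [set e | perp e]; pose s e := odflt e (wstep e).
have sP : s @: P \subset P.
  apply/subsetP => _ /imsetP[x + ->]; rewrite !inE => /perp_next[e' pe' [_ se]].
  by rewrite /s se.
have sE x : x \in P -> start (s x) = finish x.
  by rewrite inE /s => /perp_next[e' _ [se ->]].
have mP x : x \in P -> x \in m by rewrite inE => /andP[].
have inj : {in P &, injective s}.
  move=> x y xP yP /(congr1 start); rewrite !sE // => /finish_inj; apply; exact: mP.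
have PE : s @: P = P by apply/eqP; rewrite eqEcard sP card_in_imset /=.
move=> pe; have : e \in s @: P by rewrite PE inE.
case/imsetP => x xP ->; exists x; first by rewrite inE in xP.
by rewrite sE.
Qed.

Variables (V : zmodType) (wt : E -> V).

Definition wlen (e : E) : nat :=
  if pselect (exists i, witer i e == None) is left h then ex_minn h else 0%N.
Definition wsum (e : E) : V := \sum_(i < wlen e) oapp wt 0 (witer i e).
(** The weight still to be collected before the walk from [t] ends. Unending walks have the default
    [wlen] 0, and [potE] is claimed only away from them. *)
Definition pot (t : T) : V :=
  oapp wsum 0 [pick e | m e && (start e == t)].

Lemma witer_None e i j : (i <= j)%N -> witer i e = None -> witer j e = None.
Proof.
move=> /subnK <- h; rewrite /witer iterD -/(witer i e) h.
by elim: (_ - _)%N => //= n ->.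
Qed.

Lemma wlenP e : m e -> ~~ perp e ->
  witer (wlen e) e = None /\ forall i, (i < wlen e)%N -> witer i e != None.
Proof.
move=> me; rewrite /perp me /= => /asboolPn/existsNP[i /negP].
rewrite negbK => /eqP h; rewrite /wlen; case: pselect => [h'|[]]; last by exists i; rewrite h.
case: ex_minnP => n /eqP wn nmin; split=> // j; apply: contraL => /nmin.
by rewrite -leqNgt.
Qed.

Lemma perp_witer e i : m e -> (wlen e < i)%N -> witer i e != None -> perp e.
Proof.
move=> me li; apply: contraNT => np; have [h _] := wlenP me np.
by rewrite (witer_None (ltnW li) h).
Qed.

Lemma wstep_m e e' : wstep e = Some e' -> m e' /\ start e' = finish e.
Proof. by rewrite /wstep; case: pickP => // x /andP[mx /eqP sx] [<-]. Qed.

Lemma perp_step e e' : m e -> wstep e = Some e' -> perp e' = perp e.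
Proof.
move=> me se; have [me' _] := wstep_m se.
rewrite /perp me me' /=; apply/asboolP/asboolP => h i; last first.
  by have := h i.+1; rewrite witerS se.
by case: i => // i; rewrite witerS se /=.
Qed.

Lemma wsumE e : m e -> ~~ perp e -> wsum e = wt e + oapp wsum 0 (wstep e).
Proof.
move=> me np; have [h1 h2] := wlenP me np.
have lenE : wlen e = (oapp wlen 0 (wstep e)).+1%N.
  case: (posnP (wlen e)) => [z|]; first by rewrite z in h1.
  case: (wlen e) h1 h2 => // n; rewrite witerS => h1 h2 _; congr _.+1.
  case se: (wstep e) h1 => [e'|] /= h1; last first.
    by case: n h2 {h1} => // n /(_ 1%N isT); rewrite witerS se.
  have [me' _] := wstep_m se.
  have [h1' h2'] := wlenP me' (etrans (congr1 negb (perp_step me se)) np).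
  apply/eqP; rewrite eqn_leq; apply/andP; split.
    rewrite leqNgt; apply/negP => lt; have := h2 (wlen e').+1 lt.
    by rewrite witerS se /= h1' eqxx.
  by rewrite leqNgt; apply/negP => /h2'; rewrite h1 eqxx.
rewrite /wsum lenE big_ord_recl /=; congr (_ + _).
case se: (wstep e) => [e'|] /=; last by rewrite big_ord0.
apply: eq_bigr => i _; congr (oapp wt 0 _).
by rewrite -[LHS]/(witer i.+1 e) witerS se.
Qed.

Lemma pot_start e : m e -> pot (start e) = wsum e.
Proof.
move=> me; rewrite /pot; case: pickP => [e' /andP[me' /eqP /start_inj ->] //|].
by move/(_ e); rewrite me eqxx.
Qed.

Lemma potE e : m e -> ~~ perp e -> pot (start e) = wt e + pot (finish e).
Proof. by move=> me np; rewrite pot_start // wsumE. Qed.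

End PartialWalk.

(** * Matched pairs of letters *)

(* The common shape of string and band complexes: the letter [q] joins the
   vertices [shi q] and [slo q], and its path [spi q] is the component of the
   differential from [sfrom q] to [sto q]. *)
Record sdata (k : fieldType) (A : falgType k) (G : quiver_in A) := SData {
  sN : finType;
  sQ : finType;
  shi : sQ -> sN;
  slo : sQ -> sN;
  sdir : sQ -> bool;
  spi : sQ -> qpath G;
  svt : sN -> vert G;
  sdg : sN -> int }.

Section SData.
Variables (k : fieldType) (A : falgType k) (G : quiver_in A).
Hypothesis hG : gentle_algebra G.

Section Flags.
Variable X : sdata G.

(* The flag [(q, true)] traverses the letter [q] from [shi q] to [slo q], the
   flag [(q, false)] in the opposite direction. *)
Definition sst (q : sQ X) (o : bool) : sN X := if o then shi q else slo q.
Definition sfrom (q : sQ X) := sst q (sdir q).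
Definition sto (q : sQ X) := sst q (~~ sdir q).
Definition send (q : sQ X) (o : bool) : pend G :=
  if sdir q == o then oend (spi q) else iend (spi q).

(** The four linking conditions on consecutive letters collapse into the last clause: ends of
    letters that meet at a vertex lie in different classes. *)
Definition is_sdata : Prop :=
  [/\ injective (@shi _ _ _ X), injective (@slo _ _ _ X),
      forall q, [/\ npath (spi q), (spi q).2 != [::],
        psrc (spi q) = svt (sto q), ptgt (spi q) = svt (sfrom q)
        & sdg (sto q) = sdg (sfrom q) + 1]
    & forall q q' o o', sst q o = sst q' o' -> (q, o) <> (q', o') ->
        ~~ same (send q o) (send q' o')].

Hypothesis hX : is_sdata.

Lemma sst_inj o : injective (sst^~ o).
Proof. by case: hX => h1 h2 _ _; case: o. Qed.

Lemma sfromE (q : sQ X) o : sst q o = if sdir q == o then sfrom q else sto q.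
Proof. by rewrite /sfrom /sto; case: (sdir q); case: o. Qed.

Lemma send_at (q : sQ X) o : end_at (svt (sst q o)) (send q o).
Proof.
case: hX => _ _ /(_ q)[np p0 es et _] _; rewrite sfromE /send.
case: ifP => _; first by rewrite -et oend_at.
by rewrite -es iend_at //; case/andP: np.
Qed.

Lemma same_flag (q : sQ X) o q' o' : sst q o = sst q' o' -> same (send q o) (send q' o') ->
  q = q' /\ o = o'.
Proof.
case: hX => _ _ _ h e s.
have [[-> ->]//|ne] := pselect ((q, o) = (q', o')).
by case/negP: (h _ _ _ _ e ne).
Qed.

Lemma send_from (q : sQ X) : send q (sdir q) = oend (spi q).
Proof. by rewrite /send eqxx. Qed.
Lemma send_to (q : sQ X) : send q (~~ sdir q) = iend (spi q).
Proof. by rewrite /send; case: (sdir q). Qed.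

Lemma from_neq_to (q : sQ X) : sfrom q <> sto q.
Proof.
by case: hX => _ _ /(_ q)[_ _ _ _ +] _ e; rewrite e => /eqP; lia.
Qed.

Lemma spi_npath (q : sQ X) : npath (spi q). Proof. by case: hX => _ _ /(_ q)[]. Qed.
Lemma spi_nnil (q : sQ X) : (spi q).2 != [::]. Proof. by case: hX => _ _ /(_ q)[]. Qed.
Lemma spi_src (q : sQ X) : psrc (spi q) = svt (sto q). Proof. by case: hX => _ _ /(_ q)[]. Qed.
Lemma spi_tgt (q : sQ X) : ptgt (spi q) = svt (sfrom q). Proof. by case: hX => _ _ /(_ q)[]. Qed.

(** By the last clause of [is_sdata] at most one flag at [a] has its end in the class of [e]. Hence
    a nontrivial path has at most one neighbouring letter on each side, whether multiplied on or
    divided off. *)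
Definition side (a : sN X) (e : pend G) : option (sQ X) :=
  omap fst [pick f : sQ X * bool | (sst f.1 f.2 == a) && same (send f.1 f.2) e].

Lemma sideP (q : sQ X) o e : same (send q o) e -> side (sst q o) e = Some q.
Proof.
move=> s; rewrite /side; case: pickP => [[q' o'] /= /andP[/eqP e' s']|].
  rewrite same_sym in s'; by have [-> _] := same_flag (esym e') (same_trans hG s s').
by move/(_ (q, o)); rewrite /= eqxx s.
Qed.

Lemma side_fromP (q : sQ X) e : same (oend (spi q)) e -> side (sfrom q) e = Some q.
Proof. by rewrite -send_from; exact: sideP. Qed.
Lemma side_toP (q : sQ X) e : same (iend (spi q)) e -> side (sto q) e = Some q.
Proof. by rewrite -send_to; exact: sideP. Qed.

End Flags.

Section Potential.
Variables (X Y : sdata G).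
Hypotheses (hX : is_sdata X) (hY : is_sdata Y).

Local Notation E := (sQ X * sQ Y)%type.
Implicit Types e : E.

Definition matched e := spi e.1 == spi e.2.
Definition sense e := sdir e.1 == sdir e.2.
(** Walks are oriented by the letter of [X], from [shi] to [slo]; the letter of [Y] is traversed the
    other way if the two directions disagree. *)
Definition mpt (x : bool) e : sN X * sN Y := (sst e.1 x, sst e.2 (x == sense e)).

Lemma mpt_from e : mpt (sdir e.1) e = (sfrom e.1, sfrom e.2).
Proof. by rewrite /mpt /sense /sfrom; case: (sdir e.1); case: (sdir e.2). Qed.
Lemma mpt_to e : mpt (~~ sdir e.1) e = (sto e.1, sto e.2).
Proof. by rewrite /mpt /sense /sto; case: (sdir e.1); case: (sdir e.2). Qed.

Lemma matched_send e x : matched e -> send e.1 x = send e.2 (x == sense e).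
Proof.
by move/eqP => em; rewrite /send em /sense; case: (sdir e.1); case: (sdir e.2); case: x.
Qed.

Lemma matched_flag e e' x x' : matched e -> matched e' ->
  mpt x e = mpt x' e' -> (e.1, x) = (e'.1, x') -> e = e'.
Proof.
case: e e' => q r [q' r'] me me' [_ er] /= [eq ex]; subst q' x'.
have s := matched_send x me; have s' := matched_send x me'.
rewrite /= in s s' er; congr pair.
apply: (same_flag hY er _).1; rewrite -s -s'.
exact: same_refl (send_at hX _ _).
Qed.

Lemma mpt_inj x : {in matched &, injective (mpt x)}.
Proof.
move=> e e' me me' em; apply: (matched_flag me me' em).
by case: em => /(sst_inj hX) ->.
Qed.

(* Consecutive matched pairs cannot share the letter of [Y]. *)
Lemma matched_flag_r e e' x x' : matched e -> matched e' ->
  mpt x e = mpt x' e' -> (e.2, x == sense e) = (e'.2, x' == sense e') ->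
  (e.1, x) = (e'.1, x').
Proof.
case: e e' => q r [q' r'] me me' [eq _] /= [er ex]; subst r'.
have s := matched_send x me; have s' := matched_send x' me'.
rewrite /= ex -s' in s.
have [|-> -> //] := same_flag hX eq _.
by rewrite s; apply: same_refl (send_at hX _ _).
Qed.

Definition cperp : pred E := perp matched (mpt true) (mpt false).

Lemma cperp_matched e : cperp e -> matched e. Proof. by case/andP. Qed.

(** A change of sense would make consecutive pairs share a flag of [Y]; by [matched_flag_r] they
    would then share a flag of [X], though one is left where the other is entered. *)
Lemma cperp_step e : cperp e -> exists2 e', cperp e' &
  mpt true e' = mpt false e /\ sense e' = sense e.
Proof.
move=> pe; have [e' pe' [em _]] := perp_next pe; exists e' => //; split=> //.
set o := sense e; have [_ er] := em.
case: (eqVneq (sense e') o) => // no; exfalso.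
have no' : sense e' = ~~ o by move: no; case: sense; case: (o).
have ef : (e'.2, true == sense e') = (e.2, false == o).
  by move: er; rewrite no' -/o; case: (o) => er; rewrite (sst_inj hY er).
by have [] := matched_flag_r (cperp_matched pe') (cperp_matched pe) em ef.
Qed.

Definition tcyc (a : sN X) (b : sN Y) : bool :=
  [exists e : E, cperp e && (mpt true e == (a, b))].

Lemma tcyc_mpt e x : cperp e -> tcyc (mpt x e).1 (mpt x e).2.
Proof.
move=> pe; apply/existsP; case: x; first by exists e; rewrite pe -surjective_pairing eqxx.
have [e' pe' [se _]] := perp_next pe.
by exists e'; rewrite [cperp e']pe' se -surjective_pairing eqxx.
Qed.

Lemma tcyc_flags a b : tcyc a b -> forall x, exists2 e, cperp e & mpt x e = (a, b).
Proof.
case/existsP => e /andP[pe /eqP se] [|]; first by exists e.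
have [e' pe' fe'] := perp_prev (@mpt_inj false) pe.
by exists e'; rewrite ?fe'.
Qed.

Lemma tcyc_left (q : sQ X) x b : tcyc (sst q x) b -> exists r,
  cperp (q, r) /\ mpt x (q, r) = (sst q x, b).
Proof.
move=> /tcyc_flags/(_ x)[[q' r] pe em]; exists r.
by case: (em) => /(sst_inj hX) qq _; subst q'.
Qed.

Lemma tcyc_right a (r : sQ Y) y : tcyc a (sst r y) -> exists q x,
  cperp (q, r) /\ mpt x (q, r) = (a, sst r y) /\ (x == sense (q, r)) = y.
Proof.
move=> t; have [[q1 r1] p1 e1] := tcyc_flags t true.
have [[q2 r2] p2 e2] := tcyc_flags t false.
have ne : (true == sense (q1, r1)) != (false == sense (q2, r2)).
  apply/negP => /eqP es; case: (e1) (e2) => _ er1 [_ er2].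
  rewrite es in er1; rewrite -er1 in er2; move/(sst_inj hY): er2 => rr; subst r2.
  have := matched_flag_r (cperp_matched p1) (cperp_matched p2) (etrans e1 (esym e2)).
  by rewrite /= es => /(_ erefl) [].
have [y1|ny] := eqVneq (true == sense (q1, r1)) y.
  exists q1, true; case: (e1) => _; rewrite /= y1 => /(sst_inj hY) rr; subst r1.
  by [].
have y2 : (false == sense (q2, r2)) = y.
  by move: (true == _) (false == sense _) ne ny => [] []; case: (y).
exists q2, false; case: (e2) => _; rewrite /= y2 => /(sst_inj hY) rr; subst r2.
by [].
Qed.

(* The basis element [(a, b, p)] of the Hom complex lies on a perpetual walk. *)
Definition cyc (a : sN X) (b : sN Y) (p : qpath G) : bool :=
  if p.2 == [::] then tcyc a b
  else [exists e : E, [&& cperp e, sfrom e.1 == a, sto e.2 == b & spi e.1 == p]].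

Lemma pcat_nil (p q : qpath G) : q.2 = [::] -> ptgt q = psrc p -> pcat p q = p.
Proof. by case: p q => [x s] [y t] /= -> <-; rewrite /pcat /= cats0. Qed.
Lemma nil_pcat (p q : qpath G) : p.2 = [::] -> pcat p q = q.
Proof. by case: p q => [x s] [y t] /= ->. Qed.
Lemma pcat_nnill (p q : qpath G) : p.2 != [::] -> (pcat p q).2 != [::].
Proof. by case: p => x [|a s]. Qed.
Lemma pcat_nnilr (p q : qpath G) : q.2 != [::] -> (pcat p q).2 != [::].
Proof. by case: p q => x [|a s] [y [|b t]]. Qed.

(** With [cycR], this makes the spans of the perpetual and of the other basis elements complementary
    subcomplexes. *)
Lemma cycL (q : sQ X) b p : ptgt p = svt (sto q) -> npath (pcat (spi q) p) ->
  cyc (sfrom q) b (pcat (spi q) p) = cyc (sto q) b p.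
Proof.
move=> tp np; rewrite /cyc (negPf (pcat_nnill _ (spi_nnil hX q))).
have st : psrc (spi q) = ptgt p by rewrite spi_src.
have [p0|p0] := eqVneq p.2 [::].
  rewrite pcat_nil //; apply/existsP/idP => [[e /and4P[pe /eqP e1 /eqP e2 /eqP e3]]|].
    have eq : e.1 = q.
      rewrite /sfrom in e1; apply: (same_flag hX e1 _).1; rewrite !send_from e3.
      by apply: same_refl (oend_at (spi_nnil hX q)).
    have := tcyc_mpt (~~ sdir e.1) pe; rewrite mpt_to /=.
    by rewrite eq e2.
  move/tcyc_left => [r [pe em]]; exists (q, r); rewrite pe /= !eqxx /=.
  move: em; rewrite -[~~ sdir q]/(~~ sdir (q, r).1) mpt_to => /(congr1 snd) /= ->.
  by rewrite eqxx.
(* A perpetual element with nontrivial path is a whole matched letter: dividing off a letter leaves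
   no nontrivial path, and multiplying another one on would put two flags of one class at a
   vertex. *)
apply/existsP/existsP => -[e /and4P[pe /eqP e1 /eqP e2 /eqP e3]]; exfalso.
  have : e.1 = q.
    rewrite /sfrom in e1; apply: (same_flag hX e1 _).1; rewrite !send_from e3.
    rewrite oend_pcat ?spi_nnil //; by apply: same_refl (oend_at (spi_nnil hX q)).
  move=> eq; rewrite eq in e3; move/(congr1 (fun p => size p.2)): e3.
  rewrite /= size_cat; case: (p.2) p0 => //= a s _; lia.
subst p; move: np; rewrite npath_pcat ?spi_npath ?spi_nnil //.
rewrite -send_to -send_from => s.
have [e4 e5] := same_flag hX (esym e1) s.
by rewrite e4 in e5; case: (sdir _) e5.
Qed.

Lemma cycR (r : sQ Y) a p : psrc p = svt (sfrom r) -> npath (pcat p (spi r)) ->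
  cyc a (sto r) (pcat p (spi r)) = cyc a (sfrom r) p.
Proof.
move=> tp np; rewrite /cyc (negPf (pcat_nnilr _ (spi_nnil hY r))).
have st : psrc p = ptgt (spi r) by rewrite spi_tgt.
have [p0|p0] := eqVneq p.2 [::].
  rewrite nil_pcat //; apply/existsP/idP => [[e /and4P[pe /eqP e1 /eqP e2 /eqP e3]]|].
    have er : e.2 = r.
      rewrite /sto in e2; apply: (same_flag hY e2 _).1; rewrite !send_to -e3.
      move/cperp_matched/eqP: pe => <-.
      apply: same_refl (iend_at (spi_nnil hX _) _).
      by case/andP: (spi_npath hX e.1).
    have := tcyc_mpt (sdir e.1) pe; rewrite mpt_from /=.
    by rewrite er e1.
  move/tcyc_right => [q [x [pe [em y]]]]; exists (q, r).
  have xq : x = sdir q by move: y; rewrite /sense /=; case: x (sdir q) (sdir r) {em} => [] [] [].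
  move: em (cperp_matched pe); rewrite xq -[sdir q]/(sdir (q, r).1) mpt_from.
  by rewrite pe /matched /= => /(congr1 fst) /= -> ->; rewrite !eqxx.
apply/existsP/existsP => -[e /and4P[pe /eqP e1 /eqP e2 /eqP e3]]; exfalso.
  have er : e.2 = r.
    rewrite /sto in e2; apply: (same_flag hY e2 _).1; rewrite !send_to.
    move/cperp_matched/eqP: pe => <-; rewrite e3 iend_pcat ?spi_nnil //.
    apply: same_refl (iend_at (spi_nnil hY _) _).
    by case/andP: (spi_npath hY r).
  move/cperp_matched/eqP: pe; rewrite er e3 => /(congr1 (fun p => size p.2)).
  rewrite /= size_cat; case: (p.2) p0 => //= c s _; lia.
subst p; move: np; rewrite npath_pcat ?spi_npath ?spi_nnil //.
move/cperp_matched/eqP: pe => ->; rewrite -send_to -send_from => s.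
have [e4 e5] := same_flag hY e2 s.
by rewrite e4 in e5; case: (sdir _) e5.
Qed.

End Potential.
End SData.

(** * Potentials on the basis of the Hom complex *)

Section Gauge.
Variables (k : fieldType) (A : falgType k) (G : quiver_in A).
Hypothesis hG : gentle_algebra G.
Variables (X Y : sdata G).
Hypotheses (hX : is_sdata X) (hY : is_sdata Y).

Lemma sideE (S : sdata G) (a : sN S) e (q : sQ S) : side a e = Some q ->
  exists o, sst q o = a /\ same (send q o) e.
Proof.
rewrite /side; case: pickP => //= -[q' o] /= /andP[/eqP e1 s] [<-]; by exists o.
Qed.

Lemma same_eq b (o o' : option (arr G)) : same (b, o) (b, o') -> (b, o) = (b, o').
Proof. by case: o o' => [a|] [a'|] //; rewrite /same /= eqxx => /eqP ->. Qed.

Variables (x : sQ X -> int) (z : sQ Y -> int).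

(** The sign depends on the direction in which the walk crosses the letter, so that [potE] becomes
    the same relation [tpotE] in both cases. *)
Definition mwt (e : sQ X * sQ Y) : int :=
  if sdir e.1 then z e.2 - x e.1 else x e.1 - z e.2.
Definition tpot (a : sN X) (b : sN Y) : int :=
  pot (@matched _ _ _ X Y) (mpt true) (mpt false) mwt (a, b).

Lemma tpotE q r : matched (q, r) -> ~~ cperp (q, r) ->
  tpot (sto q) (sto r) - x q = tpot (sfrom q) (sfrom r) - z r.
Proof.
move=> me np; have := potE (mpt_inj hX hY (x:=true)) mwt me np.
have := mpt_from (q, r); have := mpt_to (q, r); rewrite /tpot /mwt /=.
by case: (sdir q) => /= <- <- ->; rewrite -/(mpt _ _); ring.
Qed.

(** The constant of a square of basis elements linked by multiplication with [q] and [r]. It is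
    free, hence 0, unless an identity is linked to the square: at the targets of the two components,
    at their sources, or where [spi q] and [spi r] compose. The first two cases meet only in a
    matched pair, where [tpotE] makes them agree off perpetual walks. *)
Definition cluster (q : sQ X) (r : sQ Y) : int :=
  if iend (spi q) == iend (spi r) then tpot (sto q) (sto r) - x q
  else if oend (spi q) == oend (spi r) then tpot (sfrom q) (sfrom r) - z r
  else if same (iend (spi q)) (oend (spi r)) then tpot (sto q) (sfrom r) - x q - z r
  else 0.

Definition kx (q : sQ X) a := if a == sto q then x q else 0.
Definition kz (r : sQ Y) b := if b == sfrom r then z r else 0.

(** With a letter on one side only, the square degenerates to an edge; its value is forced by an
    identity exactly if [p] is the path of that letter, starting at [sfrom] and ending at [sto]. *)
Definition gpot (a : sN X) (b : sN Y) (p : qpath G) : int :=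
  if p.2 == [::] then tpot a b else
  match side a (oend p), side b (iend p) with
  | Some q, Some r => cluster q r + kx q a + kz r b
  | Some q, None =>
      if (a == sfrom q) && (p == spi q) then tpot (sto q) b - x q else kx q a
  | None, Some r =>
      if (b == sto r) && (p == spi r) then tpot a (sfrom r) - z r else kz r b
  | None, None => 0
  end.

Let ft (S : sdata G) (hS : is_sdata S) (q : sQ S) : (sfrom q == sto q) = false.
Proof. by apply/eqP; exact: from_neq_to. Qed.

Lemma pcat_neql (p q : qpath G) : q.2 != [::] -> (pcat p q == p) = false.
Proof.
move=> q0; apply/eqP => /(congr1 (fun p => size p.2)); rewrite /= size_cat.
by case: (q.2) q0 => //= a s _; lia.
Qed.
Lemma pcat_neqr (p q : qpath G) : p.2 != [::] -> (pcat p q == q) = false.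
Proof.
move=> q0; apply/eqP => /(congr1 (fun p => size p.2)); rewrite /= size_cat.
by case: (p.2) q0 => //= a s _; lia.
Qed.

Lemma clusterR q r : svt (sto q) = svt (sfrom r) ->
    same (iend (spi q)) (oend (spi r)) ->
  cluster q r = tpot (sto q) (sfrom r) - x q - z r.
Proof.
move=> e s; have n0 : npath (pcat (spi q) (spi r)).
  rewrite npath_pcat ?spi_npath ?spi_nnil //.
  by rewrite spi_src // spi_tgt.
rewrite /cluster s; case: eqP => [/npath_pcat_iend|_].
  by move=> []; rewrite ?spi_nnil.
case: eqP => // /npath_pcat_oend [] //; by rewrite ?spi_nnil.
Qed.

Lemma gpotL q b p : ptgt p = svt (sto q) -> psrc p = svt b ->
    npath (pcat (spi q) p) ->
  gpot (sto q) b p = gpot (sfrom q) b (pcat (spi q) p) + x q.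
Proof.
move=> tp sp np; rewrite /gpot (negPf (pcat_nnill _ (spi_nnil hX q))).
rewrite oend_pcat ?spi_nnil // (side_fromP hG hX (same_refl (oend_at (spi_nnil hX q)))).
have st : psrc (spi q) = ptgt p by rewrite spi_src.
have [p0|p0] := eqVneq p.2 [::]; last first.
  rewrite iend_pcat // (side_toP hG hX); last first.
    by rewrite -npath_pcat ?spi_npath ?spi_nnil ?(pcat_npathr _ st).
  rewrite /kx eqxx ft //; case: side => [r|]; first by ring.
  by rewrite eq_sym ft //= pcat_neql // eqxx /= add0r.
rewrite pcat_nil //; case sr: (side b _) => [r|]; last by rewrite !eqxx /=; ring.
(* The identity at [(sto q, b)] meets a letter [r] either at its source, where [spi q] and [spi r]
   compose, or at its target, where both paths have the same first arrow. *)
have [o [eb]] := sideE sr; have [eo|/eqP eo] := eqVneq o (sdir r).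
  move: eb; rewrite eo send_from -/(sfrom r) => eb; rewrite same_sym => s.
  rewrite clusterR // ?eb -?tp -?sp; last by rewrite /ptgt p0.
  by rewrite /kx ft // /kz eb eqxx; ring.
have {}eo : o = ~~ sdir r by case: o (sdir r) eo {eb} => [] [].
move: eb; rewrite eo send_to -/(sto r) => eb /same_eq; rewrite -/(iend _) => s.
by rewrite /cluster s eqxx /kx ft // /kz -eb eq_sym ft //; ring.
Qed.

Lemma gpotR r a p : psrc p = svt (sfrom r) -> ptgt p = svt a ->
    npath (pcat p (spi r)) -> ~~ cyc a (sfrom r) p ->
  gpot a (sfrom r) p = gpot a (sto r) (pcat p (spi r)) + z r.
Proof.
move=> sp tp np nc; rewrite /gpot (negPf (pcat_nnilr _ (spi_nnil hY r))).
have ir : same (iend (spi r)) (iend (spi r)).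
  apply: same_refl (iend_at (spi_nnil hY r) _); by case/andP: (spi_npath hY r).
rewrite iend_pcat ?spi_nnil // (side_toP hG hY ir).
have st : psrc p = ptgt (spi r) by rewrite spi_tgt.
have [p0|p0] := eqVneq p.2 [::]; last first.
  rewrite oend_pcat // (side_fromP hG hY); last first.
    by rewrite same_sym -(npath_pcat hG (pcat_npathl hG st np) (spi_npath hY r) p0 (spi_nnil hY r) st).
  rewrite /kz eqxx (eq_sym (sto r)) !ft //; case: side => [q|]; first by ring.
  by rewrite pcat_neqr ?andbF //= add0r.
rewrite nil_pcat //; case sq: (side a _) => [q|]; last by rewrite !eqxx /=; ring.
have [o [ea]] := sideE sq; have [eo|/eqP eo] := eqVneq o (sdir q).
  move: ea; rewrite eo send_from -/(sfrom q) => ea /same_eq; rewrite -/(oend _) => s.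
  rewrite /cluster s eqxx /kx -ea ft // /kz (eq_sym (sto r)) ft //; case: eqP => [i|_]; last by ring.
  have m : spi q = spi r by apply: npath_ends_inj; rewrite ?spi_npath ?spi_nnil.
  (* The identity has a matched pair at this end, so two values of [cluster] compete; here the
     exclusion of perpetual walks is used. *)
  have np' : ~~ cperp (q, r).
    apply: contra nc => pe; rewrite /cyc p0 eqxx -ea.
    by have := tcyc_mpt (sdir q) pe; rewrite -[sdir q]/(sdir (q, r).1) mpt_from.
  by rewrite tpotE //; [ring|exact/eqP].
have {}eo : o = ~~ sdir q by case: o (sdir q) eo {ea} => [] [].
move: ea; rewrite eo send_to -/(sto q) => ea s.
rewrite clusterR // -?ea.
  by rewrite /kx eqxx // /kz (eq_sym (sto r)) ft //; ring.
by rewrite -sp ea -tp /ptgt p0.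
Qed.

End Gauge.

(** * Dimensions of spaces given by predicates *)

Section Dimension.
Variables (k : fieldType).

Definition subsp (V : vectType k) (S : V -> Prop) : Prop :=
  S 0 /\ forall (c : k) f g, S f -> S g -> S (c *: f + g).

Lemma vspanE (V : vectType k) (S : V -> Prop) : subsp S ->
  forall f, f \in vspan S <-> S f.
Proof. by case=> S0 Sl; exact: vspan_subspace. Qed.

Lemma subsp_and (V : vectType k) (S S' : V -> Prop) : subsp S -> subsp S' ->
  subsp (fun f => S f /\ S' f).
Proof.
move=> [S0 Sl] [S0' Sl']; split=> [//|c f g [Sf Sf'] [Sg Sg']]; split; auto.
Qed.

Lemma dim_mod_sub (V : vectType k) (S N : V -> Prop) : subsp S -> subsp N ->
    (forall f, N f -> S f) ->
  (dim_mod S N + \dim (vspan N) = \dim (vspan S))%N.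
Proof.
move=> hS hN NS; have sub : (vspan N <= vspan S)%VS.
  by apply/subvP => f /(vspanE hN)/NS/(vspanE hS).
by rewrite /dim_mod (addv_idPl sub) subnK // dimvS.
Qed.

Lemma dim_vspan_eq (V : vectType k) (S S' : V -> Prop) : subsp S -> subsp S' ->
  (forall f, S f <-> S' f) -> \dim (vspan S) = \dim (vspan S').
Proof.
move=> hS hS' e; congr (\dim _); apply/vspaceP => f.
by apply/idP/idP => [/(vspanE hS)/e/(vspanE hS')|/(vspanE hS')/e/(vspanE hS)].
Qed.

Section Iso.
Variables (W V : vectType k) (phi : W -> V).
Hypothesis phi_lin : linear phi.
Variables (S1 : W -> Prop) (S : V -> Prop).
Hypotheses (hS1 : subsp S1) (hS : subsp S).
Hypothesis phiS : forall f, S1 f -> S (phi f).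
Hypothesis phi_onto : forall g, S g -> exists2 f, S1 f & phi f = g.
Hypothesis phi_inj : forall f, S1 f -> phi f = 0 -> f = 0.

Lemma dim_iso : \dim (vspan S) = \dim (vspan S1).
Proof.
pose L : {linear W -> V} := HB.pack phi (GRing.isLinear.Build k W V *:%R phi phi_lin).
have LE f : linfun L f = phi f by rewrite lfunE.
have -> : vspan S = (linfun L @: vspan S1)%VS.
  apply/vspaceP => g; apply/idP/memv_imgP => [/(vspanE hS)/phi_onto[f Sf <-]|[f]].
    by exists f; [exact/(vspanE hS1)|rewrite LE].
  by move=> /(vspanE hS1) Sf ->; apply/(vspanE hS); rewrite LE; exact: phiS.
apply: limg_dim_eq; apply/eqP; rewrite -subv0; apply/subvP => f.
rewrite memv_cap memv_ker LE => /andP[/(vspanE hS1) Sf /eqP f0].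
by rewrite (phi_inj Sf f0) mem0v.
Qed.
End Iso.

Lemma dim_vspan_ffun (I : finType) (W : vectType k) (S1 : W -> Prop) : subsp S1 ->
  \dim (vspan (fun F : {ffun I -> W} => forall i, S1 (F i)))
  = (#|I| * \dim (vspan S1))%N.
Proof.
move=> hS1; pose U := vspan S1; pose phi (F : {ffun I -> subvs_of U}) : {ffun I -> W} :=
  [ffun i => vsval (F i)].
rewrite (@dim_iso _ _ phi _ (fun _ => True)).
- have -> : vspan (fun _ : {ffun I -> subvs_of U} => True) = fullv.
    apply/vspaceP => f; rewrite memvf; apply/idP; exact/(vspanE _).
  by rewrite dimvf.
- by move=> c f g; apply/ffunP => i; rewrite !ffunE linearP.
- by [].
- split=> [i|c f g hf hg i]; first by rewrite ffunE; case: hS1.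
  by rewrite !ffunE; case: hS1 => _; apply.
- by move=> F _ i; rewrite ffunE; apply/(vspanE hS1)/subvsP.
- move=> F hF; exists [ffun i => vsproj U (F i)] => //.
  by apply/ffunP => i; rewrite !ffunE vsprojK //; apply/(vspanE hS1).
- move=> F _ /ffunP F0; apply/ffunP => i; have := F0 i; rewrite !ffunE.
  by move=> Fi0; apply: subvs_inj; rewrite Fi0 linear0.
Qed.

Lemma dim_split (V : vectType k) (pr : V -> V) (S : V -> Prop) : subsp S ->
    linear pr -> (forall f, pr (pr f) = pr f) -> (forall f, S f -> S (pr f)) ->
  \dim (vspan S) = (\dim (vspan (fun f => S f /\ pr f = f))
                    + \dim (vspan (fun f => S f /\ pr f = 0%R)))%N.
Proof.
move=> hS pl pp Sp.
pose L : {linear V -> V} := HB.pack pr (GRing.isLinear.Build k V V *:%R pr pl).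
have p0 : pr 0 = 0 by exact: (linear0 L).
have hf : subsp (fun f : V => S f /\ pr f = f).
  by apply: subsp_and => //; split=> // c f g hf hg; rewrite pl hf hg.
have hz : subsp (fun f : V => S f /\ pr f = 0).
  by apply: subsp_and => //; split=> // c f g hf' hg; rewrite pl hf' hg scaler0 addr0.
rewrite -dimv_disjoint_sum.
  congr (\dim _); apply/vspaceP => f; apply/idP/memv_addP => [/(vspanE hS) Sf|].
    exists (pr f); first by apply/(vspanE hf); split; auto.
    exists (f - pr f); last by rewrite addrCA subrr addr0.
    apply/(vspanE hz); split; last by rewrite addrC -scaleN1r pl pp scaleN1r addNr.
    by rewrite addrC -scaleN1r; case: hS => _; apply; auto.
  case=> u /(vspanE hf)[Su _] [v /(vspanE hz)[Sv _] ->].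
  by apply/(vspanE hS); rewrite -[u]scale1r; case: hS => _; apply.
apply/eqP; rewrite -subv0; apply/subvP => f.
rewrite memv_cap => /andP[/(vspanE hf)[_ e] /(vspanE hz)[_ e']].
by rewrite memv0 -e e'.
Qed.

End Dimension.

(** * Hom complexes *)

Section Complexes.
Variables (k : fieldType) (A : falgType k) (G : quiver_in A).
Hypothesis hG : gentle_algebra G.

Lemma pcoef_ext0 (u : A) : (forall p : qpath G, pcoef p u = 0) -> u = 0.
Proof. by move=> h; apply: (pcoef_ext hG) => p _; rewrite h pcoef0. Qed.

Lemma pcoef_neq0 (u : A) : u != 0 -> exists p : qpath G, pcoef p u != 0.
Proof.
move=> u0; apply/not_existsP => h; case/eqP: u0; apply: pcoef_ext0 => p.
by apply/eqP/negPn/negP; exact: h.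
Qed.

Lemma pcoef_mul_neq0 (u v : A) (p : qpath G) : pcoef p (u * v) != 0 ->
  exists p1 p2, [/\ psrc p1 = ptgt p2, p = pcat p1 p2, npath p,
                    pcoef p1 u != 0 & pcoef p2 v != 0].
Proof.
rewrite (pcoefE hG u) big_distrl pcoef_sum /= => h.
have /hasP[p1 + h1] : has (fun p1 => pcoef p (pcoef p1 u *: ev p1 * v) != 0) (npaths G).
  apply: contraNT h => /hasPn h; rewrite big_seq big1 // => q /h /negPn /eqP //.
rewrite mem_npaths // => n1; move: h1; rewrite -scalerAl pcoefZ mulf_eq0 negb_or.
case/andP => c1 /(pcoef_mull_neq0 hG n1)[p2 [e1 e2 np c2]].
by exists p1, p2; rewrite -(pcoefE hG u).
Qed.

Implicit Types C D : complex G.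

Lemma homogeneousE C D m (f : mor C D) : homogeneous m f <->
  forall a b p, pcoef p (f (a, b)) != 0 ->
    [/\ ptgt p = cvert a, psrc p = cvert b & cdeg b = cdeg a + m].
Proof.
split=> [h a b p cp|h a b].
  have [/(projhom_coef hG)/(_ p cp)[-> ->] /(_ _)-> //] := h a b.
  by apply: contraNneq cp => ->; rewrite pcoef0.
split; first by apply/(projhom_coef hG) => p /h[].
by case/pcoef_neq0 => p /h[].
Qed.

Lemma mcompDl C D D' (f g : mor C D) (h : mor D D') c :
  mcomp (c *: f + g) h = c *: mcomp f h + mcomp g h.
Proof.
apply/ffunP => x; rewrite !ffunE scaler_sumr -big_split /=; apply: eq_bigr => b _.
by rewrite !ffunE mulrDl scalerAl.
Qed.

Lemma mcompDr C D D' (f g : mor D D') (h : mor C D) c :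
  mcomp h (c *: f + g) = c *: mcomp h f + mcomp h g.
Proof.
apply/ffunP => x; rewrite !ffunE scaler_sumr -big_split /=; apply: eq_bigr => b _.
by rewrite !ffunE mulrDr scalerAr.
Qed.

Lemma mcompA C D D' E (f : mor C D) (g : mor D D') (h : mor D' E) :
  mcomp (mcomp f g) h = mcomp f (mcomp g h).
Proof.
apply/ffunP => x; rewrite !ffunE /=.
under eq_bigr => b _ do rewrite ffunE /= big_distrl /=.
rewrite exchange_big; apply: eq_bigr => b _; rewrite ffunE /= big_distrr /=.
by apply: eq_bigr => b' _; rewrite mulrA.
Qed.

Lemma mcomp0r C D D' (f : mor C D) : mcomp f (0 : mor D D') = 0.
Proof. by apply/ffunP => x; rewrite !ffunE big1 // => b _; rewrite ffunE mulr0. Qed.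
Lemma mcomp0l C D D' (f : mor D D') : mcomp (0 : mor C D) f = 0.
Proof. by apply/ffunP => x; rewrite !ffunE big1 // => b _; rewrite ffunE mul0r. Qed.

Lemma mcompDDl C D D' (f g : mor C D) (h : mor D D') :
  mcomp (f + g) h = mcomp f h + mcomp g h.
Proof. by have := mcompDl f g h 1; rewrite !scale1r. Qed.
Lemma mcompDDr C D D' (f g : mor D D') (h : mor C D) :
  mcomp h (f + g) = mcomp h f + mcomp h g.
Proof. by have := mcompDr f g h 1; rewrite !scale1r. Qed.
Lemma mcompZl C D D' (f : mor C D) (h : mor D D') c :
  mcomp (c *: f) h = c *: mcomp f h.
Proof. by have := mcompDl f 0 h c; rewrite !addr0 mcomp0l addr0. Qed.
Lemma mcompZr C D D' (f : mor D D') (h : mor C D) c :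
  mcomp h (c *: f) = c *: mcomp h f.
Proof. by have := mcompDr f 0 h c; rewrite !addr0 mcomp0r addr0. Qed.

Lemma homogeneous_mcomp C D D' (f : mor C D) (g : mor D D') m n :
  homogeneous m f -> homogeneous n g -> homogeneous (m + n) (mcomp f g).
Proof.
move=> /homogeneousE hf /homogeneousE hg; apply/homogeneousE => a c p.
rewrite ffunE pcoef_sum /= => h.
have /existsP[b] : [exists b, pcoef p (f (a, b) * g (b, c)) != 0].
  apply: contraNT h => /existsPn h; rewrite big1 // => b _; exact/eqP/negPn.
case/pcoef_mul_neq0 => p1 [p2 [e1 -> _ /hf[t1 s1 d1] /hg[t2 s2 d2]]].
by rewrite ptgt_pcat //; split; rewrite // d2 d1 addrA.
Qed.

Lemma homogeneous_sub C D m : subsp (@homogeneous _ _ _ C D m).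
Proof.
split=> [|c f g /homogeneousE hf /homogeneousE hg]; apply/homogeneousE => a b p.
  by rewrite ffunE pcoef0 eqxx.
rewrite !ffunE pcoefD pcoefZ => h.
have [z|/hg //] := eqVneq (pcoef p (g (a, b))) 0.
by apply: hf; apply: contraNneq h => ->; rewrite z mulr0 addr0.
Qed.

Lemma chain_sub C D : subsp (@chain_map _ _ _ C D).
Proof.
apply: (subsp_and (homogeneous_sub C D 0)).
by split=> [|c f g hf hg]; rewrite ?mcomp0l ?mcomp0r // mcompDl mcompDr hf hg.
Qed.

Lemma null_sub C D : subsp (@null_homotopic _ _ _ C D).
Proof.
have [h0 hl] := homogeneous_sub C D (-1).
split=> [|c f g [h [hh ->]] [h' [hh' ->]]].
  by exists 0; split=> //; rewrite mcomp0l mcomp0r addr0.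
exists (c *: h + h'); split; first exact: hl.
by rewrite mcompDl mcompDr scalerDr addrACA.
Qed.

Lemma null_chain C D (f : mor C D) : is_complex C -> is_complex D ->
  null_homotopic f -> chain_map f.
Proof.
move=> [hC dC] [hD dD] [h [hh ->]]; split.
  have h1 : homogeneous 0 (mcomp (diff C) h) := homogeneous_mcomp hC hh.
  have h2 : homogeneous 0 (mcomp h (diff D)) := homogeneous_mcomp hh hD.
  by have := (homogeneous_sub C D 0).2 1 _ _ h1 h2; rewrite scale1r.
by rewrite mcompDDl mcompDDr !mcompA dD -!mcompA dC mcomp0l mcomp0r addr0 add0r.
Qed.

Lemma homDE C D : is_complex C -> is_complex D ->
  (homD C D + \dim (vspan (@null_homotopic _ _ _ C D)))%N
  = \dim (vspan (@chain_map _ _ _ C D)).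
Proof.
move=> hC hD; apply: dim_mod_sub; [exact: chain_sub|exact: null_sub|].
by move=> f; exact: null_chain.
Qed.

Lemma mcomp1l C D (f : mor C D) m : homogeneous m f -> mcomp (mid C) f = f.
Proof.
move=> hf; apply/ffunP => -[a b]; rewrite ffunE /= (bigD1 a) //= ffunE /= eqxx.
rewrite big1 ?addr0 => [|c /negPf ca]; last by rewrite ffunE /= eq_sym ca mul0r.
have [/eqP e _] := hf a b; case: hG => _ [idM _ _ _] _.
by rewrite -[X in _ * X = _]e !mulrA idM eqxx.
Qed.

Lemma mcomp1r C D (f : mor C D) m : homogeneous m f -> mcomp f (mid D) = f.
Proof.
move=> hf; apply/ffunP => -[a b]; rewrite ffunE /= (bigD1 b) //= ffunE /= eqxx.
rewrite big1 ?addr0 => [|c /negPf ca]; last by rewrite ffunE /= ca mulr0.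
have [/eqP e _] := hf a b; case: hG => _ [idM _ _ _] _.
by rewrite -[X in X * _ = _]e -!mulrA idM eqxx !mulrA.
Qed.

Lemma mid_hom C : homogeneous 0 (mid C).
Proof.
apply/homogeneousE => a b p; rewrite ffunE /=.
have [->|_] := eqVneq a b; last by rewrite pcoef0 eqxx.
rewrite pcoef_idem //; have [->|_] := eqVneq p (cvert b, [::]); last by rewrite eqxx.
by rewrite addr0.
Qed.

Section Rep.
Variable X : sdata G.
Hypothesis hX : is_sdata X.

(** A common form for string and band complexes: the letter [q] acts between [r] copies of its end
    vertices through the matrix [J q]. *)
Definition rep r (J : sQ X -> 'M[k]_r) : complex G :=
  @Complex _ _ G ('I_r * sN X)%type (fun x => svt x.2) (fun x => sdg x.2)
    [ffun xy => \sum_(q : sQ X)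
       if (xy.1.2 == sfrom q) && (xy.2.2 == sto q)
       then J q xy.1.1 xy.2.1 *: ev (spi q) else 0].

Variables (r : nat) (J : sQ X -> 'M[k]_r).

Lemma repL D (f : mor (rep J) D) (i : 'I_r) (a : sN X) c :
  mcomp (diff (rep J)) f ((i, a), c) =
  \sum_q if a == sfrom q
         then \sum_i1 J q i i1 *: (ev (spi q) * f ((i1, sto q), c)) else 0.
Proof.
rewrite ffunE /=; under eq_bigr => x _ do rewrite /diff ffunE /= big_distrl /=.
rewrite exchange_big; apply: eq_bigr => q _ /=.
transitivity (\sum_i1 \sum_b (if (a == sfrom q) && (b == sto q)
  then J q i i1 *: ev (spi q) else 0) * f ((i1, b), c)).
  by rewrite pair_bigA; apply: eq_bigr => -[].
case: eqP => _; last by rewrite big1 // => i1 _; rewrite big1 // => b _; rewrite mul0r.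
apply: eq_bigr => i1 _; rewrite (bigD1 (sto q)) //= eqxx big1 ?addr0 ?scalerAl //.
by move=> b /negPf ->; rewrite mul0r.
Qed.

Lemma repR C (f : mor C (rep J)) (j : 'I_r) (b : sN X) c :
  mcomp f (diff (rep J)) (c, (j, b)) =
  \sum_q if b == sto q
         then \sum_j1 J q j1 j *: (f (c, (j1, sfrom q)) * ev (spi q)) else 0.
Proof.
rewrite ffunE /=; under eq_bigr => x _ do rewrite /diff ffunE /= big_distrr /=.
rewrite exchange_big; apply: eq_bigr => q _ /=.
transitivity (\sum_j1 \sum_a f (c, (j1, a)) * (if (a == sfrom q) && (b == sto q)
  then J q j1 j *: ev (spi q) else 0)).
  by rewrite pair_bigA; apply: eq_bigr => -[].
case: eqP => _; last first.
  by rewrite big1 // => i1 _; rewrite big1 // => a _; rewrite andbF mulr0.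
apply: eq_bigr => i1 _; rewrite (bigD1 (sfrom q)) //= eqxx big1 ?addr0 ?scalerAr //.
by move=> a /negPf ->; rewrite mulr0.
Qed.

Lemma rep_complex : is_complex (rep J).
Proof.
split.
  apply/homogeneousE => -[i a] [j b] p; rewrite /diff ffunE pcoef_sum /= => h.
  have /existsP[q] : [exists q, pcoef p (if (a == sfrom q) && (b == sto q)
      then J q i j *: ev (spi q) else 0) != 0].
    apply: contraNT h => /existsPn h; rewrite big1 // => q _; exact/eqP/negPn.
  case: (hX) => _ _ /(_ q)[np _ e1 e2 e3] _.
  case: andP => [[/eqP -> /eqP ->]|_]; last by rewrite pcoef0 eqxx.
  rewrite pcoefZ pcoef_ev //; have [->|_] := eqVneq p (spi q); first by [].
  by rewrite mulr0 eqxx.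
apply/ffunP => -[[i a] [j b]]; rewrite repL ffunE big1 // => q _.
case: eqP => // _; rewrite big1 // => i1 _; rewrite /diff ffunE big_distrr /= big1 ?scaler0 //.
move=> q' _; case: andP => [[/eqP e1 /eqP e2]|_]; last by rewrite mulr0.
rewrite -scalerAr ev_mul //; case: eqP => [e|]; rewrite ?scaler0 //.
have np : ~~ npath (pcat (spi q) (spi q')).
  rewrite npath_pcat ?spi_npath ?spi_nnil // -send_from -send_to.
  apply/negP => s; have [qq] := same_flag hX e1 s; rewrite qq.
  by case: (sdir q').
move: np; rewrite /npath is_path_pcat //.
have /andP[-> _] := spi_npath hX q; have /andP[-> _] := spi_npath hX q'.
by rewrite /= negbK => /eqP ->; rewrite scaler0.
Qed.

End Rep.
End Complexes.

(** * Coefficient matrices and the splitting of the Hom complex *)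

Section Division.
Variables (k : fieldType) (A : falgType k) (G : quiver_in A).
Hypothesis hG : gentle_algebra G.

(** Cancellation makes the quotient unique, so a coefficient of [ev v * u] is a single coefficient
    of [u] or 0; see [ldivP]. *)
Definition ldiv (v p0 : qpath G) : option (qpath G) :=
  if pselect (exists p, [/\ psrc v = ptgt p, p0 = pcat v p & npath p0]) is left h
  then Some (projT1 (cid h)) else None.
Definition rdiv (v p0 : qpath G) : option (qpath G) :=
  if pselect (exists p, [/\ psrc p = ptgt v, p0 = pcat p v & npath p0]) is left h
  then Some (projT1 (cid h)) else None.

Lemma ldiv_Some v p0 p : ldiv v p0 = Some p ->
  [/\ psrc v = ptgt p, p0 = pcat v p & npath p0].
Proof. by rewrite /ldiv; case: pselect => // h [<-]; exact: projT2 (cid h). Qed.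
Lemma rdiv_Some v p0 p : rdiv v p0 = Some p ->
  [/\ psrc p = ptgt v, p0 = pcat p v & npath p0].
Proof. by rewrite /rdiv; case: pselect => // h [<-]; exact: projT2 (cid h). Qed.

Lemma ldiv_pcat v p : psrc v = ptgt p -> npath (pcat v p) -> ldiv v (pcat v p) = Some p.
Proof.
move=> e n; case h: (ldiv v _) => [q|].
  by have [e1 e2 _] := ldiv_Some h; rewrite (pcat_injr _ _ e2).
by move: h; rewrite /ldiv; case: pselect => // -[]; exists p.
Qed.
Lemma rdiv_pcat v p : psrc p = ptgt v -> npath (pcat p v) -> rdiv v (pcat p v) = Some p.
Proof.
move=> e n; case h: (rdiv v _) => [q|].
  by have [e1 e2 _] := rdiv_Some h; rewrite (pcat_injl _ _ e2).
by move: h; rewrite /rdiv; case: pselect => // -[]; exists p.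
Qed.

Lemma ldivP v p0 u : npath v ->
  pcoef p0 (ev v * u) = if ldiv v p0 is Some p then pcoef p u else 0.
Proof.
move=> nv; case h: (ldiv v p0) => [p|].
  by have [e -> n] := ldiv_Some h; rewrite pcoef_mull // -h.
apply/eqP/negPn/negP => /(pcoef_mull_neq0 hG nv)[p [e1 e2 np _]].
by move: h; rewrite /ldiv; case: pselect => // -[]; exists p.
Qed.
Lemma rdivP v p0 u : npath v ->
  pcoef p0 (u * ev v) = if rdiv v p0 is Some p then pcoef p u else 0.
Proof.
move=> nv; case h: (rdiv v p0) => [p|].
  by have [e -> n] := rdiv_Some h; rewrite pcoef_mulr // -h.
apply/eqP/negPn/negP => /(pcoef_mulr_neq0 hG nv)[p [e1 e2 np _]].
by move: h; rewrite /rdiv; case: pselect => // -[]; exists p.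
Qed.

Variables (X Y : sdata G).
Hypotheses (hX : is_sdata X) (hY : is_sdata Y).

(** The conditions on the end points are included because [gpotL] and [gpotR] assume them. *)
Definition ncv (a : sN X) (b : sN Y) (p : qpath G) : bool :=
  [&& ptgt p == svt a, psrc p == svt b & ~~ cyc a b p].

Lemma ncvL q b p p0 : ldiv (spi q) p0 = Some p -> ncv (sfrom q) b p0 = ncv (sto q) b p.
Proof.
move=> /ldiv_Some[e -> n]; rewrite /ncv ptgt_pcat // spi_tgt // eqxx.
rewrite -e spi_src // eqxx -[psrc (pcat _ _)]/(psrc p) /=; congr (_ && ~~ _).
by rewrite cycL // -e spi_src.
Qed.

Lemma ncvR r a p p0 : rdiv (spi r) p0 = Some p -> ncv a (sto r) p0 = ncv a (sfrom r) p.
Proof.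
move=> /rdiv_Some[e -> n]; rewrite /ncv ptgt_pcat // e spi_tgt // eqxx.
rewrite -[psrc (pcat _ _)]/(psrc (spi r)) spi_src // eqxx /=; congr (_ && ~~ _).
by rewrite cycR // e spi_tgt.
Qed.

Section Cmx.
Variables (r s : nat) (J : sQ X -> 'M[k]_r) (K : sQ Y -> 'M[k]_s).
Local Notation C := (rep J).
Local Notation D := (rep K).
Implicit Types f g : mor C D.

Definition cmx f (a : sN X) (b : sN Y) (p : qpath G) : 'M[k]_(r, s) :=
  \matrix_(i, j) pcoef p (f ((i, a), (j, b))).

Lemma cmx_inj f g : (forall a b p, npath p -> cmx f a b p = cmx g a b p) -> f = g.
Proof.
move=> h; apply/ffunP => -[[i a] [j b]]; apply: (pcoef_ext hG) => p np.
by have /matrixP/(_ i j) := h a b p np; rewrite !mxE.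
Qed.

Lemma cmx_lin c f g a b p : cmx (c *: f + g) a b p = c *: cmx f a b p + cmx g a b p.
Proof. by apply/matrixP => i j; rewrite !mxE !ffunE pcoefD pcoefZ. Qed.
Lemma cmx0 a b p : cmx 0 a b p = 0.
Proof. by apply/matrixP => i j; rewrite !mxE ffunE pcoef0. Qed.
Lemma cmxD f g a b p : cmx (f + g) a b p = cmx f a b p + cmx g a b p.
Proof. by rewrite -[f]scale1r cmx_lin !scale1r. Qed.

Lemma cmxL f a b p0 : cmx (mcomp (diff C) f) a b p0 = \sum_q if a == sfrom q
  then J q *m (if ldiv (spi q) p0 is Some p then cmx f (sto q) b p else 0) else 0.
Proof.
apply/matrixP => i j; rewrite mxE repL pcoef_sum summxE; apply: eq_bigr => q _.
case: eqP => _; last by rewrite pcoef0 mxE.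
rewrite pcoef_sum mxE; apply: eq_bigr => i1 _.
rewrite pcoefZ (ldivP _ _ (spi_npath hX q)); congr (_ * _).
by case: (ldiv _ _) => [p|]; rewrite mxE.
Qed.

Lemma cmxR f a b p0 : cmx (mcomp f (diff D)) a b p0 = \sum_q if b == sto q
  then (if rdiv (spi q) p0 is Some p then cmx f a (sfrom q) p else 0) *m K q else 0.
Proof.
apply/matrixP => i j; rewrite mxE repR pcoef_sum summxE; apply: eq_bigr => q _.
case: eqP => _; last by rewrite pcoef0 mxE.
rewrite pcoef_sum mxE; apply: eq_bigr => i1 _.
rewrite pcoefZ (rdivP _ _ (spi_npath hY q)) mulrC; congr (_ * _).
by case: (rdiv _ _) => [p|]; rewrite mxE.
Qed.

Lemma homog_cmx m f : homogeneous m f <-> forall a b p, cmx f a b p != 0 ->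
  [/\ ptgt p = svt a, psrc p = svt b & sdg b = sdg a + m].
Proof.
split=> [/(homogeneousE hG) h a b p|h]; last first.
  apply/(homogeneousE hG) => -[i a] [j b] p cp; apply: h.
  by apply: contraNneq cp => /matrixP/(_ i j); rewrite !mxE => ->.
move=> nz; have [i [j ij]] : exists i j, pcoef p (f ((i, a), (j, b))) != 0.
  apply/not_existsP => h1; case/eqP: nz; apply/matrixP => i j; rewrite !mxE.
  by apply/eqP/negPn/negP => h2; apply: (h1 i); exists j.
by have := h _ _ _ ij.
Qed.

(** This projection onto the non-perpetual part commutes with composition with either differential,
    so chain maps and null-homotopic maps both split along it. *)
Definition ncp f : mor C D :=
  [ffun xy => mult (fun p => (ncv xy.1.2 xy.2.2 p)%:R) (f xy)].

Lemma cmx_ncp f a b p : cmx (ncp f) a b p = (ncv a b p)%:R *: cmx f a b p.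
Proof. by apply/matrixP => i j; rewrite !mxE ffunE pcoef_mult. Qed.

Lemma ncp_lin : linear ncp.
Proof.
move=> c f g; apply: cmx_inj => a b p _.
by rewrite cmx_lin !cmx_ncp cmx_lin scalerDr !scalerA mulrC.
Qed.

Lemma ncpK f : ncp (ncp f) = ncp f.
Proof.
by apply: cmx_inj => a b p _; rewrite !cmx_ncp scalerA; case: ncv; rewrite ?mulr1 ?mul0r.
Qed.

Lemma ncpL f : ncp (mcomp (diff C) f) = mcomp (diff C) (ncp f).
Proof.
apply: cmx_inj => a b p _; rewrite cmx_ncp !cmxL scaler_sumr; apply: eq_bigr => q _.
case: eqP => [->|]; last by rewrite scaler0.
case h: (ldiv _ _) => [p'|]; last by rewrite mulmx0 scaler0.
by rewrite cmx_ncp (ncvL _ h) scalemxAr.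
Qed.

Lemma ncpR f : ncp (mcomp f (diff D)) = mcomp (ncp f) (diff D).
Proof.
apply: cmx_inj => a b p _; rewrite cmx_ncp !cmxR scaler_sumr; apply: eq_bigr => q _.
case: eqP => [->|]; last by rewrite scaler0.
case h: (rdiv _ _) => [p'|]; last by rewrite mul0mx scaler0.
by rewrite cmx_ncp (ncvR _ h) scalemxAl.
Qed.

Lemma ncp_hom m f : homogeneous m f -> homogeneous m (ncp f).
Proof.
move=> /homog_cmx h; apply/homog_cmx => a b p; rewrite cmx_ncp => nz; apply: h.
by apply: contraNneq nz => ->; rewrite scaler0.
Qed.

Lemma ncp_chain f : chain_map f -> chain_map (ncp f).
Proof. by case=> h e; split; [exact: ncp_hom|rewrite -ncpL -ncpR e]. Qed.

Lemma ncp_add f g : ncp (f + g) = ncp f + ncp g.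
Proof. by have := ncp_lin 1 f g; rewrite !scale1r. Qed.

Lemma ncp_null f : null_homotopic f -> null_homotopic (ncp f).
Proof.
case=> h [hh ->]; exists (ncp h); split; first exact: ncp_hom.
by rewrite ncp_add ncpL ncpR.
Qed.

Definition nchain f := chain_map f /\ ncp f = f.
Definition nnull f := null_homotopic f /\ ncp f = f.
Definition cchain f := chain_map f /\ ncp f = 0.
Definition cnull f := null_homotopic f /\ ncp f = 0.

Lemma ncp_fix_sub : subsp (fun f => ncp f = f).
Proof.
split=> [|c f g hf hg]; last by rewrite ncp_lin hf hg.
by apply: cmx_inj => a b p _; rewrite cmx_ncp cmx0 scaler0.
Qed.

Lemma ncp0 : ncp 0 = 0. Proof. by case: ncp_fix_sub. Qed.

Lemma ncp_ker_sub : subsp (fun f => ncp f = 0).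
Proof. by split=> [|c f g hf hg]; rewrite ?ncp0 // ncp_lin hf hg scaler0 addr0. Qed.

Lemma dim_chain_split : \dim (vspan (@chain_map _ _ _ C D))
  = (\dim (vspan nchain) + \dim (vspan cchain))%N.
Proof.
by rewrite (dim_split (chain_sub hG C D) ncp_lin ncpK ncp_chain).
Qed.
Lemma dim_null_split : \dim (vspan (@null_homotopic _ _ _ C D))
  = (\dim (vspan nnull) + \dim (vspan cnull))%N.
Proof.
by rewrite (dim_split (null_sub hG C D) ncp_lin ncpK ncp_null).
Qed.

End Cmx.
End Division.

(** * Removing the blocks from the non-perpetual part *)

Section GaugeIso.
Variables (k : fieldType) (A : falgType k) (G : quiver_in A).
Hypothesis hG : gentle_algebra G.
Variables (X Y : sdata G).
Hypotheses (hX : is_sdata X) (hY : is_sdata Y).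
Variables (r' s' : nat).
Local Notation r := r'.+1.
Local Notation s := s'.+1.
Variables (U : 'M[k]_r) (V : 'M[k]_s).
Hypotheses (hU : U \is a GRing.unit) (hV : V \is a GRing.unit).
Variables (c : sQ X -> k) (d : sQ Y -> k) (dx : sQ X -> int) (dz : sQ Y -> int).

Let J q : 'M[k]_r := c q *: U ^ (dx q).
Let K q : 'M[k]_s := d q *: V ^ (dz q).
Local Notation C := (rep J).
Local Notation D := (rep K).
Local Notation C1 := (rep (fun q => (c q)%:M : 'M[k]_1)).
Local Notation D1 := (rep (fun q => (d q)%:M : 'M[k]_1)).

(** Powers of [U] act from the left and powers of [V] from the right, so each needs a potential of
    its own, with the weights of the other complex set to 0. The minus signs turn [gpotL] and
    [gpotR] into multiplication by [U ^ dx q] and [V ^ dz q]. *)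
Let NX := @gpot _ _ _ X Y (fun q => - dx q) (fun _ => 0).
Let NZ := @gpot _ _ _ X Y (fun _ => 0) (fun q => - dz q).

Let nc a b p : k := (@ncv _ _ _ X Y a b p)%:R.

Let gU_L q b p p0 : ldiv (spi q) p0 = Some p -> psrc p = svt b ->
  U ^ (NX (sfrom q) b p0) = U ^ (dx q) * U ^ (NX (sto q) b p).
Proof.
case/ldiv_Some => e e0 n sp; rewrite -exprzDr //; congr (_ ^ _).
rewrite /NX (gpotL hG hX hY) ?e0 //; first by rewrite -e0; ring.
  by rewrite -e spi_src.
by rewrite -e0.
Qed.

Let gV_L q b p p0 : ldiv (spi q) p0 = Some p -> psrc p = svt b ->
  NZ (sfrom q) b p0 = NZ (sto q) b p.
Proof.
case/ldiv_Some => e e0 n sp.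
rewrite /NZ [RHS](gpotL hG hX hY) -?e0 //; first by rewrite addr0.
by rewrite -e spi_src.
Qed.

Let gU_R q a p p0 : rdiv (spi q) p0 = Some p -> ptgt p = svt a -> ~~ cyc a (sfrom q) p ->
  NX a (sto q) p0 = NX a (sfrom q) p.
Proof.
case/rdiv_Some => e e0 n tp nc'.
rewrite /NX [RHS](gpotR hG hX hY) -?e0 //; first by rewrite addr0.
by rewrite e spi_tgt.
Qed.

Let gV_R q a p p0 : rdiv (spi q) p0 = Some p -> ptgt p = svt a -> ~~ cyc a (sfrom q) p ->
  V ^ (NZ a (sto q) p0) = V ^ (NZ a (sfrom q) p) * V ^ (dz q).
Proof.
case/rdiv_Some => e e0 n tp nc'; rewrite -exprzDr //; congr (_ ^ _).
rewrite /NZ [in RHS](gpotR hG hX hY) -?e0 //; first by ring.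
by rewrite e spi_tgt.
Qed.

Local Notation fam := {ffun 'I_r * 'I_s -> mor C1 D1}.

Let cmf (F : fam) a b (p : qpath G) : 'M[k]_(r, s) :=
  \matrix_(i, j) pcoef p (F (i, j) ((ord0, a), (ord0, b))).

(** On the coefficient matrix [M] at [(a, b, p)] this is [U ^ NX *m M *m V ^ NZ], cut down to the
    non-perpetual part; see [cmPsi]. *)
Let Psi (F : fam) : mor C D := [ffun xy =>
  \sum_(i < r) \sum_(j < s)
    mult (fun p => nc xy.1.2 xy.2.2 p * ((U ^ NX xy.1.2 xy.2.2 p) xy.1.1 i
                   * (V ^ NZ xy.1.2 xy.2.2 p) j xy.2.1))
         (F (i, j) ((ord0, xy.1.2), (ord0, xy.2.2)))].

Let Phi (f : mor C D) : fam := [ffun ij => [ffun xy =>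
  \sum_(i < r) \sum_(j < s)
    mult (fun p => nc xy.1.2 xy.2.2 p * ((U ^ (- NX xy.1.2 xy.2.2 p)) ij.1 i
                   * (V ^ (- NZ xy.1.2 xy.2.2 p)) j ij.2))
         (f ((i, xy.1.2), (j, xy.2.2)))]].

Let sum_mx (e : k) (P : 'M[k]_r) (Q : 'M[k]_s) (M : 'M[k]_(r, s)) i j :
  \sum_(i1 < r) \sum_(j1 < s) e * (P i i1 * Q j1 j) * M i1 j1
  = (e *: (P *m M *m Q)) i j.
Proof.
rewrite !mxE big_distrr exchange_big; apply: eq_bigr => j1 _ /=.
rewrite mxE big_distrl big_distrr; apply: eq_bigr => i1 _ /=; ring.
Qed.

Let cmPsi F a b p : cmx (Psi F) a b p =
  nc a b p *: (U ^ NX a b p *m cmf F a b p *m V ^ NZ a b p).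
Proof.
apply/matrixP => i j; rewrite -sum_mx mxE ffunE pcoef_sum; apply: eq_bigr => i1 _.
by rewrite pcoef_sum; apply: eq_bigr => j1 _; rewrite pcoef_mult // mxE.
Qed.

Let cmPhi f a b p : cmf (Phi f) a b p =
  nc a b p *: (U ^ (- NX a b p) *m cmx f a b p *m V ^ (- NZ a b p)).
Proof.
apply/matrixP => i j; rewrite -sum_mx mxE !ffunE pcoef_sum; apply: eq_bigr => i1 _.
by rewrite pcoef_sum; apply: eq_bigr => j1 _; rewrite pcoef_mult // mxE.
Qed.

Let expV t (x : 'M[k]_t.+1) n : x \is a GRing.unit -> x ^ n *m x ^ (- n) = 1%:M.
Proof. by move=> ux; rewrite mulmxE -exprzDr // subrr. Qed.
Let expV' t (x : 'M[k]_t.+1) n : x \is a GRing.unit -> x ^ (- n) *m x ^ n = 1%:M.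
Proof. by move=> ux; rewrite mulmxE -exprzDr // addNr. Qed.

Let nc2 a b p : nc a b p * nc a b p = nc a b p.
Proof. by rewrite /nc; case: ncv; rewrite ?mulr1 ?mul0r. Qed.

Let PsiPhi f : Psi (Phi f) = ncp f.
Proof.
apply: (cmx_inj hG) => a b p _; rewrite cmPsi cmPhi cmx_ncp // -/(nc a b p).
rewrite -scalemxAr -scalemxAl scalerA nc2 !mulmxA expV // mul1mx.
by rewrite -mulmxA expV' // mulmx1.
Qed.

Let PhiPsi F a b p : cmf (Phi (Psi F)) a b p = nc a b p *: cmf F a b p.
Proof.
rewrite cmPhi cmPsi -scalemxAr -scalemxAl scalerA nc2 !mulmxA expV' // mul1mx.
by rewrite -mulmxA expV // mulmx1.
Qed.

Let cmf_inj F F' : (forall a b p, npath p -> cmf F a b p = cmf F' a b p) -> F = F'.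
Proof.
move=> h; apply/ffunP => -[i j]; apply/ffunP => -[[i0 a] [j0 b]].
apply: (pcoef_ext hG) => p np; have /matrixP/(_ i j) := h a b p np.
by rewrite !mxE !ord1.
Qed.

Let cmf_nc (F : fam) a b p : (forall ij, ncp (F ij) = F ij) ->
   cmf F a b p = nc a b p *: cmf F a b p.
Proof.
move=> h; apply/matrixP => i j; rewrite !mxE -{1}h ffunE /=.
by rewrite pcoef_mult.
Qed.

Let Psi_lin : linear Psi.
Proof.
move=> t F F'; apply: (cmx_inj hG) => a b p _; rewrite cmx_lin !cmPsi.
have -> : cmf (t *: F + F') a b p = t *: cmf F a b p + cmf F' a b p.
  by apply/matrixP => i j; rewrite !mxE !ffunE pcoefD pcoefZ.
rewrite mulmxDr mulmxDl -scalemxAr -scalemxAl scalerDr !scalerA.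
by rewrite mulrC.
Qed.

Let Psi_inj (F : fam) : (forall ij, ncp (F ij) = F ij) -> Psi F = 0 -> F = 0.
Proof.
move=> nF F0; apply: cmf_inj => a b p _; rewrite (cmf_nc _ _ _ nF) -PhiPsi F0.
rewrite cmPhi cmx0 mulmx0 mul0mx scaler0; apply/matrixP => i j.
by rewrite !mxE ffunE ffunE pcoef0.
Qed.

Let cmf_hom m (F : fam) : (forall ij, homogeneous m (F ij)) <-> forall a b p, cmf F a b p != 0 ->
  [/\ ptgt p = svt a, psrc p = svt b & sdg b = sdg a + m].
Proof.
split=> [h a b p nz|h [i j]]; last first.
  apply/(homogeneousE hG) => -[i0 a] [j0 b] p cp; apply: h.
  by apply: contraNneq cp => /matrixP/(_ i j); rewrite !mxE !ord1 => ->.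
have [i [j ij]] : exists i j, pcoef p (F (i, j) ((ord0, a), (ord0, b))) != 0.
  apply/not_existsP => h1; case/eqP: nz; apply/matrixP => i j; rewrite !mxE.
  by apply/eqP/negPn/negP => h2; apply: (h1 i); exists j.
have /(homogeneousE hG) hF := h (i, j).
by have := hF _ _ _ ij.
Qed.

Let Psi_hom m (F : fam) : (forall ij, homogeneous m (F ij)) -> homogeneous m (Psi F).
Proof.
move=> /cmf_hom h; apply/(homog_cmx hG) => a b p; rewrite cmPsi => nz; apply: h.
by apply: contraNneq nz => ->; rewrite mulmx0 mul0mx scaler0.
Qed.

Let Phi_hom m (f : mor C D) : homogeneous m f -> forall ij, homogeneous m (Phi f ij).
Proof.
move=> /(homog_cmx hG) h; apply/cmf_hom => a b p; rewrite cmPhi => nz; apply: h.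
by apply: contraNneq nz => ->; rewrite mulmx0 mul0mx scaler0.
Qed.

Let dL (F : fam) : fam := [ffun ij => mcomp (diff C1) (F ij)].
Let dR (F : fam) : fam := [ffun ij => mcomp (F ij) (diff D1)].

Let cmf_cmx F i j a b p : cmf F a b p i j = cmx (F (i, j)) a b p ord0 ord0.
Proof. by rewrite !mxE. Qed.

Let cmf_dL F a b p0 : cmf (dL F) a b p0 = \sum_q if a == sfrom q
  then c q *: (if ldiv (spi q) p0 is Some p then cmf F (sto q) b p else 0) else 0.
Proof.
apply/matrixP => i j; rewrite cmf_cmx ffunE (cmxL hG hX) !summxE; apply: eq_bigr => q _.
case: eqP => _; last by rewrite !mxE.
rewrite mul_scalar_mx !mxE; congr (_ * _); case: ldiv => [p|]; by rewrite !mxE.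
Qed.

Let cmf_dR F a b p0 : cmf (dR F) a b p0 = \sum_q if b == sto q
  then d q *: (if rdiv (spi q) p0 is Some p then cmf F a (sfrom q) p else 0) else 0.
Proof.
apply/matrixP => i j; rewrite cmf_cmx ffunE (cmxR hG hY) !summxE; apply: eq_bigr => q _.
case: eqP => _; last by rewrite !mxE.
rewrite mul_mx_scalar !mxE; congr (_ * _); case: rdiv => [p|]; by rewrite !mxE.
Qed.

Let PsiL F : Psi (dL F) = mcomp (diff C) (Psi F).
Proof.
apply: (cmx_inj hG) => a b p0 _; rewrite cmPsi cmf_dL (cmxL hG hX).
rewrite mulmx_sumr mulmx_suml scaler_sumr; apply: eq_bigr => q _.
case: eqP => [->|_]; last by rewrite mulmx0 mul0mx scaler0.
case h: (ldiv _ _) => [p|]; last by rewrite scaler0 !mulmx0 mul0mx scaler0.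
rewrite cmPsi /nc (ncvL hG hX hY _ h); case np: (ncv _ _ _); last by rewrite !scale0r mulmx0.
have /and3P[_ /eqP sp _] := np.
rewrite (gU_L h sp) (gV_L h sp) !scale1r /J -mulmxE.
by rewrite -!scalemxAr -!scalemxAl !mulmxA.
Qed.

Let PsiR F : Psi (dR F) = mcomp (Psi F) (diff D).
Proof.
apply: (cmx_inj hG) => a b p0 _; rewrite cmPsi cmf_dR (cmxR hG hY).
rewrite mulmx_sumr mulmx_suml scaler_sumr; apply: eq_bigr => q _.
case: eqP => [->|_]; last by rewrite mulmx0 mul0mx scaler0.
case h: (rdiv _ _) => [p|]; last by rewrite scaler0 !mulmx0 !mul0mx scaler0.
rewrite cmPsi /nc (ncvR hG hX hY _ h); case np: (ncv _ _ _); last by rewrite !scale0r mul0mx.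
have /and3P[/eqP tp _ ncp] := np.
rewrite (gU_R h tp ncp) (gV_R h tp ncp) !scale1r /K -mulmxE.
by rewrite -!scalemxAr -!scalemxAl !mulmxA.
Qed.

Let famD (F F' : fam) ij : (F + F') ij = F ij + F' ij. Proof. by rewrite !ffunE. Qed.
Let famB (F F' : fam) ij : (F - F') ij = F ij - F' ij. Proof. by rewrite !ffunE. Qed.
Let dLE (F : fam) ij : dL F ij = mcomp (diff C1) (F ij). Proof. by rewrite ffunE. Qed.
Let dRE (F : fam) ij : dR F ij = mcomp (F ij) (diff D1). Proof. by rewrite ffunE. Qed.

Let PsiD F F' : Psi (F + F') = Psi F + Psi F'.
Proof. by have := Psi_lin 1 F F'; rewrite !scale1r. Qed.
Let PsiB F F' : Psi (F - F') = Psi F - Psi F'.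
Proof. by rewrite addrC -scaleN1r Psi_lin scaleN1r addrC. Qed.

Let nc_B f g : ncp f = f -> ncp g = g -> ncp (f - g : mor C1 D1) = f - g.
Proof.
by move=> hf hg; rewrite addrC -scaleN1r (ncp_lin hG) hf hg.
Qed.

Let Phi_nc f ij : ncp (Phi f ij) = Phi f ij.
Proof.
apply: (cmx_inj hG) => a b p _; rewrite (cmx_ncp hG); apply/matrixP => i j.
rewrite !ord1 mxE -/(nc a b p); case: ij => i1 j1.
by rewrite -cmf_cmx cmPhi mxE mulrA nc2.
Qed.

Let Psi_nc F : ncp (Psi F) = Psi F.
Proof.
by apply: (cmx_inj hG) => a b p _; rewrite (cmx_ncp hG) cmPsi scalerA -/(nc a b p) nc2.
Qed.

Let nchain_sub (r1 s1 : nat) (J1 : sQ X -> 'M[k]_r1) (K1 : sQ Y -> 'M[k]_s1) :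
  subsp (@nchain _ _ _ X Y r1 s1 J1 K1).
Proof. by apply: subsp_and; [exact: (chain_sub hG)|exact: (ncp_fix_sub hG)]. Qed.

Let nnull_sub (r1 s1 : nat) (J1 : sQ X -> 'M[k]_r1) (K1 : sQ Y -> 'M[k]_s1) :
  subsp (@nnull _ _ _ X Y r1 s1 J1 K1).
Proof. by apply: subsp_and; [exact: (null_sub hG)|exact: (ncp_fix_sub hG)]. Qed.

(** [T] is a predicate for all block sizes at once, as it is needed both for the given blocks and
    for scalars; it will be [nchain] and [nnull]. *)
Lemma gauge_dim (T : forall (r1 s1 : nat) (J1 : sQ X -> 'M[k]_r1)
    (K1 : sQ Y -> 'M[k]_s1), mor (rep J1) (rep K1) -> Prop) :
    (forall r1 s1 J1 K1, subsp (T r1 s1 J1 K1)) ->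
    (forall F : fam, (forall ij, T _ _ _ _ (F ij)) -> T _ _ _ _ (Psi F)) ->
    (forall f : mor C D, T _ _ _ _ f -> exists2 F : fam, (forall ij, T _ _ _ _ (F ij)) & Psi F = f) ->
    (forall f : mor C1 D1, T _ _ _ _ f -> ncp f = f) ->
  \dim (vspan (T _ _ J K)) = (r * s * \dim (vspan (T _ _ _ _ : mor C1 D1 -> Prop)))%N.
Proof.
move=> sT TPsi onto Tnc.
rewrite (dim_iso Psi_lin (S1 := fun F : fam => forall ij, T _ _ _ _ (F ij))) //.
- by rewrite dim_vspan_ffun // card_prod !card_ord.
- split=> [ij|t f g hf hg ij]; first by rewrite ffunE; case: (sT _ _ (fun q => (c q)%:M : 'M_1) (fun q => (d q)%:M : 'M_1)).
  by rewrite !ffunE; case: (sT _ _ (fun q => (c q)%:M : 'M_1) (fun q => (d q)%:M : 'M_1)) => _; apply.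
- by move=> F hF; apply: Psi_inj => ij; exact: Tnc.
Qed.

Theorem dim_nchain_gauge : \dim (vspan (@nchain _ _ _ X Y r s J K))
  = (r * s * \dim (vspan (@nchain _ _ _ X Y 1 1 (fun q => (c q)%:M) (fun q => (d q)%:M))))%N.
Proof.
apply: (gauge_dim (T := fun r1 s1 J1 K1 => @nchain _ _ _ X Y r1 s1 J1 K1)).
- by move=> *; exact: nchain_sub.
- move=> F hF; split; last exact: Psi_nc.
  split; first by apply: Psi_hom => ij; case: (hF ij) => -[].
  rewrite -PsiL -PsiR; congr Psi; apply/ffunP => ij; rewrite !ffunE.
  by case: (hF ij) => -[].
- move=> f [[hf ef] nf]; exists (Phi f); last by rewrite PsiPhi.
  move=> ij; split; last exact: Phi_nc.
  split; first exact: Phi_hom.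
  (* The condition on the family is tested after applying [Psi], which is injective on non-perpetual
     families. *)
  suff /ffunP/(_ ij) : dR (Phi f) - dL (Phi f) = 0.
    by rewrite famB dLE dRE [RHS]ffunE => /eqP; rewrite subr_eq0 => /eqP.
  apply: Psi_inj => [ij'|].
    by rewrite famB dLE dRE; apply: nc_B; rewrite ?(ncpL hG hX hY) ?(ncpR hG hX hY) ?Phi_nc.
  by rewrite PsiB PsiL PsiR PsiPhi nf ef subrr.
by move=> f [].
Qed.

Theorem dim_nnull_gauge : \dim (vspan (@nnull _ _ _ X Y r s J K))
  = (r * s * \dim (vspan (@nnull _ _ _ X Y 1 1 (fun q => (c q)%:M) (fun q => (d q)%:M))))%N.
Proof.
apply: (gauge_dim (T := fun r1 s1 J1 K1 => @nnull _ _ _ X Y r1 s1 J1 K1)).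
- by move=> *; exact: nnull_sub.
- move=> F hF; split; last exact: Psi_nc.
  have /fin_all_exists [h hh] ij : exists h : mor C1 D1, homogeneous (-1) h /\
      F ij = mcomp (diff C1) h + mcomp h (diff D1) by case: (hF ij).
  exists (Psi [ffun ij => h ij]); split.
    by apply: Psi_hom => ij; rewrite ffunE; case: (hh ij).
  rewrite -PsiL -PsiR -PsiD; congr Psi; apply/ffunP => ij; rewrite !ffunE.
  by case: (hh ij).
- move=> f [[h [hh ef]] nf]; exists (Phi f); last by rewrite PsiPhi.
  move=> ij; split; last exact: Phi_nc.
  exists (Phi h ij); split; first exact: Phi_hom.
  suff /ffunP/(_ ij) : Phi f - (dL (Phi h) + dR (Phi h)) = 0.
    by rewrite famB famD dLE dRE [RHS]ffunE => /eqP; rewrite subr_eq0 => /eqP.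
  apply: Psi_inj => [ij'|].
    rewrite famB famD dLE dRE; apply: nc_B; rewrite ?Phi_nc // ncp_add ?(ncpL hG hX hY) ?(ncpR hG hX hY) //.
    by rewrite Phi_nc.
  rewrite PsiB PsiD PsiL PsiR !PsiPhi -(ncpL hG hX hY) -(ncpR hG hX hY) -ncp_add // -ef.
  by rewrite subrr.
by move=> f [].
Qed.

End GaugeIso.

(** * Bands *)

Section Letters.
Variables (k : fieldType) (A : falgType k) (G : quiver_in A).
Hypothesis hG : gentle_algebra G.
Implicit Types l : letter G.

Definition lend l (o : bool) : pend G :=
  if direct l == o then oend (lpath l) else iend (lpath l).

Lemma nt_npath l : nontrivial_letter l -> npath (lpath l).
Proof. by case/and5P => p i _ _ _; rewrite /npath p. Qed.
Lemma nt_nnil l : nontrivial_letter l -> (lpath l).2 != [::].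
Proof. by case/and5P. Qed.
Lemma nt_inverse l : nontrivial_letter l -> inverse l = ~~ direct l.
Proof.
by case/and5P => _ _ _ ne _; rewrite /inverse /direct -leNgt le_eqVlt eq_sym (negPf ne).
Qed.
Lemma nt_deg l : nontrivial_letter l ->
  if direct l then lj l = li l + 1 else li l = lj l + 1.
Proof. by case/and5P => _ _ d ne _; rewrite /direct; case: ifP; move: d ne; lia. Qed.

Lemma lpath_src l : nontrivial_letter l ->
  psrc (lpath l) = if direct l then lsrc l else ltgt l.
Proof. by move=> nt; rewrite /lsrc /ltgt nt_inverse //; case: direct. Qed.
Lemma lpath_tgt l : nontrivial_letter l ->
  ptgt (lpath l) = if direct l then ltgt l else lsrc l.
Proof. by move=> nt; rewrite /lsrc /ltgt nt_inverse //; case: direct. Qed.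

Lemma ntrel_same (p q : qpath G) : npath p -> npath q -> p.2 != [::] -> q.2 != [::] ->
  psrc p = ptgt q -> in_ideal (pcat p q) -> ~~ same (iend p) (oend q).
Proof.
by move=> np nq p0 q0 e i; rewrite -npath_pcat // /npath i andbF.
Qed.

(** For letters of equal direction, a path product in the ideal separates the classes by
    [npath_pcat]; for opposite directions, ends of the same kind are in one class only if their
    arrows are equal. *)
Lemma linked_ends l' l : nontrivial_letter l' -> nontrivial_letter l ->
  linked l' l -> ~~ same (lend l true) (lend l' false).
Proof.
move=> nt' nt /and5P[_ /eqP e dd ii /andP[di id]].
move: dd ii di id; rewrite /lend !nt_inverse // /same_first /same_last.
case d: (direct l'); case d': (direct l) => //= h1 h2 h3 h4.
- rewrite same_sym; apply: ntrel_same; rewrite ?nt_npath ?nt_nnil //.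
  by rewrite lpath_src // lpath_tgt // d d'.
- by apply: contra h3 => /same_eq [<-].
- by apply: contra h4 => /same_eq [<-].
- apply: ntrel_same; rewrite ?nt_npath ?nt_nnil //.
  by rewrite lpath_src // lpath_tgt // d d'.
Qed.

End Letters.

(** * Rotations of cyclic words *)

Section Periodic.
Variables (T : Type) (x0 : T).

Lemma iter_ordS n (i : nat) (q : 'I_n) : iter i (@ordS n) q = ((q + i) %% n)%N :> nat.
Proof.
elim: i => [|i IH] /=; first by rewrite addn0 modn_small.
by rewrite IH addnS -addn1 modnDml addn1.
Qed.

Lemma iter_ordS_n n (q : 'I_n) : iter n (@ordS n) q = q.
Proof. by apply/val_inj; rewrite /= iter_ordS modnDr modn_small. Qed.

Lemma iter_ordS_pred n i (q : 'I_n) : iter i (@ordS n) (iter i (@ord_pred n) q) = q.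
Proof. by elim: i q => //= i IH q; rewrite -iterS iterSr ord_predK IH. Qed.
Lemma iter_pred_ordS n i (q : 'I_n) : iter i (@ord_pred n) (iter i (@ordS n) q) = q.
Proof. by elim: i q => //= i IH q; rewrite -iterS iterSr ordSK IH. Qed.

Lemma nth_power (v : seq T) m i : (i < m * size v)%N ->
  nth x0 (flatten (nseq m v)) i = nth x0 v (i %% size v)%N.
Proof.
elim: m i => // m IH i; rewrite mulSn => im; rewrite /= nth_cat.
case: ltnP => lt; first by rewrite modn_small.
by rewrite IH ?ltn_subLR // -{2}(subnK lt) modnDr.
Qed.

(** By Bezout, invariance under rotation by [d] implies invariance under rotation by the gcd of [d]
    and the length, so the word repeats its prefix of that length. *)
Lemma periodic_power (w : seq T) d : (0 < d < size w)%N ->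
    (forall i, nth x0 w ((i + d) %% size w)%N = nth x0 w (i %% size w)%N) ->
  exists g m, [/\ (1 < m)%N, (0 < g)%N & w = flatten (nseq m (take g w))].
Proof.
set n := size w => /andP[d0 dn] per; pose f i := nth x0 w (i %% n)%N.
have perM j i : f (i + j * d)%N = f i.
  by elim: j i => [|j IH] i; rewrite ?addn0 // mulSn addnA IH [LHS]per.
pose g := gcdn d n; have g0 : (0 < g)%N by rewrite gcdn_gt0 d0.
have gn : (g <= d)%N by apply: dvdn_leq; rewrite // dvdn_gcdl.
have perg i : f (i + g)%N = f i.
  case: (egcdnP n d0) => u v e _; rewrite -(perM u i) e -/g addnA addnAC.
  by rewrite /f [in RHS]addnC modnMDl.
have pergM j i : f (i + j * g)%N = f i.
  by elim: j i => [|j IH] i; rewrite ?addn0 // mulSn addnA IH perg.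
have gd : (g %| n)%N by rewrite dvdn_gcdr.
have nE : (n = n %/ g * g)%N by rewrite divnK.
exists g, (n %/ g)%N; split=> //.
  by rewrite ltn_divRL // mul1n (leq_ltn_trans gn).
have sg : size (take g w) = g by rewrite size_takel // ltnW // (leq_ltn_trans gn).
apply: (@eq_from_nth _ x0).
  by rewrite size_flatten /shape map_nseq sumn_nseq sg mulnC divnK.
move=> i; rewrite -/n => iw; rewrite nth_power ?sg -?nE // nth_take ?ltn_mod //.
have := pergM (i %/ g)%N (i %% g)%N; rewrite addnC -divn_eq /f modn_small // => ->.
by rewrite modn_small // (leq_trans (ltn_pmod i g0)) // ltnW // (leq_ltn_trans gn).
Qed.

End Periodic.

(** * Flags of a band *)

Section Band.
Variables (k : fieldType) (A : falgType k) (G : quiver_in A).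
Hypothesis hG : gentle_algebra G.
Variable w : seq (letter G).
Hypothesis hw : is_band w.

Definition bandX : sdata G :=
  @SData _ _ G 'I_(size w) 'I_(size w) id (@ord_pred _)
    (fun q => direct (nth_letter q)) (fun q => lpath (nth_letter q))
    (fun q => ltgt (nth_letter q)) (fun q => li (nth_letter q)).

Let ll : letters_linked w. Proof. by case: hw => /andP[]. Qed.
Let nt (q : 'I_(size w)) : nontrivial_letter (nth_letter q).
Proof. exact: nt_nth_letter. Qed.

Lemma bandX_sdata : is_sdata bandX.
Proof.
split; [by []|exact: ord_pred_inj|move=> q|].
  have /and5P[/eqP ej /eqP es _ _ _] := band_linked q hw.
  split; rewrite ?nt_npath ?nt_nnil //.
  - by rewrite /= lpath_src // /sto /sst /=; case: direct.
  - by rewrite /= lpath_tgt // /sfrom /sst /=; case: direct.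
  - by have := nt_deg (nt q); rewrite /sto /sfrom /sst /=; case: direct => /=; rewrite -ej.
have H q q' : q = ord_pred q' -> ~~ same (send (q : sQ bandX) true) (send (q' : sQ bandX) false).
  by move=> ->; apply: linked_ends => //; exact: band_linked.
move=> q q' [] [] /= e ne.
- by case: ne; rewrite e.
- exact: H.
- by rewrite same_sym; exact: H.
- by case: ne; rewrite (ord_pred_inj e).
Qed.

Definition bnx (o : bool) : 'I_(size w) -> 'I_(size w) :=
  if o then @ord_pred _ else @ordS _.

Lemma sst_bnx (q : sQ bandX) o : sst (bnx o q : sQ bandX) o = sst q (~~ o).
Proof. by case: o => //=; rewrite /bnx /sst /= ordSK. Qed.

(** On a cycle a forward step is [(size w).-1] backward steps, so a property along backward orbits
    holds along forward ones. *)
Lemma bnx_ordS o (q q' : 'I_(size w)) (P : 'I_(size w) -> 'I_(size w) -> Prop) :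
  (forall i, P (iter i (bnx o) q) (iter i (bnx o) q')) ->
  forall i, P (iter i (@ordS (size w)) q) (iter i (@ordS (size w)) q').
Proof.
case: o => // h i; suff E (x : 'I_(size w)) : iter i (@ordS (size w)) x = iter (i * (size w).-1) (@ord_pred (size w)) x.
  by rewrite !E; exact: h.
have n0 : (0 < size w)%N by case: x => x; exact: leq_ltn_trans (leq0n x).
have pE (y : 'I_(size w)) : iter (size w).-1 (@ord_pred (size w)) y = ordS y.
  apply: (@ord_pred_inj); rewrite ordSK -iterS prednK //.
  by rewrite -[RHS](iter_pred_ordS (size w)) iter_ordS_n.
by elim: i => //= i IH; rewrite mulSn iterD -IH pE.
Qed.

Let P1 (q q' : 'I_(size w)) : Prop :=
  lpath (nth_letter q) = lpath (nth_letter q') /\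
  direct (nth_letter q) = direct (nth_letter q').

(* A shift preserving paths and directions also preserves degrees, as the
   difference of the degrees is a constant whose sum over the band is 0. *)
Lemma band_shift (d : nat) : (forall q : 'I_(size w), P1 q (iter d (@ordS (size w)) q)) ->
  forall q, nth_letter q = nth_letter (iter d (@ordS (size w)) q).
Proof.
move=> h q; pose s := iter d (@ordS (size w)).
pose D x := li (nth_letter (s x)) - li (nth_letter x).
have ljE (x : 'I_(size w)) : lj (nth_letter x) = li (nth_letter (ord_pred x)).
  by have /and3P[/eqP ->] := band_linked x hw.
have sS x : s (ordS x) = ordS (s x) by rewrite /s -iterSr.
have DS x : D (ordS x) = D x.
  have := ljE (ordS x); have := ljE (s (ordS x)); rewrite ordSK sS ordSK -sS => e1 e2.
  have := nt_deg (nt (ordS x)); have := nt_deg (nt (s (ordS x))).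
  by have [_ <-] := h (ordS x); rewrite /D e1 e2; case: direct; lia.
have Dc x : D x = D q.
  have Di i : D (iter i (@ordS (size w)) q) = D q by elim: i => //= i IH; rewrite DS.
  (* The number of forward steps from [q] to [x], modulo the length. *)
  rewrite -(Di (x + (size w - q))%N); congr D; apply/val_inj; rewrite /= iter_ordS.
  rewrite addnCA subnKC ?(ltnW (ltn_ord q)) // modnDr modn_small //.
have IJ j : injective (iter j (@ordS (size w))) by elim: j => //= j IH x y /(@ordS_inj _) /IH.
have s_inj : injective s := IJ d.
have D0 : \sum_x D x = 0.
  rewrite /D sumrB; apply/eqP; rewrite subr_eq0; apply/eqP.
  by rewrite [RHS](reindex_inj s_inj).
have Dq : D q = 0.
  move: D0; rewrite (eq_bigr (fun _ => D q)) => [|x _]; last by rewrite Dc.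
  rewrite sumr_const card_ord => /eqP; rewrite mulrn_eq0.
  have n0 : (size w == 0)%N = false by apply: negbTE; rewrite -lt0n; exact: leq_ltn_trans (ltn_ord q).
  by rewrite n0 => /eqP.
have [e1 e2] := h q; move: Dq; rewrite /D /s => /eqP; rewrite subr_eq0 => /eqP e3.
have := nt_deg (nt q); have := nt_deg (nt (iter d (@ordS (size w)) q)); rewrite -e2 e3 => n1 n2.
case: (nth_letter q) (nth_letter (iter d _ q)) e1 e2 e3 n1 n2 => p i j [p' i' j'] /=.
by rewrite /direct /= => -> _ ->; case: ltP => _ h1 h2; congr Letter; lia.
Qed.

Lemma band_primitive d (q : 'I_(size w)) :
  (forall q : 'I_(size w), nth_letter q = nth_letter (iter d (@ordS (size w)) q)) ->
  iter d (@ordS (size w)) q = q.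
Proof.
move=> h; apply/eqP/negPn/negP => ne; have l0 := nth_letter q.
pose d' := (d %% size w)%N.
have n0 : (0 < size w)%N by case: (q) => x; exact: leq_ltn_trans (leq0n x).
have d'0 : (0 < d' < size w)%N.
  rewrite ltn_mod n0 andbT lt0n; apply: contra ne => /eqP d0; apply/eqP/val_inj.
  by rewrite /= iter_ordS -modnDmr -/d' d0 addn0 modn_small.
have [|g [m [m1 g0 e]]] := periodic_power (x0 := l0) d'0.
  move=> i; have im : (i %% size w < size w)%N by rewrite ltn_mod.
  have := h (Ordinal im); rewrite !(nth_letterE l0) /= iter_ordS /= => ->.
  by rewrite modnDml modnDmr.
case: hw => _ [_ [/(_ (take g w) m) prim _]]; apply: prim => //.
rewrite /nontrivial_string; case/andP: ll => a s.
apply/andP; split; last first.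
  rewrite /letters_linked take_sorted // andbT.
  by move: a; rewrite -{1}(cat_take_drop g w) all_cat => /andP[].
rewrite /nilp size_take; case: ifP => _; lia.
Qed.

(** For equal orientations a common reading gives a rotation of the band into itself, trivial by
    [band_shift] and [band_primitive]. For opposite orientations the band would read like its
    inverse. *)
Lemma band_flags (q1 q2 : 'I_(size w)) o1 o2 :
    (forall i, lpath (nth_letter (iter i (bnx o1) q1)) = lpath (nth_letter (iter i (bnx o2) q2))
      /\ (direct (nth_letter (iter i (bnx o1) q1)) == o1)
         = (direct (nth_letter (iter i (bnx o2) q2)) == o2)) ->
  (q1, o1) = (q2, o2).
Proof.
have H (p1 p2 : 'I_(size w)) :
    ~ (forall i, lpath (nth_letter (iter i (bnx true) p1))
               = lpath (nth_letter (iter i (bnx false) p2))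
      /\ (direct (nth_letter (iter i (bnx true) p1)) == true)
         = (direct (nth_letter (iter i (bnx false) p2)) == false)).
  (* [D] is the distance modulo the length, and the flags move towards each other. After [D./2]
     steps they are at one letter read in both directions if [D] is even, and at two consecutive
     letters with equal ends at their common vertex if [D] is odd; both are impossible. *)
  move=> h; pose D := (p1 + (size w - p2))%N.
  have e1 : p1 = iter D (@ordS (size w)) p2.
    apply/val_inj; rewrite /= iter_ordS /D addnCA subnKC ?(ltnW (ltn_ord p2)) //.
    by rewrite modnDr modn_small.
  have := h D./2; have DE : D = (odd D + D./2 + D./2)%N by rewrite -addnA addnn odd_double_half.
  set a := iter D./2 (bnx false) p2.
  have e2 : iter D (@ordS _) p2 = iter D./2 (@ordS _) (iter (odd D) (@ordS _) a).
    by rewrite {1}DE -addnA addnCA !iterD.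
  have -> : iter D./2 (bnx true) p1 = if odd D then ordS a else a.
    by rewrite e1 e2 iter_pred_ordS; case: (odd D).
  case: (odd D) => [[ep ed]|[_]]; last by case: direct.
  have e : sst (ordS a : sQ bandX) false = sst (a : sQ bandX) true by rewrite /sst /= ordSK.
  have ee : send (ordS a : sQ bandX) false = send (a : sQ bandX) true.
    by rewrite /send /= ep; move: ed; case: (direct (nth_letter (ordS a))); case: direct.
  have [] := same_flag bandX_sdata e _ => //.
  by rewrite ee; exact: same_refl (send_at bandX_sdata _ _).
have S o : (forall i, lpath (nth_letter (iter i (bnx o) q1)) = lpath (nth_letter (iter i (bnx o) q2))
      /\ (direct (nth_letter (iter i (bnx o) q1)) == o)
         = (direct (nth_letter (iter i (bnx o) q2)) == o)) -> q1 = q2.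
  move=> h; have h' : forall i, P1 (iter i (bnx o) q1) (iter i (bnx o) q2).
    by move=> i; have [e1 e2] := h i; split=> //; move: e2; do 2 case: direct; case: (o).
  have {}h' := bnx_ordS h'; pose D := (q2 + (size w - q1))%N.
  have qE (x y : 'I_(size w)) : y = iter (y + (size w - x)) (@ordS _) x.
    apply/val_inj; rewrite /= iter_ordS addnCA subnKC ?(ltnW (ltn_ord x)) //.
    by rewrite modnDr modn_small.
  rewrite (qE q1 q2) -/D; apply/esym/band_primitive/band_shift => x.
  rewrite (qE q1 x) -iterD (addnC D) (iterD (x + _)%N) /D -(qE q1 q2); exact: h'.
case: o1 o2 => [] [] h.
- by rewrite (S true h).
- by case: (H q1 q2 h).
- case: (H q2 q1) => i; have [e1 e2] := h i; rewrite e1; split=> //.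
- by rewrite (S false h).
Qed.

End Band.

(** * Components at letters and at identities *)

Section Components.
Variables (k : fieldType) (A : falgType k) (G : quiver_in A).
Hypothesis hG : gentle_algebra G.
Variables (X Y : sdata G).
Hypotheses (hX : is_sdata X) (hY : is_sdata Y).
Variables (r s : nat) (J : sQ X -> 'M[k]_r) (K : sQ Y -> 'M[k]_s).
Local Notation C := (rep J).
Local Notation D := (rep K).
Implicit Types f g h : mor C D.

Lemma oend_eq_letter q q' : sfrom q = sfrom q' -> oend (spi q) = oend (spi q') ->
  q = q' :> sQ X.
Proof.
move=> e o; apply: (same_flag hX e _).1; rewrite !send_from o.
exact: same_refl (oend_at (spi_nnil hX q')).
Qed.

Lemma iend_eq_letter q q' : sto q = sto q' -> iend (spi q) = iend (spi q') ->
  q = q' :> sQ Y.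
Proof.
move=> e o; apply: (same_flag hY e _).1; rewrite !send_to o.
apply: same_refl (iend_at (spi_nnil hY q') _); by case/andP: (spi_npath hY q').
Qed.

Lemma ldiv_same (v p : qpath G) : ldiv v v = Some p -> p = (psrc v, [::]).
Proof.
case/ldiv_Some; case: v p => x t [y t']; rewrite /pcat /psrc /= => e [<- /eqP].
by rewrite -[X in X == _]cats0 eqseq_cat // eqxx /= => /eqP <-.
Qed.

Lemma rdiv_same (v p : qpath G) : rdiv v v = Some p -> p = (ptgt v, [::]).
Proof.
case/rdiv_Some; case: v p => x t [y t']; rewrite /pcat /psrc /= => -> [/(congr1 size)].
by rewrite size_cat => e _; case: t' e => //= a t'; lia.
Qed.

(** Only [q] itself can be divided off its path at [sfrom q], since the last arrow of the path
    determines the letter there; what remains is an identity. *)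
Lemma cmxL_letter f (q : sQ X) b :
  cmx (mcomp (diff C) f) (sfrom q) b (spi q)
  = J q *m cmx f (sto q) b (svt (sto q), [::]).
Proof.
rewrite (cmxL hG hX) (bigD1 q) //= eqxx big1 ?addr0 => [|q' qq].
  case h: (ldiv _ _) => [p|]; first by rewrite (ldiv_same h) spi_src.
  have e : psrc (spi q) = ptgt (svt (sto q), [::]) by rewrite spi_src.
  have := ldiv_pcat e; rewrite (_ : pcat _ _ = spi q) ?h.
    by move/(_ (spi_npath hX q)).
  by rewrite pcat_nil.
case: eqP => // e; case h: (ldiv _ _) => [p|]; last by rewrite mulmx0.
have [_ e' _] := ldiv_Some h; case/eqP: qq; apply: oend_eq_letter => //.
by rewrite e' oend_pcat // spi_nnil.
Qed.

Lemma cmxR_letter f (q : sQ Y) a :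
  cmx (mcomp f (diff D)) a (sto q) (spi q)
  = cmx f a (sfrom q) (svt (sfrom q), [::]) *m K q.
Proof.
rewrite (cmxR hG hY) (bigD1 q) //= eqxx big1 ?addr0 => [|q' qq].
  case h: (rdiv _ _) => [p|]; first by rewrite (rdiv_same h) spi_tgt.
  have e : psrc (svt (sfrom q), [::]) = ptgt (spi q) by rewrite spi_tgt.
  have := rdiv_pcat e; rewrite (_ : pcat _ _ = spi q) ?h.
    by move/(_ (spi_npath hY q)).
  by rewrite nil_pcat.
case: eqP => // e; case h: (rdiv _ _) => [p|]; last by rewrite mul0mx.
have [_ e' _] := rdiv_Some h; case/eqP: qq; apply: iend_eq_letter => //.
by rewrite e' iend_pcat // spi_nnil.
Qed.

Lemma cmxL_triv f a b x : cmx (mcomp (diff C) f) a b (x, [::]) = 0.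
Proof.
rewrite (cmxL hG hX) big1 // => q _; case: eqP => // _.
case h: (ldiv _ _) => [p|]; last by rewrite mulmx0.
have [_ /(congr1 snd) + _] := ldiv_Some h; have := spi_nnil hX q.
by rewrite /pcat /=; case: (spi q).2.
Qed.

Lemma cmxR_triv f a b x : cmx (mcomp f (diff D)) a b (x, [::]) = 0.
Proof.
rewrite (cmxR hG hY) big1 // => q _; case: eqP => // _.
case h: (rdiv _ _) => [p|]; last by rewrite mul0mx.
have [_ /(congr1 snd) + _] := rdiv_Some h; have := spi_nnil hY q.
by rewrite /pcat /=; case: (spi q).2 => // c t; case: p.2.
Qed.

(** Differentials consist of paths of positive length, so a homotopy contributes nothing to identity
    components. *)
Lemma null_triv f a b x : null_homotopic f -> cmx f a b (x, [::]) = 0.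
Proof. by case=> h [_ ->]; rewrite cmxD // cmxL_triv cmxR_triv addr0. Qed.

Definition mkmor (T : sN X -> sN Y -> qpath G -> 'M[k]_(r, s)) : mor C D :=
  [ffun xy => \sum_(p <- npaths G) T xy.1.2 xy.2.2 p xy.1.1 xy.2.1 *: ev p].

Lemma cmx_mkmor T a b p : npath p -> cmx (mkmor T) a b p = T a b p.
Proof.
move=> np; apply/matrixP => i j; rewrite mxE ffunE pcoef_sum /=.
rewrite (bigD1_seq p) ?npaths_uniq ?mem_npaths //=.
rewrite pcoefZ pcoef_ev // eqxx mulr1 big_seq_cond big1 ?addr0 // => q.
by rewrite mem_npaths // pcoefZ => /andP[nq /negPf qp]; rewrite pcoef_ev // eq_sym qp mulr0.
Qed.

Lemma cmx_npath f a b p : cmx f a b p != 0 -> npath p.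
Proof.
apply: contraNT => np; apply/eqP/matrixP => i j; by rewrite !mxE pcoef_npathF.
Qed.

End Components.

(** * Perpetual walks between two bands *)

Section PerpBand.
Variables (k : fieldType) (A : falgType k) (G : quiver_in A).
Hypothesis hG : gentle_algebra G.
Variables (v w : seq (letter G)).
Hypotheses (hv : is_band v) (hw : is_band w).
Local Notation X := (bandX v).
Local Notation Y := (bandX w).
Let hX : is_sdata X := bandX_sdata hG hv.
Let hY : is_sdata Y := bandX_sdata hG hw.
Implicit Types e : sQ X * sQ Y.

Lemma cperp_next e : cperp e ->
  cperp (ord_pred e.1 : sQ X, bnx (sense e) e.2 : sQ Y)
  /\ sense (ord_pred e.1 : sQ X, bnx (sense e) e.2 : sQ Y) = sense e.
Proof.
move=> pe; have [[q' r'] pe' [+ o']] := cperp_step hX hY pe.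
rewrite /mpt; set o := sense e in o' *; case=> /= eq er.
rewrite o' in er; have r'E : r' = bnx o e.2.
  have E : sst (r' : sQ Y) o = sst (bnx o e.2 : sQ Y) o.
    by rewrite sst_bnx; case: (o) er.
  exact: (sst_inj hY E).
have q'E : q' = ord_pred e.1 by rewrite -[q']/(sst (q' : sQ X) true) eq.
by rewrite -r'E -q'E.
Qed.

Lemma cperp_iter e i : cperp e ->
  cperp (iter i (@ord_pred _) e.1 : sQ X, iter i (bnx (sense e)) e.2 : sQ Y)
  /\ sense (iter i (@ord_pred _) e.1 : sQ X, iter i (bnx (sense e)) e.2 : sQ Y) = sense e.
Proof.
move=> pe; elim: i => [|i [IH1 IH2]] /=; first by case: (e) pe.
by have := cperp_next IH1; rewrite IH2.
Qed.

Lemma cperp_content e i : cperp e ->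
  lpath (nth_letter (iter i (@ord_pred (size v)) e.1))
  = lpath (nth_letter (iter i (bnx (sense e)) e.2)) /\
  (direct (nth_letter (iter i (@ord_pred (size v)) e.1)) == true)
  = (direct (nth_letter (iter i (bnx (sense e)) e.2)) == sense e).
Proof.
move=> pe; have [pi si] := cperp_iter i pe; split.
  by have /eqP := cperp_matched pi.
by rewrite -{2}si /sense /=; do 2 case: direct.
Qed.

Lemma cperp_uniq_r (q : sQ X) (r r' : sQ Y) : cperp (q, r) -> cperp (q, r') ->
  (r, sense (q, r)) = (r', sense (q, r')).
Proof.
move=> p1 p2; apply: (band_flags hG hw) => i.
have [e1 e2] := cperp_content i p1; have [e3 e4] := cperp_content i p2.
by rewrite -e1 -e2 -e3 -e4.
Qed.

Lemma iter_bnx_size (w' : seq (letter G)) (q : 'I_(size w')) o :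
  iter (size w') (bnx o) q = q.
Proof.
case: o; last exact: iter_ordS_n.
by rewrite -[RHS](iter_pred_ordS (size w')) iter_ordS_n.
Qed.

Lemma iter_bnx_dvd (w' : seq (letter G)) (q : 'I_(size w')) o m :
  iter m (bnx o) q = q -> (size w' %| m)%N.
Proof.
have H : iter m (@ordS (size w')) q = q -> (size w' %| m)%N.
  move/(congr1 val); rewrite /= iter_ordS -[RHS](modn_small (ltn_ord q)).
  by rewrite -{2}[val q]addn0 => /eqP; rewrite eqn_modDl mod0n.
case: o => // e; apply: H; rewrite -{1}e; exact: iter_ordS_pred.
Qed.

(** After [size w] steps the letter of [Y] has returned, so the reading of [X] repeats and by
    [band_flags] its letter has returned too; hence [size v] divides [size w]. The converse is
    similar. *)
Lemma cperp_size e : cperp e -> size v = size w.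
Proof.
case: e => q r pe; apply/eqP; rewrite eqn_dvd; apply/andP; split.
  apply: (@iter_bnx_dvd v q true).
  have [] // : (iter (size w) (bnx true) q, true) = (q, true).
  apply: (band_flags hG hv) => i; rewrite -iterD.
  have [-> ->] := cperp_content (i + size w) pe.
  by have [-> ->] := cperp_content i pe; rewrite iterD iter_bnx_size.
apply: (@iter_bnx_dvd w r (sense (q, r))).
have [] := cperp_iter (size v) pe; rewrite (iter_bnx_size q true) => p1 s1.
by have [->] := cperp_uniq_r p1 pe.
Qed.

(** The walk from one perpetual pair runs through all letters of [v], and [cperp_uniq_r] makes the
    partner of each letter unique. *)
Lemma cperp_struct e0 : cperp e0 -> exists (o : bool) (rho : sQ X -> sQ Y),
  [/\ bijective rho, forall q r, cperp (q, r) = (r == rho q),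
      forall q, sense (q, rho q) = o
    & forall q : 'I_(size v), rho (ord_pred q) = bnx o (rho q)].
Proof.
case: e0 => q0 r0 pe0; set o := sense (q0, r0).
have qE (q : 'I_(size v)) : exists i, q = iter i (@ord_pred (size v)) q0.
  exists (q0 + (size v - q))%N.
  have -> : q0 = iter (q0 + (size v - q)) (@ordS (size v)) q.
    apply/val_inj; rewrite /= iter_ordS addnCA subnKC ?(ltnW (ltn_ord q)) //.
    by rewrite modnDr modn_small.
  rewrite [X in iter X (@ord_pred _)](_ : _ = (q0 + (size v - q))%N) ?iter_pred_ordS //.
  by rewrite /= iter_ordS addnCA subnKC ?(ltnW (ltn_ord q)) // modnDr modn_small.
have ex (q : sQ X) : exists r : sQ Y, cperp (q, r) /\ sense (q, r) = o.
  have [i ->] := qE q; exists (iter i (bnx o) r0); exact: (cperp_iter i pe0).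
have [rho hrho] := choice ex.
have rhoE (q : sQ X) (r : sQ Y) : cperp (q, r) = (r == rho q).
  have [p1 s1] := hrho q; apply/idP/eqP => [p2|-> //].
  by have [] := cperp_uniq_r p2 p1.
have rho_pred (q : 'I_(size v)) : rho (ord_pred q) = bnx o (rho q).
  have [p1 s1] := hrho q; have := (cperp_next p1).1.
  by rewrite /= s1 rhoE => /eqP.
exists o, rho; split=> //; last by move=> q; case: (hrho q).
apply: inj_card_bij; last by rewrite !card_ord (cperp_size pe0).
move=> q1 q2 e.
have [p1 s1] := hrho q1; have [p2 s2] := hrho q2.
have [] // : (q1, true) = (q2, true).
apply: (band_flags hG hv) => i.
have [-> ->] := cperp_content i p1; have [-> ->] := cperp_content i p2.
by rewrite /= s1 s2 e.
Qed.

End PerpBand.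

(** * The perpetual part as a two-term complex *)

Section CycBand.
Variables (k : fieldType) (A : falgType k) (G : quiver_in A).
Hypothesis hG : gentle_algebra G.
Variables (v w : seq (letter G)).
Hypotheses (hv : is_band v) (hw : is_band w).
Local Notation X := (bandX v).
Local Notation Y := (bandX w).
Let hX : is_sdata X := bandX_sdata hG hv.
Let hY : is_sdata Y := bandX_sdata hG hw.
Variables (o : bool) (rho : sQ X -> sQ Y).
Hypothesis rho_perp : forall (q : sQ X) (r : sQ Y), cperp (q, r) = (r == rho q).
Hypothesis rho_sense : forall q : sQ X, sense (q, rho q) = o.
Hypothesis rho_pred : forall q : 'I_(size v), rho (ord_pred q) = bnx o (rho q).

(** The vertex [a] is the upper end of the letter [a]; [o] tells which end of the partner [rho a]
    corresponds to it. *)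
Definition cvtx (a : sN X) : sN Y := sst (rho a) o.

Lemma cvtx_sst (q : sQ X) x : cvtx (sst q x) = sst (rho q) (x == o).
Proof.
case: x; rewrite /cvtx /=; first by case: (o).
rewrite /sst /= -/(sst _ _) rho_pred.
have := sst_bnx (rho q) o; rewrite /sst => ->; by case: (o).
Qed.

Lemma cvtx_from q : cvtx (sfrom q) = sfrom (rho q).
Proof.
rewrite /sfrom cvtx_sst; congr sst.
by have := rho_sense q; rewrite /sense /=; case: (o); do 2 case: direct.
Qed.

Lemma cvtx_to q : cvtx (sto q) = sto (rho q).
Proof.
rewrite /sto cvtx_sst; congr sst.
by have := rho_sense q; rewrite /sense /=; case: (o); do 2 case: direct.
Qed.

Lemma rho_spi q : spi (rho q) = spi q.
Proof.
have : cperp (q, rho q) by rewrite rho_perp eqxx.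
by move/cperp_matched/eqP => /= ->.
Qed.

Lemma sst_ex (a : sN X) : a = sfrom (a : sQ X) \/ a = sto (a : sQ X).
Proof. by rewrite /sfrom /sto; case: sdir; [left|right]. Qed.

Lemma svt_cvtx a : svt (cvtx a) = svt a.
Proof.
case: (sst_ex a) => ->; rewrite ?cvtx_from ?cvtx_to -?spi_tgt -?spi_src //.
  by rewrite rho_spi.
by rewrite rho_spi.
Qed.

Definition coff (a : sN X) : int := sdg (cvtx a) - sdg a.

(** A letter and its partner both raise the degree by 1 from [sfrom] to [sto], and the letters
    connect all vertices of the band. *)
Lemma coff_const a a' : coff a = coff a'.
Proof.
have H (q : 'I_(size v)) : coff (ord_pred q) = coff q.
  have e : coff (sto (q : sQ X)) = coff (sfrom (q : sQ X)).
    rewrite /coff cvtx_to cvtx_from.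
    case: (hX) => _ _ /(_ q)[_ _ _ _ ->] _; case: (hY) => _ _ /(_ (rho q))[_ _ _ _ ->] _.
    by ring.
  by move: e; rewrite /sto /sfrom /sst /=; case: direct.
have Di i : coff (iter i (@ordS (size v)) a') = coff a'.
  by elim: i => //= i IH; rewrite -H ordSK.
rewrite -(Di (a + (size v - a'))%N); congr coff; apply/val_inj; rewrite /= iter_ordS.
by rewrite addnCA subnKC ?(ltnW (ltn_ord a')) // modnDr modn_small.
Qed.

Lemma sdg_cvtx a a' : sdg (cvtx a) = sdg a + coff a'.
Proof. by rewrite (coff_const a' a) /coff; ring. Qed.

Lemma tcycE a b : tcyc a b = (b == cvtx a).
Proof.
apply/existsP/eqP => [[[q r] /andP[]]|->].
  rewrite rho_perp => /eqP -> /eqP [] /= <- <-; rewrite rho_sense.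
  by rewrite /cvtx /=; case: (o).
exists (a, rho a); rewrite rho_perp eqxx /mpt rho_sense /=; apply/eqP; congr pair.
Qed.

Lemma cycP a b p : cyc a b p -> ptgt p = svt a -> psrc p = svt b ->
  (p = (svt b, [::]) /\ b = cvtx a) \/
  exists q, [/\ a = sfrom q, b = sto (rho q) & p = spi q].
Proof.
rewrite /cyc; case: eqVneq => [p0|p0].
  rewrite tcycE => /eqP -> _ sp; left; split=> //.
  by case: p p0 sp => x t /= -> <-.
case/existsP => -[q r] /and4P[]; rewrite rho_perp => /eqP -> /= /eqP <- /eqP <- /eqP <- _ _.
by right; exists q.
Qed.

Lemma cyc_triv a : cyc a (cvtx a) (svt (cvtx a), [::]).
Proof. by rewrite /cyc /= tcycE. Qed.

Section Reps.
Variables (r s : nat) (J : sQ X -> 'M[k]_r) (K : sQ Y -> 'M[k]_s).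
Local Notation C := (rep J).
Local Notation D := (rep K).
Local Notation fn := {ffun 'I_(size v) -> 'M[k]_(r, s)}.
Implicit Types (f g h : mor C D) (u : fn).

Definition cval f : fn := [ffun a : sN X => cmx f a (cvtx a) (svt (cvtx a), [::])].
Definition cmk u : mor C D := mkmor J K (fun a b p =>
  if (b == cvtx a) && (p == (svt b, [::])) then u a else 0).

Lemma cval_lin c f g : cval (c *: f + g) = c *: cval f + cval g.
Proof. by apply/ffunP => a; rewrite !ffunE (cmx_lin c). Qed.

Lemma cmx_cmk u a b p : cmx (cmk u) a b p =
  if (b == cvtx a) && (p == (svt b, [::])) then u a else 0.
Proof.
case: (boolP (npath p)) => np; first by rewrite cmx_mkmor.
case: (eqVneq p (svt b, [::])) => [e|_].
  by rewrite e npath_idem in np.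
by rewrite andbF; apply/eqP/negPn/negP => /cmx_npath n; rewrite n in np.
Qed.

Lemma cval_cmk u : cval (cmk u) = u.
Proof. by apply/ffunP => a; rewrite ffunE cmx_cmk !eqxx. Qed.

Lemma cmk_hom u a0 : homogeneous (coff a0) (cmk u).
Proof.
apply/(homog_cmx hG) => a b p; rewrite cmx_cmk; case: andP => [[/eqP -> /eqP ->] _|_].
  by split; [exact: svt_cvtx| |exact: sdg_cvtx].
by rewrite eqxx.
Qed.

Lemma cmk_ncp u : ncp (cmk u) = 0.
Proof.
apply: (cmx_inj hG) => a b p _; rewrite (cmx_ncp hG) cmx0 cmx_cmk.
case: andP => [[/eqP -> /eqP ->]|_]; last by rewrite scaler0.
by rewrite /ncv cyc_triv !andbF scale0r.
Qed.

(** The perpetual part lives in two degrees only: identities in degree [coff], matched letters in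
    degree [coff + 1]. *)
Lemma cyc_supp g d : homogeneous d g -> ncp g = 0 ->
    (forall a, d = coff a -> cval g a = 0) ->
    (forall q, d = coff (sfrom q) + 1 -> cmx g (sfrom q) (sto (rho q)) (spi q) = 0) ->
  g = 0.
Proof.
move=> /(homog_cmx hG) hg ng h1 h2; apply: (cmx_inj hG) => a b p _; rewrite cmx0.
apply/eqP/negPn/negP => nz; have [tp sp dg] := hg _ _ _ nz.
have : cmx (ncp g) a b p = 0 by rewrite ng cmx0.
rewrite (cmx_ncp hG) /ncv tp sp !eqxx /=; case: (boolP (cyc a b p)) => [cy _|_]; last first.
  by rewrite scale1r => /eqP; apply/negP.
case: (cycP cy tp sp) => [[ep eb]|[q [ea eb ep]]]; case/eqP: nz.
  have := h1 a; rewrite ffunE ep eb; apply.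
  by move: dg; rewrite eb (sdg_cvtx a a); lia.
rewrite ea eb ep; apply: h2.
move: dg; rewrite ea eb -cvtx_to (sdg_cvtx _ (sfrom q)).
by case: (hX) => _ _ /(_ q)[_ _ _ _ ->] _; lia.
Qed.

Lemma cmxL_rho f q : cmx (mcomp (diff C) f) (sfrom q) (sto (rho q)) (spi q)
  = J q *m cval f (sto q).
Proof. by rewrite (cmxL_letter hG hX) ffunE svt_cvtx cvtx_to. Qed.

Lemma cmxR_rho f q : cmx (mcomp f (diff D)) (sfrom q) (sto (rho q)) (spi q)
  = cval f (sfrom q) *m K (rho q).
Proof. by rewrite -rho_spi (cmxR_letter hG hY) ffunE cvtx_from. Qed.

(** The kernel of the commutator with the differentials, from the identities to the matched
    letters. *)
Definition csol u : Prop := forall q, J q *m u (sto q) = u (sfrom q) *m K (rho q).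

Lemma csol_sub : subsp csol.
Proof.
split=> [q|c f g hf hg q]; first by rewrite !ffunE mulmx0 mul0mx.
by rewrite !ffunE mulmxDr mulmxDl -scalemxAr -scalemxAl hf hg.
Qed.

Lemma chain_csol f : chain_map f -> csol (cval f).
Proof. by case=> _ e q; rewrite -cmxL_rho -cmxR_rho e. Qed.

Lemma csol_chain u a0 : coff a0 = 0 -> csol u -> chain_map (cmk u).
Proof.
move=> c0 su; split; first by rewrite -c0; exact: cmk_hom.
apply/eqP; rewrite -subr_eq0 -scaleN1r addrC; apply/eqP.
have h1 : homogeneous 1 (mcomp (diff C) (cmk u)).
  by have := homogeneous_mcomp hG (rep_complex hG hX J).1 (cmk_hom u a0); rewrite c0 addr0.
have h2 : homogeneous 1 (mcomp (cmk u) (diff D)).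
  by have := homogeneous_mcomp hG (cmk_hom u a0) (rep_complex hG hY K).1; rewrite c0 add0r.
apply: (@cyc_supp _ 1).
- exact: (homogeneous_sub hG C D 1).2.
- rewrite (ncp_lin hG) (ncpL hG hX hY) (ncpR hG hX hY) cmk_ncp mcomp0l mcomp0r scaler0 addr0 //.
- by move=> a _; rewrite cval_lin !ffunE (cmxL_triv hG hX) (cmxR_triv hG hY) scaler0 addr0.
move=> q _; rewrite cmx_lin // cmxL_rho cmxR_rho cval_cmk su scaleN1r addNr //.
Qed.

Lemma dim_cchain a0 : coff a0 = 0 -> \dim (vspan (@cchain _ _ _ X Y r s J K)) = \dim (vspan csol).
Proof.
move=> c0; symmetry; apply: (dim_iso cval_lin).
- by apply: subsp_and; [exact: chain_sub|exact: ncp_ker_sub].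
- exact: csol_sub.
- by move=> f [cf _]; exact: chain_csol.
- move=> u su; exists (cmk u); last exact: cval_cmk.
  by split; [exact: (csol_chain c0)|exact: cmk_ncp].
move=> f [[hf _] nf] v0; apply: (cyc_supp hf nf) => [a _|q].
  by rewrite v0 ffunE.
by rewrite (coff_const _ a0) c0.
Qed.

Lemma dim_cnull0 a0 : coff a0 = 0 -> \dim (vspan (@cnull _ _ _ X Y r s J K)) = 0%N.
Proof.
move=> c0; apply/eqP; rewrite dimv_eq0; apply/eqP/vspaceP => f; rewrite memv0.
apply/idP/eqP => [/(vspanE _)|->]; last by exact: mem0v.
have sn : subsp (@cnull _ _ _ X Y r s J K).
  by apply: subsp_and; [exact: null_sub|exact: ncp_ker_sub].
case=> // nf pf; have [hf _] := null_chain hG (rep_complex hG hX J) (rep_complex hG hY K) nf.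
apply: (cyc_supp hf pf) => [a _|q]; last by rewrite (coff_const _ a0) c0.
by rewrite ffunE (null_triv hG hX hY _ _ _ nf).
Qed.

Let sg (a : sN X) : k := (-1) ^ (sdg a).
Let sg_to q : sg (sto q) = - sg (sfrom q).
Proof.
case: (hX) => _ _ /(_ q)[_ _ _ _ e] _; rewrite /sg e exprzDr ?unitrN1 //.
by rewrite mulrN1.
Qed.
Let sg2 a : sg a * sg a = 1.
Proof. by rewrite /sg -exprzMl ?unitrN1 // mulrNN mulr1 exp1rz. Qed.

(* For elements of degree -1, the sign [(-1) ^ sdg a] turns the anticommutation
   relation into the commutation relation. *)
Lemma cchain_cnull a0 : coff a0 <> 0 -> (coff a0 = -1 -> forall u, csol u -> u = 0) ->
  forall f, @cchain _ _ _ X Y r s J K f -> cnull f.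
Proof.
move=> c0 s0 f [[hf ef] nf]; split=> //.
case: (eqVneq (coff a0) (-1)) => [c1|/eqP c1]; last first.
  suff -> : f = 0 by case: (null_sub hG C D).
  by apply: (cyc_supp hf nf) => [a|q]; rewrite (coff_const _ a0) => h; exfalso; lia.
(* A band has as many letters as vertices, so [L] is an endomorphism of a finite-dimensional space;
   once injective it is onto, and [f] is a boundary. *)
pose L u : fn := [ffun q => J q *m u (sto q) + u (sfrom q) *m K (rho q)].
have Llin : linear L.
  move=> c u u'; apply/ffunP => q; rewrite !ffunE mulmxDr mulmxDl.
  by rewrite -scalemxAr -scalemxAl scalerDr addrACA.
pose L' : {linear fn -> fn} := HB.pack L (GRing.isLinear.Build k fn fn *:%R L Llin).
have LE u : linfun L' u = L u by rewrite lfunE.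
have ker0 : lker (linfun L') == 0%VS.
  rewrite -subv0; apply/subvP => u; rewrite memv_ker LE memv0 => /eqP Lu.
  have : csol [ffun a => sg a *: u a].
    move=> q; have := congr1 (fun g : fn => g q) Lu; rewrite !ffunE => /eqP.
    rewrite addr_eq0 => /eqP e; rewrite -scalemxAr e sg_to -scalemxAl.
    by rewrite scalerN scaleNr opprK.
  move/(s0 c1)/ffunP => h; apply/eqP/ffunP => a; have := h a; rewrite !ffunE.
  by move/(congr1 (fun M => sg a *: M)); rewrite scalerA sg2 scale1r scaler0.
pose y : fn := [ffun q => cmx f (sfrom q) (sto (rho q)) (spi q)].
have [u Lu] : exists u, L u = y.
  have : y \in limg (linfun L').
    by rewrite lker0_limgf ?memvf.
  by case/memv_imgP => u _; rewrite LE => ->; exists u.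
have hu : homogeneous (-1) (cmk u) by rewrite -c1; exact: cmk_hom.
exists (cmk u); split=> //; apply/eqP; rewrite -subr_eq0; apply/eqP.
have nu : null_homotopic (mcomp (diff C) (cmk u) + mcomp (cmk u) (diff D)).
  by exists (cmk u).
have [hn _] := null_chain hG (rep_complex hG hX J) (rep_complex hG hY K) nu.
rewrite addrC -scaleN1r; apply: (@cyc_supp _ 0).
- exact: (homogeneous_sub hG C D 0).2.
- rewrite (ncp_lin hG) (ncp_add hG) (ncpL hG hX hY) (ncpR hG hX hY) cmk_ncp.
  by rewrite mcomp0l mcomp0r nf !addr0 scaler0.
- by move=> a; rewrite (coff_const _ a0) c1.
move=> q _; rewrite cmx_lin // cmxD // cmxL_rho cmxR_rho cval_cmk scaleN1r.
have := congr1 (fun g : fn => g q) Lu; rewrite !ffunE => ->; exact: addNr.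
Qed.

(** A map of degree -1 that anticommutes with the differentials is what an isomorphism with the
    shift is made from, as the shift negates the differential. *)
Lemma csol_anti u a0 (su := [ffun a : sN X => (-1) ^ sdg a *: u a] : fn) :
  coff a0 = -1 -> csol u -> mcomp (diff C) (cmk su) + mcomp (cmk su) (diff D) = 0.
Proof.
move=> c1 hu; have hs : homogeneous (-1) (cmk su) by rewrite -c1; exact: cmk_hom.
have nu : null_homotopic (mcomp (diff C) (cmk su) + mcomp (cmk su) (diff D)).
  by exists (cmk su).
have [hn _] := null_chain hG (rep_complex hG hX J) (rep_complex hG hY K) nu.
apply: (@cyc_supp _ 0 hn).
- by rewrite (ncp_add hG) (ncpL hG hX hY) (ncpR hG hX hY) cmk_ncp mcomp0l mcomp0r addr0.
- by move=> a; rewrite (coff_const _ a0) c1.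
move=> q _; rewrite cmxD // cmxL_rho cmxR_rho cval_cmk !ffunE.
rewrite -scalemxAr -scalemxAl hu -/(sg _) -/(sg _) sg_to scaleNr.
exact: addNr.
Qed.

End Reps.
End CycBand.

(** * Intertwiners of Jordan blocks *)

Section Jordan.
Variable k : fieldType.

Definition jord r (lam : k) : 'M[k]_r :=
  \matrix_(i, j) if j == i then lam else if j == i.+1 :> nat then 1 else 0.

Lemma jord_unit r lam : lam != 0 -> jord r lam \in unitmx.
Proof.
move=> l0; rewrite unitmxE -det_tr det_trig.
  by rewrite unitfE; apply/prodf_neq0 => i _; rewrite !mxE eqxx.
apply/is_trig_mxP => i j ij; rewrite !mxE.
by case: eqP => [e|_]; [rewrite e ltnn in ij|case: eqP ij => // ->; lia].
Qed.

Lemma jordE r lam : jord r lam = lam%:M + jord r 0.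
Proof.
apply/matrixP => i j; rewrite !mxE (eq_sym i j); case: (j == i).
  by rewrite addr0.
by rewrite mulr0n add0r.
Qed.

Lemma jord0_entry r (i j : 'I_r) : jord r 0 i j = (j == i.+1 :> nat)%:R.
Proof.
rewrite mxE; case: (eqVneq j i) => [->|_]; last by case: eqP.
by rewrite (_ : (i == i.+1 :> nat) = false) //; apply/eqP; lia.
Qed.

Lemma sum_jord0 r (i : 'I_r) (F : 'I_r -> k) :
  \sum_l jord r 0 i l * F l = \sum_(l < r | l == i.+1 :> nat) F l.
Proof.
rewrite [RHS]big_mkcond; apply: eq_bigr => l _; rewrite jord0_entry.
by case: eqP => _; rewrite ?mul1r ?mul0r.
Qed.

Lemma jord0_exp s' m :
  (jord s'.+1 0) ^+ m = \matrix_(i, j) (j == (i + m)%N :> nat)%:R.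
Proof.
elim: m => [|m IH]; apply/matrixP => i j.
  by rewrite expr0 !mxE addn0 eq_sym.
rewrite exprS IH -mulmxE mxE sum_jord0 [RHS]mxE.
case: (ltnP i.+1 s'.+1) => [lt|ge].
  rewrite (big_pred1 (Ordinal lt)) => [|l]; first by rewrite mxE /= addSnnS.
  by rewrite /= -val_eqE.
rewrite big_pred0 => [|l]; last by apply/eqP; have := ltn_ord l; lia.
by case: eqP => // e; have := ltn_ord j; lia.
Qed.

Lemma jord0_nilp s' m : (s' < m)%N -> (jord s'.+1 0) ^+ m = 0.
Proof.
move=> lt; rewrite jord0_exp; apply/matrixP => i j; rewrite !mxE.
by case: eqP => // e; have := ltn_ord j; lia.
Qed.

Definition itw r s (P : 'M[k]_r) (Q : 'M[k]_s) (M : 'M[k]_(r, s)) : Prop :=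
  P *m M = M *m Q.

Lemma itw_sub r s P Q : subsp (@itw r s P Q).
Proof.
split=> [|c f g]; rewrite /itw ?mulmx0 ?mul0mx // => hf hg.
by rewrite mulmxDr mulmxDl -scalemxAr -scalemxAl hf hg.
Qed.

(** The nilpotent block shifts a row to the right, so the kernel of its power [m] is the space of
    rows supported on the last [minn m s'.+1] entries; [phi] embeds these. *)
Lemma dim_ker_jord s' m :
  \dim (vspan (fun y : 'rV[k]_s'.+1 => y *m (jord s'.+1 0) ^+ m = 0)) = minn m s'.+1.
Proof.
set S := fun y => _; set t := minn m s'.+1.
have ts : (t <= s'.+1)%N by rewrite geq_minr.
have SE y : S y <-> forall j : 'I_s'.+1, (j + m < s'.+1)%N -> y ord0 j = 0.
  have E j : (y *m (jord s'.+1 0) ^+ m) ord0 j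
           = if (m <= j)%N then y ord0 (inord (j - m)) else 0.
    rewrite jord0_exp mxE; case: leqP => lt.
      rewrite (bigD1 (inord (j - m))) //= big1 ?addr0 => [|l ne].
        rewrite mxE inordK ?subnK ?eqxx ?mulr1 //.
        by apply: leq_ltn_trans (ltn_ord j); rewrite leq_subr.
      rewrite mxE; case: eqP => [e|_]; rewrite ?mulr0 //.
      by case/eqP: ne; apply/val_inj; rewrite /= inordK; have := ltn_ord j; lia.
    by rewrite big1 // => l _; rewrite mxE; case: eqP => [e|]; rewrite ?mulr0 //; lia.
  split=> [h j lt|h].
    have := congr1 (fun M : 'rV_s'.+1 => M ord0 (inord (j + m))) h.
    rewrite /= E inordK // leq_addl addnK mxE => <-; congr (y _ _).
    by apply/val_inj; rewrite /= inordK.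
  apply/rowP => j; rewrite [LHS]E mxE; case: leqP => // lt; apply: h.
  by rewrite inordK; have := ltn_ord j; lia.
pose phi (z : 'rV[k]_t) : 'rV[k]_s'.+1 :=
  \row_j \sum_(i < t | (i + (s'.+1 - t))%N == j) z ord0 i.
have phiE z (i : 'I_t) : phi z ord0 (inord (i + (s'.+1 - t))) = z ord0 i.
  have lt : (i + (s'.+1 - t) < s'.+1)%N by have := ltn_ord i; lia.
  rewrite mxE (bigD1 i) /= ?inordK // big1 ?addr0 // => j /andP[/eqP e ne].
  by case/eqP: ne; apply/val_inj => /=; lia.
rewrite (@dim_iso _ _ _ phi _ (fun _ => True)).
- have -> : vspan (fun _ : 'rV[k]_t => True) = fullv.
    apply/vspaceP => f; rewrite memvf; apply/idP; exact/(vspanE _).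
  by rewrite dimvf /dim /= mul1n.
- move=> c y z; apply/rowP => j; rewrite !mxE big_distrr -big_split.
  by apply: eq_bigr => i _; rewrite !mxE.
- by [].
- by split=> [|c f g]; rewrite /S ?mul0mx // mulmxDl -scalemxAl => -> ->; rewrite scaler0 addr0.
- move=> z _; apply/SE => j lt; rewrite mxE big1 // => i /eqP e.
  by move: lt; rewrite -e /t; have := ltn_ord i; lia.
- move=> y /SE Sy; exists (\row_i y ord0 (inord (i + (s'.+1 - t)))) => //.
  apply/rowP => j; rewrite mxE; case: (ltnP (j + m) s'.+1) => lt.
    by rewrite Sy // big1 // => i /eqP e; move: lt; rewrite -e /t; have := ltn_ord i; lia.
  have jt : (j - (s'.+1 - t) < t)%N by have := ltn_ord j; rewrite /t; lia.
  have je : (j - (s'.+1 - t) + (s'.+1 - t))%N = j by rewrite /t; have := ltn_ord j; lia.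
  rewrite (bigD1 (Ordinal jt)) /= ?je // big1 ?addr0 => [|i /andP[/eqP e ne]].
    by rewrite mxE /= je; congr (y _ _); apply/val_inj; rewrite /= inordK.
  by case/eqP: ne; apply/val_inj => /=; lia.
move=> z _ z0; apply/rowP => i; have := phiE z i.
by rewrite z0 !mxE.
Qed.

(** An intertwiner is determined by its first row [y], its row [i] being [y *m Q ^+ i]. The equation
    for the last row is [y *m Q ^+ r'.+1 = 0], from which the commuting unit [S] cancels. *)
Lemma dim_itw_jord0 r' s' (S : 'M[k]_s'.+1) : S \in unitmx -> GRing.comm (jord s'.+1 0) S ->
  \dim (vspan (itw (jord r'.+1 0) (jord s'.+1 0 * S))) = minn r'.+1 s'.+1.
Proof.
move=> uS cS; set Q := jord s'.+1 0 * S; rewrite -dim_ker_jord.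
have QE m : Q ^+ m = jord s'.+1 0 ^+ m * S ^+ m by rewrite exprMn_comm.
have rowN (M : 'M[k]_(r'.+1, s'.+1)) (i : 'I_r'.+1) :
    row i (jord r'.+1 0 *m M) = if (i.+1 < r'.+1)%N then row (inord i.+1) M else 0.
  apply/rowP => j; rewrite mxE [LHS]mxE sum_jord0; case: ltnP => lt.
    rewrite (big_pred1 (inord i.+1)) ?mxE // => l.
    by rewrite /= -val_eqE /= inordK.
  by rewrite mxE big_pred0 // => l; apply/eqP; have := ltn_ord l; lia.
have itwE M : itw (jord r'.+1 0) Q M -> forall i : 'I_r'.+1, row i M = row ord0 M *m Q ^+ i.
  move=> h [i]; elim: i => [|i IH] lt.
    by rewrite expr0 mulmx1; congr row; apply/val_inj.
  have lt' : (i < r'.+1)%N by lia.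
  have := congr1 (row (Ordinal lt')) h; rewrite rowN /= lt row_mul IH /=.
  rewrite -mulmxA mulmxE -exprSr => <-; congr row; apply/val_inj => /=.
  by rewrite inordK.
apply/esym; apply: (@dim_iso _ _ _ (row ord0) _ (itw (jord r'.+1 0) Q)).
- by move=> c f g; rewrite linearP.
- exact: itw_sub.
- by split=> [|c f g]; rewrite ?mul0mx // mulmxDl -scalemxAl => -> ->; rewrite scaler0 addr0.
- move=> M h; have := congr1 (row (ord_max : 'I_r'.+1)) h.
  rewrite rowN /= ltnn row_mul (itwE M h ord_max) -mulmxA mulmxE -exprSr QE -mulmxE mulmxA.
  move/(congr1 (fun y => y *m invmx (S ^+ r'.+1))); rewrite mulmxK ?mul0mx //.
  by rewrite -[_ \in _]/(_ \is a GRing.unit) unitrX.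
- move=> y y0; pose M : 'M_(r'.+1, s'.+1) := \matrix_(i, j) (y *m Q ^+ i) ord0 j.
  have rE i : row i M = y *m Q ^+ i.
    by apply/rowP => j; rewrite mxE [LHS]mxE.
  exists M.
    apply/row_matrixP => i; rewrite rowN row_mul !rE -mulmxA mulmxE -exprSr.
    case: ltnP => lt; first by rewrite inordK.
    have -> : i.+1 = r'.+1 by have := ltn_ord i; lia.
    by rewrite QE -mulmxE mulmxA y0 mul0mx.
  by rewrite rE expr0 mulmx1.
move=> M h M0; apply/row_matrixP => i; rewrite (itwE M h) M0 mul0mx.
by rewrite row0.
Qed.

Definition jordX s (mu : k) (e : bool) : 'M[k]_s :=
  if e then jord s mu else invmx (jord s mu).
Definition muX (mu : k) (e : bool) : k := if e then mu else mu^-1.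

(** This form treats the block and its inverse alike. With [N] the nilpotent part and [T] the
    inverse, [T = mu^-1 - mu^-1 * N * T], which gives [S]. *)
Lemma jordXE s' mu e : mu != 0 -> exists2 S : 'M[k]_s'.+1,
  S \in unitmx /\ GRing.comm (jord s'.+1 0) S
  & jordX s'.+1 mu e = (muX mu e)%:M + jord s'.+1 0 * S.
Proof.
move=> m0; case: e; first by exists 1; rewrite ?unitmx1 ?mulr1 -?jordE //; split=> //; exact: commr1.
set N := jord s'.+1 0; set T := jordX _ _ _.
have uJ := jord_unit s'.+1 m0.
have cN : GRing.comm N (jord s'.+1 mu).
  rewrite jordE; apply: commrD; last exact: commr_refl.
  by rewrite /GRing.comm -!mulmxE mul_scalar_mx mul_mx_scalar.
have cT : GRing.comm N T by apply: commrV.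
exists (- mu^-1 *: T).
  split; last by rewrite /GRing.comm -scalerAr -scalerAl cT.
  by rewrite unitmxZ ?unitfE ?oppr_eq0 ?invr_eq0 // unitmx_inv.
apply: (can_inj (mulrK uJ)); rewrite mulVr // mulrDl -mulrA -scalerAl mulVr //.
rewrite /= -scalerAr mulr1 -/N -mulmxE mul_scalar_mx jordE scalerDr scale_scalar_mx.
by rewrite mulVf // -addrA scaleNr subrr addr0.
Qed.

Lemma dim_itw_eq r' s' mu e : mu != 0 ->
  \dim (vspan (itw (jord r'.+1 (muX mu e)) (jordX s'.+1 mu e))) = minn r'.+1 s'.+1.
Proof.
move=> m0; have [S [uS cS] ->] := jordXE s' e m0; rewrite -(dim_itw_jord0 r' uS cS).
apply: dim_vspan_eq; [exact: itw_sub|exact: itw_sub|move=> M].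
rewrite /itw jordE mulmxDl mulmxDr mul_scalar_mx mul_mx_scalar.
by split=> [/addrI|->].
Qed.

(** Subtracting the eigenvalue [muX mu e] on both sides leaves an invertible matrix on the left and
    a nilpotent one on the right; a high power of the relation kills [M]. *)
Lemma itw_neq r' s' lam mu e M : mu != 0 -> lam != muX mu e ->
  itw (jord r'.+1 lam) (jordX s'.+1 mu e) M -> M = 0.
Proof.
move=> m0 ne; have [S [uS cS] ->] := jordXE s' e m0; set Q := _ * S.
rewrite /itw jordE mulmxDl mulmxDr mul_scalar_mx mul_mx_scalar => h.
set R := jord r'.+1 (lam - muX mu e).
have {}h : R *m M = M *m Q.
  by rewrite /R jordE mulmxDl mul_scalar_mx scalerBl -addrA addrCA addrC h addrC addKr.
have hm m : R ^+ m *m M = M *m Q ^+ m.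
  elim: m => [|m IH]; first by rewrite !expr0 mul1mx mulmx1.
  by rewrite exprSr -mulmxE -mulmxA h mulmxA IH -mulmxA mulmxE -exprSr.
have := hm s'.+1; rewrite /Q exprMn_comm // jord0_nilp // mul0r mulmx0.
move/(congr1 (mulmx (invmx (R ^+ s'.+1)))); rewrite mulKmx ?mulmx0 //.
rewrite -[_ \in _]/(_ \is a GRing.unit) unitrX //.
by apply: jord_unit; rewrite subr_eq0.
Qed.

End Jordan.

(** * Monodromy around a band *)

Section Monodromy.
Variables (k : fieldType) (A : falgType k) (G : quiver_in A).
Variables (v w : seq (letter G)).
Variable rho : 'I_(size v) -> 'I_(size w).
Hypothesis rho_bij : bijective rho.
Variables (i0 : 'I_(size v)) (j0 : 'I_(size w)).
Hypotheses (i00 : i0 = 0%N :> nat) (j00 : j0 = 0%N :> nat).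

Definition bJ r (lam : k) n (q : 'I_n) : 'M[k]_r :=
  if q == 0%N :> nat then jord r lam else 1%:M.

Local Notation dir q := (direct (nth_letter q)).
Local Notation csolv r s lam mu :=
  (@csol _ _ _ v w rho r s (bJ r lam (n := size v)) (bJ s mu (n := size w))).

(** The letter of [v] whose partner carries the block of [mu]; the block of [lam] sits at [i0]. *)
Definition turn_at : 'I_(size v) := odflt i0 [pick q | rho q == j0].

Lemma turn_atP q : (rho q == 0%N :> nat) = (q == turn_at).
Proof.
have -> : (rho q == 0%N :> nat) = (rho q == j0) by rewrite -val_eqE /= j00.
rewrite /turn_at; case: pickP => [x /eqP <-|h]; first by rewrite (bij_eq rho_bij).
by case: rho_bij => g gK Kg; have := h (g j0); rewrite Kg eqxx.
Qed.

(* Whether the monodromy along [w] is its Jordan block or the inverse. *)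
Definition turn_sense : bool :=
  if turn_at == i0 then true else dir i0 == dir turn_at.

Variables (r' s' : nat) (lam mu : k).
Hypothesis mu0 : mu != 0.
Local Notation r := r'.+1.
Local Notation s := s'.+1.
Local Notation Jm := (jord s mu).

Let uJ : Jm \in unitmx. Proof. exact: jord_unit. Qed.

Definition turn : 'M[k]_s := if dir turn_at then invmx Jm else Jm.
(** Solving the equations letter by letter upwards from [i0] meets one nontrivial matrix, at
    [turn_at]. If [turn_at] is [i0], this matrix occurs only in the equation that closes the
    cycle. *)
Definition transport (q : 'I_(size v)) : 'M[k]_s :=
  if (turn_at != i0) && (turn_at <= q)%N then turn else 1%:M.

Let uT : turn \in unitmx. Proof. by rewrite /turn; case: ifP => _; rewrite ?unitmx_inv. Qed.

Lemma transport_unit q : transport q \in unitmx.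
Proof. by rewrite /transport; case: ifP => _; rewrite ?unitmx1. Qed.

Let KE (q : 'I_(size v)) : bJ s mu (rho q) = if q == turn_at then Jm else 1%:M.
Proof. by rewrite /bJ turn_atP. Qed.

Let csolE (u : {ffun 'I_(size v) -> 'M[k]_(r, s)}) : csolv r s lam mu u <-> forall q : 'I_(size v),
  if dir q then bJ r lam q *m u (ord_pred q) = u q *m bJ s mu (rho q)
  else bJ r lam q *m u q = u (ord_pred q) *m bJ s mu (rho q).
Proof.
by split=> h q; have := h q; rewrite /sto /sfrom /sst /=; case: direct.
Qed.

Let predE (q : 'I_(size v)) : q != i0 -> ord_pred q = q.-1 :> nat.
Proof.
rewrite -val_eqE /= i00 => q0; have -> : (q + size v).-1 = (q.-1 + size v)%N by lia.
by rewrite modnDr modn_small //; have := ltn_ord q; lia.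
Qed.

Let pred0 : ord_pred i0 = (size v).-1 :> nat.
Proof. by rewrite /= i00 add0n modn_small //; have := ltn_ord i0; lia. Qed.

Let transport_rec q : q != i0 ->
  transport q = transport (ord_pred q) *m (if q == turn_at then turn else 1%:M).
Proof.
move=> q0; rewrite /transport predE //.
have [e|ne] := eqVneq q turn_at.
  rewrite -e q0 leqnn /= (_ : (q <= q.-1)%N = false) ?mul1mx //.
  by move: q0; rewrite -val_eqE /= i00; lia.
have -> : (turn_at <= q.-1)%N = (turn_at <= q)%N.
  by move: q0 ne; rewrite -!val_eqE /= i00; lia.
by rewrite mulmx1.
Qed.

Let step_rec (q : 'I_(size v)) (x y : 'M[k]_(r, s)) : q != i0 ->
  (if dir q then bJ r lam q *m x = y *m bJ s mu (rho q)
   else bJ r lam q *m y = x *m bJ s mu (rho q))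
  <-> y = x *m (if q == turn_at then turn else 1%:M).
Proof.
move=> q0; rewrite {1 3}/bJ (_ : (q == 0%N :> nat) = false); last first.
  by apply: negbTE; move: q0; rewrite -val_eqE /= i00.
rewrite !mul1mx KE; case: (eqVneq q turn_at) => [->|_]; last first.
  by rewrite !mulmx1; case: direct; split=> ->.
rewrite /turn; case: direct => //; split=> ->; by rewrite ?mulmxK ?mulmxKV.
Qed.

Lemma csol_transport u : csolv r s lam mu u -> forall q, u q = u i0 *m transport q.
Proof.
move=> /csolE h; suff H n (q : 'I_(size v)) : q = n :> nat -> u q = u i0 *m transport q.
  by move=> q; exact: (H q).
elim: n q => [|n IH] q qn.
  have -> : q = i0 by apply/val_inj; rewrite /= qn i00.
  rewrite /transport (_ : _ && _ = false) ?mulmx1 //; apply/negP => /andP[+].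
  by rewrite -val_eqE /= i00; lia.
have q0 : q != i0 by rewrite -val_eqE /= i00 qn.
have /(step_rec _ _ q0) -> := h q.
rewrite (transport_rec q0) mulmxA; congr (_ *m _); apply: IH.
by rewrite predE // qn.
Qed.

(** The equation at [i0] is the one not yet used by the transport. The directions at [i0] and
    [turn_at] decide whether the block of [mu] ends up inverted. *)
Let close (M : 'M[k]_(r, s)) :
  (if dir i0 then bJ r lam i0 *m (M *m transport (ord_pred i0)) = M *m bJ s mu (rho i0)
   else bJ r lam i0 *m M = M *m transport (ord_pred i0) *m bJ s mu (rho i0))
  <-> itw (jord r lam) (jordX s mu turn_sense) M.
Proof.
rewrite {1 3}/bJ i00 eqxx KE eq_sym /transport pred0 /itw /turn_sense.
have -> : (turn_at <= (size v).-1)%N by have := ltn_ord turn_at; lia.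
case: eqVneq => _ /=; first by rewrite !mulmx1; case: direct.
rewrite !mulmx1 /turn mulmxA /jordX.
case: (dir i0); case: (dir turn_at) => //=; split.
- by move=> e; rewrite -{2}e mulmxKV.
- by move=> ->; rewrite mulmxK.
- by move=> e; rewrite -{2}e mulmxK.
- by move=> ->; rewrite mulmxKV.
Qed.

Definition spread (M : 'M[k]_(r, s)) : {ffun 'I_(size v) -> 'M[k]_(r, s)} :=
  [ffun q => M *m transport q].

Lemma csol_itw u : csolv r s lam mu u -> itw (jord r lam) (jordX s mu turn_sense) (u i0).
Proof.
move=> su; have h := csol_transport su; apply/close; move/csolE: su => /(_ i0).
by rewrite h.
Qed.

Lemma transport0 : transport i0 = 1%:M.
Proof.
rewrite /transport (_ : _ && _ = false) //; apply/negP => /andP[+].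
by rewrite -val_eqE /= i00; lia.
Qed.

Lemma itw_csol M : itw (jord r lam) (jordX s mu turn_sense) M -> csolv r s lam mu (spread M).
Proof.
move/close => h; apply/csolE => q; rewrite !ffunE.
have [->|q0] := eqVneq q i0; first by rewrite transport0 mulmx1.
by apply/(step_rec _ _ q0); rewrite transport_rec ?mulmxA.
Qed.

Lemma csol_inj u : csolv r s lam mu u -> u i0 = 0 -> u = 0.
Proof.
move=> su u0; apply/ffunP => q; rewrite (csol_transport su) u0 mul0mx.
by rewrite ffunE.
Qed.

Lemma dim_csol : \dim (vspan (csolv r s lam mu))
  = \dim (vspan (itw (jord r lam) (jordX s mu turn_sense))).
Proof.
apply/esym; apply: (@dim_iso _ _ _ (fun u : {ffun 'I_(size v) -> 'M[k]_(r, s)} => u i0)).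
- by move=> c f g; rewrite !ffunE.
- exact: csol_sub.
- exact: itw_sub.
- exact: csol_itw.
- by move=> M h; exists (spread M); [exact: itw_csol|rewrite ffunE transport0 mulmx1].
- exact: csol_inj.
Qed.

End Monodromy.

(** * Isomorphisms of band complexes *)

Section Words.
Variables (k : fieldType) (A : falgType k) (G : quiver_in A).
Hypothesis hG : gentle_algebra G.

Let B := (\dim {:A}).

(* The walk read from a flag, as a number in base [2 B]: chain maps can only
   decrease it (lexicographically). *)
Definition fval (w : seq (letter G)) (q : 'I_(size w)) (o : bool) : nat :=
  let l := size (lpath (nth_letter q)).2 in
  if direct (nth_letter q) == o then (2 * B - l)%N else l.
Fixpoint fnum (w : seq (letter G)) (n : nat) (q : 'I_(size w)) (o : bool) : nat :=
  if n is n'.+1 then (fval q o * (2 * B) ^ n' + fnum n' (bnx o q) o)%N else 0%N.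
(** The sum of both readings is used because a component between identities may exchange the two
    sides of the vertex. *)
Definition word (w : seq (letter G)) (n : nat) (a : 'I_(size w)) : nat :=
  (fnum n a true + fnum n (ordS a) false)%N.

Lemma letter_size (w : seq (letter G)) (q : 'I_(size w)) : is_band w ->
  (0 < size (lpath (nth_letter q)).2 < B)%N.
Proof.
move=> hw; have nt : nontrivial_letter (nth_letter q) by apply: nt_nth_letter; case: hw => /andP[].
rewrite (npath_size hG (nt_npath nt)) andbT.
by have := nt_nnil nt; case: (lpath _).2.
Qed.

Lemma fnum_lt (w : seq (letter G)) n (q : 'I_(size w)) o : is_band w -> (fnum n q o < (2 * B) ^ n)%N.
Proof.
move=> hw; elim: n q => [|n IH] q //=.
have vl : (fval q o < 2 * B)%N.
  by rewrite /fval; have := letter_size q hw; case: ifP; lia.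
rewrite expnS; apply: leq_trans (_ : ((fval q o).+1 * (2 * B) ^ n <= _)%N).
  by rewrite mulSn addnC ltn_add2r IH.
by rewrite leq_mul2r vl orbT.
Qed.

Lemma fvalE (w : seq (letter G)) (q : sQ (bandX w)) o :
  fval q o = if sdir q == o then (2 * B - size (spi q).2)%N else size (spi q).2.
Proof. by []. Qed.

Variables (v w : seq (letter G)).
Hypotheses (hv : is_band v) (hw : is_band w).
Local Notation X := (bandX v).
Local Notation Y := (bandX w).
Let hX : is_sdata X := bandX_sdata hG hv.
Let hY : is_sdata Y := bandX_sdata hG hw.
Variables (c : sQ X -> k) (d : sQ Y -> k).
Hypotheses (c0 : forall q, c q != 0) (d0 : forall q, d q != 0).
Local Notation C := (rep (fun q => (c q)%:M : 'M[k]_1)).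
Local Notation D := (rep (fun q => (d q)%:M : 'M[k]_1)).
Variable f : mor C D.
Hypothesis chf : chain_map f.

Definition triv0 (a : sN X) (b : sN Y) : 'M[k]_1 := cmx f a b (svt b, [::]).

Let hf a b p : cmx f a b p != 0 -> [/\ ptgt p = svt a, psrc p = svt b & sdg b = sdg a + 0].
Proof. by case: chf => /(homog_cmx hG) h _; exact: h. Qed.

Lemma triv0_vert a b : triv0 a b != 0 -> svt a = svt b.
Proof. by case/hf. Qed.

Let cval2 (q : sQ X) (x : bool) (r : sQ Y) (y : bool) :
  [/\ spi q = spi r & (sdir q == x) = (sdir r == y)] -> fval q x = fval r y.
Proof. by rewrite /fval /= => -[-> ->]. Qed.

(** A letter read from [sfrom] has a value above [B], one read from [sto] a value below. If both are
    read from [sfrom], commuting with the differentials gives [spi r = pcat (spi q) p]; if both from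
    [sto], it gives [spi q = pcat p (spi r)]. Either [p] is trivial and an identity component
    appears at the other ends, or the value drops. *)
Lemma order_step (q : sQ X) (x : bool) (r : sQ Y) (y : bool) :
    same (send q x) (send r y) -> triv0 (sst q x) (sst r y) != 0 ->
  (fval r y < fval q x)%N \/
  [/\ spi q = spi r, (sdir q == x) = (sdir r == y)
    & triv0 (sst q (~~ x)) (sst r (~~ y)) != 0].
Proof.
move=> s nz; have ev := triv0_vert nz; case: chf => _ ef.
have [lq lr] := (letter_size q hv, letter_size r hw).
case: (eqVneq (sdir q) x) => [ex|ex].
  case: (eqVneq (sdir r) y) => [ey|ey]; last first.
    by left; rewrite !fvalE ex eqxx (negPf ey) /=; lia.
  subst x y; rewrite -/(sfrom q) -/(sfrom r) in nz ev.
  rewrite -/(sto q) -/(sto r).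
  have := cmxR_letter hG hY f r (sfrom q); rewrite ef mul_mx_scalar => e.
  have nz' : cmx (mcomp (diff C) f) (sfrom q) (sto r) (spi r) != 0.
    by rewrite e scaler_eq0 negb_or d0.
  move: nz'; rewrite (cmxL hG hX) => nz'.
  have /existsP[q'] : [exists q', (if sfrom q == sfrom q' then (c q')%:M *m
      (if ldiv (spi q') (spi r) is Some p then cmx f (sto q') (sto r) p else 0) else 0) != 0].
    apply: contraNT nz' => /existsPn h; rewrite big1 // => q' _; exact/eqP/negPn.
  case: (eqVneq (sfrom q) (sfrom q')) => [eq|_]; last by rewrite eqxx.
  case h: (ldiv _ _) => [p|]; last by rewrite mulmx0 eqxx.
  rewrite mul_scalar_mx scaler_eq0 negb_or => /andP[_ nzp].
  have [e1 e2 _] := ldiv_Some h.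
  have eo : oend (spi r) = oend (spi q') by rewrite e2 oend_pcat ?spi_nnil.
  have qq : q' = q.
    rewrite !send_from eo in s; apply: (oend_eq_letter hX (esym eq)).
    by move: s; rewrite /oend => /same_eq ->.
  subst q'; case: (eqVneq p.2 [::]) => p0.
    right; rewrite ?eqxx; have er : spi r = spi q by rewrite e2 pcat_nil.
    split=> //; rewrite /triv0; have [_ sp _] := hf nzp.
    by rewrite (_ : (svt (sto r), [::]) = p) //; case: p p0 sp {h e1 e2 nzp} => a t /= -> <-.
  left; rewrite !fvalE !eqxx; have := congr1 (fun p => size p.2) e2.
  by rewrite /= size_cat /=; case: p.2 p0 => //= a t _; lia.
have {}ex : x = ~~ sdir q by move: ex; case: (x); case: sdir.
subst x; rewrite -/(sto q) in nz ev.
have := cmxL_letter hG hX f q (sst r y).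
rewrite ev -ef mul_scalar_mx => e.
have nz' : cmx (mcomp f (diff D)) (sfrom q) (sst r y) (spi q) != 0.
  by rewrite e scaler_eq0 negb_or c0.
move: nz'; rewrite (cmxR hG hY) => nz'.
have /existsP[r'] : [exists r', (if sst r y == sto r' then
    (if rdiv (spi r') (spi q) is Some p then cmx f (sfrom q) (sfrom r') p else 0)
     *m (d r')%:M else 0) != 0].
  apply: contraNT nz' => /existsPn h; rewrite big1 // => q' _; exact/eqP/negPn.
case: (eqVneq (sst r y) (sto r')) => [er|_]; last by rewrite eqxx.
case h: (rdiv _ _) => [p|]; last by rewrite mul0mx eqxx.
rewrite mul_mx_scalar scaler_eq0 negb_or => /andP[_ nzp].
have [e1 e2 _] := rdiv_Some h.
have eo : iend (spi q) = iend (spi r') by rewrite e2 iend_pcat ?spi_nnil.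
have [rr yy] : r = r' /\ y = ~~ sdir r'.
  by apply: (same_flag hY er); rewrite send_to -eo -send_to same_sym.
subst r' y; rewrite -/(sto r) in er nz ev *; rewrite /triv0 !negbK -/(sfrom q) -/(sfrom r).
case: (eqVneq p.2 [::]) => p0.
  right; have e3 : spi q = spi r by rewrite e2 nil_pcat.
  split; rewrite ?e3 //; first by case: (sdir q); case: (sdir r).
  have [_ sp _] := hf nzp.
  by rewrite (_ : (svt (sfrom r), [::]) = p) //; case: p p0 sp {h e1 e2 nzp} => a t /= -> <-.
have nn b : (b == ~~ b) = false by case: b.
left; rewrite !fvalE !nn; have := congr1 (fun p => size p.2) e2.
by rewrite /= size_cat /=; case: p.2 p0 => //= a t _; lia.
Qed.

Lemma flag_neq (S : sdata G) (q q' : sQ S) o o' : is_sdata S -> sst q o = sst q' o' ->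
  o != o' -> ~~ same (send q o) (send q' o').
Proof. by case=> _ _ _ h e /eqP ne; apply: h => // -[_]. Qed.

Lemma order_next (q : sQ X) (x : bool) (r : sQ Y) (y : bool) :
    spi q = spi r -> (sdir q == x) = (sdir r == y) ->
    svt (sst q (~~ x)) = svt (sst r (~~ y)) ->
  same (send (bnx x q : sQ X) x) (send (bnx y r : sQ Y) y).
Proof.
move=> e1 e2 ev.
have ee : send q (~~ x) = send r (~~ y).
  rewrite /send e1; move: e2; case: (sdir q); case: (sdir r); case: x {ev}; by case: y.
have a1 := send_at hX q (~~ x); have a2 := send_at hX (bnx x q : sQ X) x.
have b1 := send_at hY r (~~ y); have b2 := send_at hY (bnx y r : sQ Y) y.
rewrite sst_bnx in a2; rewrite sst_bnx in b2; rewrite -ev in b1 b2.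
apply: (same_other hG a1 a2 b1 b2).
- by rewrite ee; exact: same_refl b1.
- by apply: flag_neq; rewrite ?sst_bnx //; case: (x).
- by apply: flag_neq; rewrite ?sst_bnx //; case: (y).
Qed.

Lemma order n (q : sQ X) (x : bool) (r : sQ Y) (y : bool) :
    same (send q x) (send r y) -> triv0 (sst q x) (sst r y) != 0 ->
  (fnum n r y < fnum n q x)%N \/
  (fnum n r y = fnum n q x /\ forall i, (i < n)%N ->
     spi (iter i (bnx x) q : sQ X) = spi (iter i (bnx y) r : sQ Y) /\
     (sdir (iter i (bnx x) q : sQ X) == x) = (sdir (iter i (bnx y) r : sQ Y) == y)).
Proof.
elim: n q r => [|n IH] q r s nz; first by right.
case: (order_step s nz) => [lt|[e1 e2 nz']] /=.
  left; have := fnum_lt n (bnx y r) y hw; have := fnum_lt n (bnx x q) x hv => _ h2.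
  apply: (@leq_trans ((fval r y).+1 * (2 * B) ^ n)).
    by rewrite mulSn addnC ltn_add2r.
  by apply: leq_trans (leq_addr _ _); rewrite leq_mul2r lt orbT.
have e : fval q x = fval r y by apply: cval2.
have s' := order_next e1 e2 (triv0_vert nz').
case: (IH (bnx x q) (bnx y r) s') => [|lt|[e3 e4]].
- by rewrite !sst_bnx.
- by left; rewrite e ltn_add2l.
right; split; first by rewrite e e3.
by case=> [|i] lt //=; rewrite -!iterS !iterSr; exact: e4.
Qed.

(** Exceeds by 2 the length of every walk that ends, because [perp_witer] is applied after [n.-1]
    steps and needs a strict inequality. *)
Definition wbound : nat := (\max_(e : sQ X * sQ Y) wlen (@matched _ _ _ X Y) (mpt true) (mpt false) e).+2.

Lemma matched_perp n (q : sQ X) (r : sQ Y) (y : bool) : (wbound <= n)%N ->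
   (forall i, (i < n)%N ->
     spi (iter i (bnx true) q : sQ X) = spi (iter i (bnx y) r : sQ Y) /\
     (sdir (iter i (bnx true) q : sQ X) == true) = (sdir (iter i (bnx y) r : sQ Y) == y)) ->
  tcyc (sst q true : sN X) (sst r y : sN Y).
Proof.
move=> ln h; pose e i : sQ X * sQ Y := (iter i (bnx true) q, iter i (bnx y) r).
have m i : (i < n)%N -> matched (e i) by move/h => [/eqP].
have se i : (i < n)%N -> sense (e i) = y.
  by move/h => [_]; rewrite /sense /=; case: direct; case: direct; case: (y).
have st i : (i.+1 < n)%N -> wstep (@matched _ _ _ X Y) (mpt true) (mpt false) (e i) = Some (e i.+1).
  move=> lt; have em : mpt true (e i.+1) = mpt false (e i).
    rewrite /mpt !se ?(ltnW lt) //; congr pair.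
    have E : sst (bnx y (iter i (bnx y) r) : sQ Y) y = sst (iter i (bnx y) r : sQ Y) (~~ y).
      exact: sst_bnx.
    have -> : (true == y) = y by case: (y).
    have -> : (false == y) = ~~ y by case: (y).
    exact: E.
  rewrite /wstep; case: pickP => [e' /andP[m' /eqP e2]|/(_ (e i.+1))].
    congr Some; apply: (mpt_inj hX hY (x := true)) => //; first by apply: m.
    by rewrite e2 em.
  by rewrite m // em eqxx.
have wi i : (i < n)%N -> witer (@matched _ _ _ X Y) (mpt true) (mpt false) i (e 0%N) = Some (e i).
  elim: i => // i IH lt; rewrite /witer /= -/(witer _ _ _ i _) IH ?(ltnW lt) //.
  exact: st.
have n0 : (0 < n)%N by apply: leq_trans ln.
have pe : cperp (e 0%N).
  apply: (@perp_witer _ _ _ _ _ _ n.-1); first exact: m.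
    rewrite -ltnS prednK //; apply: leq_trans ln; rewrite /wbound !ltnS.
    exact: (leq_bigmax (F := wlen (@matched _ _ _ X Y) (mpt true) (mpt false))).
  by rewrite wi // prednK.
by have := tcyc_mpt true pe; rewrite /mpt se // eq_sym eqb_id.
Qed.

(** There are two classes of ends at the common vertex, so the readings from [b] pair off with those
    from [a], and [order] compares both pairs. Equality over [wbound] steps in the first pair would
    put [(a, b)] on a perpetual walk. *)
Lemma word_order n a b : triv0 a b != 0 -> (word n b <= word n a)%N /\
  ((wbound <= n)%N -> ~~ tcyc a b -> (word n b < word n a)%N).
Proof.
move=> nz; have ev := triv0_vert nz.
have sa : sst (ordS a : sQ X) false = a by rewrite /sst /= ordSK.
have sb : sst (ordS b : sQ Y) false = b by rewrite /sst /= ordSK.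
have a1 := send_at hX (a : sQ X) true; have a2 := send_at hX (ordS a : sQ X) false.
have b1 := send_at hY (b : sQ Y) true; have b2 := send_at hY (ordS b : sQ Y) false.
rewrite sa in a2; rewrite sb -ev in b2; rewrite -[sst (b : sQ Y) true]/b -ev in b1.
rewrite -[sst (a : sQ X) true]/a in a1.
have na : ~~ same (send (a : sQ X) true) (send (ordS a : sQ X) false) by apply: flag_neq.
have nb : ~~ same (send (b : sQ Y) true) (send (ordS b : sQ Y) false) by apply: flag_neq.
rewrite /word; case/or3P: (same3 hG b1 a1 b2) => s; last by rewrite s in nb.
  have s' := same_other hG a1 a2 b1 b2 (etrans (same_sym _ _) s) na nb.
  rewrite same_sym in s.
  have o1 := order n s nz; have o2 := order n s'; rewrite sa sb in o2; have {}o2 := o2 nz.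
  split.
    by apply: leq_add; [case: o1 => [/ltnW|[->]]|case: o2 => [/ltnW|[->]]].
  move=> ln nc; case: o1 => [lt|[_ h]]; last by case/negP: nc; exact: (matched_perp ln h).
  by rewrite -addSn; apply: leq_add => //; case: o2 => [/ltnW|[->]].
have nb' : ~~ same (send (ordS b : sQ Y) false) (send (b : sQ Y) true) by rewrite same_sym.
have s' := same_other hG a1 a2 b2 b1 s na nb'.
have o1 := order n s; rewrite sb in o1; have {}o1 := o1 nz.
have o2 := order n s'; rewrite sa in o2; have {}o2 := o2 nz.
rewrite addnC; split.
  by apply: leq_add; [case: o1 => [/ltnW|[->]]|case: o2 => [/ltnW|[->]]].
move=> ln nc; case: o1 => [lt|[_ h]]; last first.
  by case/negP: nc; rewrite -sb; exact: (matched_perp ln h).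
by rewrite -addSn; apply: leq_add => //; case: o2 => [/ltnW|[->]].
Qed.

End Words.

(** * Criteria for isomorphisms *)

Section Units.
Variables (k : fieldType) (A : falgType k) (G : quiver_in A).
Hypothesis hG : gentle_algebra G.

Lemma inverse_chain (C D : complex G) (f : mor C D) (g : mor D C) :
    is_complex C -> is_complex D ->
    chain_map f -> homogeneous 0 g -> mcomp f g = mid C -> mcomp g f = mid D ->
  chain_map g.
Proof.
move=> [hC _] [hD _] [hf ef] hg fg gf; split=> //.
have e1 : homogeneous 1 (mcomp g (diff C)).
  by have := homogeneous_mcomp hG hg hC; rewrite add0r.
have e2 : homogeneous 1 (mcomp (diff D) g).
  by have := homogeneous_mcomp hG hD hg; rewrite addr0.
rewrite -[LHS](mcomp1r hG e1) -fg mcompA -(mcompA (diff C)) -ef -!mcompA gf.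
by rewrite !mcompA (mcomp1l hG e2).
Qed.

Lemma homotopic_refl (C D : complex G) (f : mor C D) : homotopic f f.
Proof. by rewrite /homotopic subrr; case: (null_sub hG C D). Qed.

Section Letters.
Variables (X Y : sdata G) (c : sQ X -> k) (d : sQ Y -> k).
Hypotheses (hX : is_sdata X) (hY : is_sdata Y).
Local Notation C := (rep (fun q => (c q)%:M : 'M[k]_1)).
Local Notation D := (rep (fun q => (d q)%:M : 'M[k]_1)).

(** Homotopies do not affect identity components, so [f] followed by its inverse has coefficient 1
    at the identity of [a]; a trivial path factors only into trivial paths. *)
Lemma iso_triv (f : mor C D) (a : sN X) : isoD_map f ->
  exists (b : sN Y) (g : mor D C), [/\ chain_map g, cmx f a b (svt b, [::]) != 0
                                     & cmx g b a (svt a, [::]) != 0].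
Proof.
move=> [[hf _] [g [cg fg _]]].
have := null_triv hG hX hX a a (svt a) fg; rewrite -[_ - _]addrC -scaleN1r cmx_lin //.
move=> /matrixP/(_ ord0 ord0); rewrite !mxE /mid !ffunE /= eqxx pcoef_idem // eqxx mulr1.
move/eqP; rewrite addrC subr_eq0 pcoef_sum => /eqP e.
have /existsP[[j b]] : [exists b, pcoef (svt a, [::])
    (f ((ord0, a), b) * g (b, (ord0, a))) != 0].
  apply: contraT => /existsPn h; move/eqP: e; rewrite big1 => [|b _].
    by rewrite eq_sym (negPf (oner_neq0 _)).
  exact/eqP/negPn.
case/(pcoef_mul_neq0 hG) => p1 [p2 [e1 e2 _ n1 n2]].
have [t1 t2] : p1.2 = [::] /\ p2.2 = [::].
  by move: e2; rewrite /pcat => -[_]; case: p1.2 => //; case: p2.2.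
have N (S T : sdata G) (J : sQ S -> 'M[k]_1) (K : sQ T -> 'M[k]_1)
     (h : mor (rep J) (rep K)) i x y z (p : qpath G) :
   homogeneous 0 h -> pcoef p (h ((i, x), (z, y))) != 0 -> p.2 = [::] ->
   cmx h x y (svt y, [::]) != 0.
  move=> /(homogeneousE hG) hh nz p0; have [_ /= sp _] := hh _ _ _ nz.
  apply: contraNneq nz => /matrixP/(_ i z); rewrite !mxE => <-.
  by case: p p0 sp => x' s' /= -> <-.
exists b, g; split=> //; first exact: (N _ _ _ _ f _ _ _ _ _ hf n1 t1).
case: cg => hg _; exact: (N _ _ _ _ g _ _ _ _ _ hg n2 t2).
Qed.

End Letters.

Variables (v w : seq (letter G)).
Hypotheses (hv : is_band v) (hw : is_band w).
Local Notation X := (bandX v).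
Local Notation Y := (bandX w).
Let hX : is_sdata X := bandX_sdata hG hv.
Let hY : is_sdata Y := bandX_sdata hG hw.
Variables (c : sQ X -> k) (d : sQ Y -> k).
Hypotheses (c0 : forall q, c q != 0) (d0 : forall q, d q != 0).
Local Notation C := (rep (fun q => (c q)%:M : 'M[k]_1)).
Local Notation D := (rep (fun q => (d q)%:M : 'M[k]_1)).

(** The component of [f] would lower the word strictly, and that of the inverse could not raise it
    again. *)
Lemma not_iso (f : mor C D) (a : sN X) :
  (forall a b, cmx f a b (svt b, [::]) != 0 -> ~~ tcyc a b) -> ~ isoD_map f.
Proof.
move=> h iso; have [cf _] := iso.
have [b [g [cg n1 n2]]] := iso_triv hX a iso.
have [_ lt] := word_order hG hv hw c0 d0 cf (wbound v w) n1.
have [le _] := word_order hG hw hv d0 c0 cg (wbound v w) n2.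
by have := leq_trans (lt (leqnn _) (h _ _ n1)) le; rewrite ltnn.
Qed.

Variables (o : bool) (rho : sQ X -> sQ Y).
Hypothesis rho_bij : bijective rho.
Hypothesis rho_perp : forall (q : sQ X) (r : sQ Y), cperp (q, r) = (r == rho q).
Hypothesis rho_sense : forall q : sQ X, sense (q, rho q) = o.
Hypothesis rho_pred : forall q : 'I_(size v), rho (ord_pred q) = bnx o (rho q).

Let bb := cvtx o rho.

Let bb_bij : bijective bb.
Proof.
have [g gK Kg] := rho_bij.
pose s x := if o then x else ordS x : 'I_(size w).
have sK : cancel s (fun x => sst (x : sQ Y) o).
  by move=> x; rewrite /s /sst /=; case: (o) => //; exact: ordSK.
have Ks : cancel (fun x => sst (x : sQ Y) o) s.
  by move=> x; rewrite /s /sst /=; case: (o) => //; exact: ord_predK.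
exists (g \o s) => x; rewrite /bb /cvtx /=; first by rewrite Ks gK.
by rewrite Kg sK.
Qed.

Section Inverse.
Variable u : {ffun 'I_(size v) -> 'M[k]_1}.
Hypothesis u0 : forall a, u a ord0 ord0 != 0.

Let phi : mor C D := cmk o rho _ _ u.
Definition cinv : mor D C :=
  [ffun yx => if yx.1.2 == bb yx.2.2
              then (u yx.2.2 ord0 ord0)^-1 *: idem (svt yx.2.2) else 0].

Let sv a : svt (bb a) = svt a := svt_cvtx hG hv hw rho_perp rho_sense rho_pred a.

Let phiE x y : phi (x, y) = if y.2 == bb x.2 then u x.2 ord0 ord0 *: idem (svt x.2) else 0.
Proof.
case: x y => i a [j b]; apply: (pcoef_ext hG) => p np /=.
have := cmx_cmk hG o rho (fun q => (c q)%:M) (fun q => (d q)%:M) u a b p.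
move/matrixP => /(_ i j); rewrite mxE -/phi => ->; rewrite -/bb !ord1.
case: (eqVneq b (bb a)) => [->|_] /=; last by rewrite pcoef0 mxE.
rewrite pcoefZ pcoef_idem //; have := sv a => /= ->.
by case: eqP; rewrite ?mulr1 ?mulr0 // mxE.
Qed.

Lemma cmk_cinv : mcomp phi cinv = mid C.
Proof.
apply/ffunP => -[[i a] [i' a']]; rewrite ffunE /= ffunE /=.
rewrite (bigD1 (ord0, bb a)) //= big1 ?addr0 => [|[j b] /= ne]; last first.
  rewrite phiE /=; case: eqP => [e|]; last by rewrite mul0r.
  by case/eqP: ne; rewrite e ord1.
rewrite phiE ffunE /= eqxx (bij_eq bb_bij) !ord1 xpair_eqE eqxx /=.
case: eqP => [<-|_]; last by rewrite mulr0.
rewrite -scalerAl -scalerAr scalerA mulfV ?u0 // scale1r.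
by case: hG => _ [-> _ _ _] _; rewrite eqxx.
Qed.

Lemma cinv_cmk : mcomp cinv phi = mid D.
Proof.
have [g gK Kg] := bb_bij.
apply/ffunP => -[[i b] [i' b']]; rewrite ffunE /= [RHS]ffunE /=.
rewrite (bigD1 (ord0, g b)) //= big1 ?addr0 => [|[j a] /= ne]; last first.
  rewrite ffunE /=; case: eqP => [e|]; last by rewrite mul0r.
  by case/eqP: ne; rewrite e gK ord1.
rewrite phiE ffunE /= Kg eqxx !ord1 xpair_eqE eqxx /= (eq_sym b').
case: eqP => _; last by rewrite mulr0.
rewrite -scalerAl -scalerAr scalerA mulVf ?u0 // scale1r.
by case: hG => _ [-> _ _ _] _; rewrite eqxx; have := sv (g b); rewrite Kg /= => ->.
Qed.

Lemma cinv_hom a0 : homogeneous (- coff o rho a0) cinv.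
Proof.
apply/(homogeneousE hG) => -[i b] [j a] p; rewrite ffunE /=.
case: (eqVneq b (bb a)) => [->|_]; last by rewrite pcoef0 eqxx.
rewrite pcoefZ pcoef_idem //; case: (eqVneq p _) => [->|_] /=; last by rewrite mulr0 eqxx.
move=> _; split => //; first by have := sv a => /= ->.
by have := sdg_cvtx hG hv hw rho_sense rho_pred a a0; rewrite -/bb /= => ->; ring.
Qed.

End Inverse.

Hypothesis off0 : forall a, coff o rho a = 0.
Variable a0 : sN X.

Section Nonvanishing.
Variable f : mor C D.
Hypothesis chf : chain_map f.
Let u := cval o rho f.
Hypothesis u0 : forall a, u a ord0 ord0 != 0.

Let phi : mor C D := cmk o rho _ _ u.
Let psi : mor D C := cinv u.

Let phi_chain : chain_map phi.
Proof.
apply: (csol_chain hG hv hw rho_perp rho_sense rho_pred (off0 a0)).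
exact: (chain_csol hG hv hw rho_perp rho_sense rho_pred chf).
Qed.

Let psi_chain : chain_map psi.
Proof.
apply: (inverse_chain (rep_complex hG hX _) (rep_complex hG hY _) phi_chain).
- by have := cinv_hom u a0; rewrite off0 oppr0.
- exact: cmk_cinv.
- exact: cinv_cmk.
Qed.

Let n := wbound v w.

Let word_f a b : cmx f a b (svt b, [::]) != 0 -> (word n b < word n a)%N \/ b = bb a.
Proof.
move=> nz; have [_ h] := word_order hG hv hw c0 d0 chf n nz.
case: (boolP (tcyc a b)) => [|nc]; last by left; exact: h.
by rewrite (tcycE rho_perp rho_sense) => /eqP; right.
Qed.

(** [psi] is a chain map in the opposite direction with a nonzero identity component from [bb a] to
    [a]. *)
Let word_bb a : (word n a <= word n (bb a))%N.
Proof.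
suff nz : triv0 psi (bb a) a != 0 by have [] := word_order hG hw hv d0 c0 psi_chain n nz.
apply/eqP => /matrixP/(_ ord0 ord0); rewrite !mxE ffunE /= eqxx.
rewrite pcoefZ pcoef_idem // eqxx mulr1 => /eqP; rewrite invr_eq0.
exact/negP.
Qed.

Let M := (\sum_(a : sN X) @word _ _ _ v n a).+1.
(** A lexicographic order: shorter paths first, then vertices with larger words. [M] exceeds every
    word. *)
Let key (a : sN X) (p : qpath G) : nat := (size p.2 * M + (M - @word _ _ _ v n a))%N.

Let wM a : (@word _ _ _ v n a < M)%N.
Proof. by rewrite /M ltnS (bigD1 a) //= leq_addr. Qed.

Let key_size a a' (p p1 p2 : qpath G) : p2.2 != [::] -> p = pcat p1 p2 ->
  (key a' p1 < key a p)%N.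
Proof.
move=> p20 ->; rewrite /key /= size_cat.
have l2 : (0 < size p2.2)%N by case: p2.2 p20.
have h := wM a; apply: (@leq_ltn_trans (size p1.2 * M + M)); first by rewrite leq_add2l leq_subr.
rewrite mulnDl -addnA ltn_add2l; apply: (@leq_ltn_trans (size p2.2 * M)).
  by rewrite leq_pmull.
by rewrite -[X in (X < _)%N]addn0 ltn_add2l subn_gt0.
Qed.

(** [f] is triangular for [key]: the coefficient at [bb a] of [g] followed by [f] is a nonzero
    multiple of that of [g] at [a], plus coefficients of [g] with smaller key. *)
Let inj (g : mor C C) : homogeneous 0 g -> mcomp g f = 0 -> g = 0.
Proof.
move=> hg gf.
suff H m : forall (i j : 'I_1) (c1 a : sN X) p, (key a p < m)%N -> pcoef p (g ((i, c1), (j, a))) = 0.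
  apply/ffunP => -[[i c1] [j a]]; rewrite ffunE; apply: (pcoef_ext0 hG) => p.
  exact: (H (key a p).+1).
elim: m => // m IH i j c1 a p lt; apply/eqP/negPn/negP => nz.
have := congr1 (fun h : mor C D => pcoef p (h ((i, c1), (j, bb a)))) gf.
rewrite !ffunE pcoef0 pcoef_sum (bigD1 (j, a)) //= big1 ?addr0; last first.
  move=> [j' a'] ne; apply/eqP/negPn/negP.
  case/(pcoef_mul_neq0 hG) => p1 [p2 [e1 e2 _ n1 n2]].
  case: (eqVneq p2.2 [::]) => p20; last first.
    by move: n1; rewrite IH ?eqxx // (leq_trans (key_size a a' p20 e2)).
  have pe : p = p1 by rewrite e2 pcat_nil.
  have [hf _] := chf; have /(homogeneousE hG) hf' := hf.
  have [_ /= sp _] := hf' _ _ _ n2.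
  have nz2 : cmx f a' (bb a) (svt (bb a), [::]) != 0.
    apply: contraNneq n2 => /matrixP/(_ j' j); rewrite !mxE /= => <-.
    by case: (p2) p20 sp => x' s' /= -> <-.
  case: (word_f nz2) => [lw|/(bij_inj bb_bij) e]; last first.
    by case/eqP: ne; rewrite e !ord1.
  move: n1; rewrite -pe IH ?eqxx //; apply: leq_trans (_ : (key a p <= m)%N) => //.
  rewrite /key ltn_add2l; have := leq_ltn_trans (word_bb a) lw; have := wM a'; lia.
pose t := u a ord0 ord0; pose fa := f ((j, a), (j, bb a)); pose N := fa - t *: idem (svt (bb a)).
have gi : g ((i, c1), (j, a)) * idem (svt (bb a)) = g ((i, c1), (j, a)).
  have [/eqP e _] := hg (i, c1) (j, a); rewrite /bb (svt_cvtx hG hv hw rho_perp rho_sense rho_pred).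
  rewrite -e -!mulrA; case: hG => _ [-> _ _ _] _; by rewrite eqxx !mulrA.
have -> : f ((j, a), (j, bb a)) = t *: idem (svt (bb a)) + N by rewrite /N addrC subrK.
rewrite mulrDr -scalerAr gi pcoefD pcoefZ.
have -> : pcoef p (g ((i, c1), (j, a)) * N) = 0.
  apply/eqP/negPn/negP; case/(pcoef_mul_neq0 hG) => p1 [p2 [e1 e2 _ n1 n2]].
  case: (eqVneq p2.2 [::]) => p20; last first.
    by move: n1; rewrite IH ?eqxx // (leq_trans (key_size a a p20 e2)).
  move: n2; rewrite pcoefD pcoefN pcoefZ pcoef_idem //.
  case: (eqVneq p2 (svt (bb a), [::])) => [->|ne].
    by rewrite mulr1 /t /u ffunE mxE /fa !ord1 subrr eqxx.
  rewrite mulr0 subr0 => n2; have [hf _] := chf; have /(homogeneousE hG) hf' := hf.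
  have [_ /= sp _] := hf' _ _ _ n2.
  by case/eqP: ne; case: (p2) p20 sp => x' s' /= -> <-.
by rewrite addr0 => /eqP; rewrite mulf_eq0 (negPf nz) (negPf (u0 a)).
Qed.

(** Composition with [f'] is injective on the finite-dimensional space of degree 0 endomorphisms,
    hence onto. A preimage of the identity is an inverse on one side, and on the other by
    injectivity. *)
Lemma cval_iso : isoD_map f.
Proof.
pose f' := mcomp f psi; have [hf _] := chf; have [hpsi _] := psi_chain; have [hphi _] := phi_chain.
have hf' : homogeneous 0 f' := homogeneous_mcomp hG hf hpsi.
have gE (g : mor C C) : homogeneous 0 g -> mcomp g f' = 0 -> g = 0.
  move=> hg e; apply: inj => //.
  have hgf : homogeneous 0 (mcomp g f) := homogeneous_mcomp hG hg hf.
  rewrite -(mcomp1r hG hgf) -(cinv_cmk u0) -/psi -/phi -mcompA (mcompA g) -/f' e.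
  exact: mcomp0l.
have sH := homogeneous_sub hG C C 0.
pose U := vspan (@homogeneous _ _ _ C C 0).
pose R (g : mor C C) := mcomp g f'.
have Rlin : linear R by move=> t g h; rewrite /R mcompDl.
pose L : {linear mor C C -> mor C C} := HB.pack R (GRing.isLinear.Build k _ _ *:%R R Rlin).
have LE g : linfun L g = mcomp g f' by rewrite lfunE.
have img : (linfun L @: U)%VS = U.
  apply/eqP; rewrite eqEdim; apply/andP; split.
    apply/subvP => _ /memv_imgP[g /(vspanE sH) hg ->]; apply/(vspanE sH); rewrite LE.
    exact: (homogeneous_mcomp hG hg hf').
  rewrite limg_dim_eq //; apply/eqP; rewrite -subv0; apply/subvP => g.
  rewrite memv_cap memv_ker LE => /andP[/(vspanE sH) hg /eqP g0].
  by rewrite (gE g hg g0) mem0v.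
have : mid C \in (linfun L @: U)%VS by rewrite img; apply/(vspanE sH); exact: mid_hom.
case/memv_imgP => g /(vspanE sH) hg; rewrite LE => gf.
have fg : mcomp f' g = mid C.
  apply/eqP; rewrite -subr_eq0; apply/eqP; apply: gE.
    rewrite -scaleN1r addrC; apply: sH.2; first exact: mid_hom.
    exact: (homogeneous_mcomp hG hf' hg).
  rewrite -scaleN1r addrC mcompDl (mcomp1l hG hf') mcompA -gf (mcomp1r hG hf').
  by rewrite scaleN1r addNr.
have chf' : chain_map f'.
  split=> //; have [_ e1] := chf; have [_ e2] := psi_chain.
  by rewrite /f' mcompA e2 -!mcompA e1.
have chg := inverse_chain (rep_complex hG hX _) (rep_complex hG hX _) chf' hg fg (esym gf).
split=> //; exists (mcomp psi g); split.
- split; first exact: (homogeneous_mcomp hG hpsi hg).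
  have [_ e1] := chg; have [_ e2] := psi_chain.
  by rewrite mcompA e1 -!mcompA e2.
- by rewrite -mcompA fg; exact: homotopic_refl.
- have hpf : homogeneous 0 (mcomp (mcomp psi g) f).
    by apply: (homogeneous_mcomp hG (m := 0) (n := 0)) => //; exact: (homogeneous_mcomp hG hpsi hg).
  rewrite (_ : mcomp (mcomp psi g) f = mid D); first exact: homotopic_refl.
  have e : mcomp (mcomp (mcomp psi g) f) psi = psi.
    by rewrite mcompA -/f' mcompA -gf (mcomp1r hG hpsi).
  by rewrite -(mcomp1r hG hpf) -(cinv_cmk u0) -/psi -/phi -mcompA e.
Qed.

End Nonvanishing.
End Units.

(** * Assembly *)

Section Reindex.
Variables (k : fieldType) (A : falgType k) (G : quiver_in A).
Hypothesis hG : gentle_algebra G.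

Definition reindexing (C C' : complex G) (g : cidx C' -> cidx C) : Prop :=
  [/\ bijective g, forall x, cvert (g x) = cvert x, forall x, cdeg (g x) = cdeg x
    & forall x y, cdiff C (g x, g y) = cdiff C' (x, y)].

Lemma reindexing_id (C : complex G) : @reindexing C C id.
Proof. by split=> //; exists id. Qed.

Lemma reindexing_inv (C C' : complex G) (g : cidx C' -> cidx C) (g' : cidx C -> cidx C') :
  cancel g g' -> cancel g' g -> reindexing g -> reindexing g'.
Proof.
move=> gK Kg [_ gv gd gf]; split; first by exists g.
- by move=> x; rewrite -gv Kg.
- by move=> x; rewrite -gd Kg.
by move=> x y; rewrite -gf !Kg.
Qed.

Definition pull (C C' D D' : complex G) (g : cidx C' -> cidx C) (h : cidx D' -> cidx D)
  (f : mor C D) : mor C' D' := [ffun xy => f (g xy.1, h xy.2)].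

Section Pull.
Variables (C C' D D' : complex G) (g : cidx C' -> cidx C) (h : cidx D' -> cidx D).
Hypotheses (hg : reindexing g) (hh : reindexing h).
Local Notation pull := (pull g h).

Lemma pull_lin : linear pull.
Proof. by move=> c f f'; apply/ffunP => x; rewrite !ffunE. Qed.

Lemma pull_hom m f : homogeneous m f -> homogeneous m (pull f).
Proof.
case: hg hh => _ gv gd _ [_ hv hd _] hf x y; rewrite ffunE /=.
by have := hf (g x) (h y); rewrite gv gd hv hd.
Qed.

Lemma pullL f : pull (mcomp (diff C) f) = mcomp (diff C') (pull f).
Proof.
case: hg => gb _ _ gf; apply/ffunP => -[x y]; rewrite !ffunE /=.
rewrite (reindex g) /=; last exact: onW_bij.
by apply: eq_bigr => b _; rewrite ffunE /= /diff gf.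
Qed.

Lemma pullR f : pull (mcomp f (diff D)) = mcomp (pull f) (diff D').
Proof.
case: hh => hb _ _ hf; apply/ffunP => -[x y]; rewrite !ffunE /=.
rewrite (reindex h) /=; last exact: onW_bij.
by apply: eq_bigr => b _; rewrite ffunE /= /diff hf.
Qed.

Lemma pull_chain f : chain_map f -> chain_map (pull f).
Proof. by case=> hf ef; split; [exact: pull_hom|rewrite -pullL -pullR ef]. Qed.

Lemma pull_null f : null_homotopic f -> null_homotopic (pull f).
Proof.
case=> e [he ->]; exists (pull e); split; first exact: pull_hom.
by rewrite -pullL -pullR; have := pull_lin 1; rewrite /linear_for; move/(_ (mcomp (diff C) e)) => E; have := E (mcomp e (diff D)); rewrite !scale1r.
Qed.

End Pull.

Lemma homD_reindex (C C' D D' : complex G) (g : cidx C' -> cidx C) (h : cidx D' -> cidx D) :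
    is_complex C -> is_complex C' -> is_complex D -> is_complex D' ->
    reindexing g -> reindexing h -> homD C D = homD C' D'.
Proof.
move=> cC cC' cD cD' hg hh.
have [g' gK Kg] : bijective g by case: hg.
have [h' hK Kh] : bijective h by case: hh.
have hg' := reindexing_inv gK Kg hg; have hh' := reindexing_inv hK Kh hh.
have pK (f : mor C D) : pull g' h' (pull g h f) = f.
  by apply/ffunP => -[x y]; rewrite !ffunE /= Kg Kh.
have Kp (f : mor C' D') : pull g h (pull g' h' f) = f.
  by apply/ffunP => -[x y]; rewrite !ffunE /= gK hK.
have inj (f : mor C D) : pull g h f = 0 -> f = 0.
  by move=> e; rewrite -[f]pK e; apply/ffunP => x; rewrite !ffunE.
have e1 : \dim (vspan (@chain_map _ _ _ C' D')) = \dim (vspan (@chain_map _ _ _ C D)).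
  apply: (dim_iso (pull_lin g h)); try exact: chain_sub.
  - exact: pull_chain.
  - by move=> f cf; exists (pull g' h' f) => //; exact: pull_chain.
  - by move=> f _; exact: inj.
have e2 : \dim (vspan (@null_homotopic _ _ _ C' D')) = \dim (vspan (@null_homotopic _ _ _ C D)).
  apply: (dim_iso (pull_lin g h)); try exact: null_sub.
  - exact: pull_null.
  - by move=> f cf; exists (pull g' h' f) => //; exact: pull_null.
  - by move=> f _; exact: inj.
have := homDE hG cC cD; have := homDE hG cC' cD'; rewrite e1 e2 => <-.
exact: addIn.
Qed.

End Reindex.

(** * String and band complexes in the common form *)

Section StringBand.
Variables (k : fieldType) (A : falgType k) (G : quiver_in A).
Hypothesis hG : gentle_algebra G.

Lemma band_rep (w : seq (letter G)) (lam : k) (r : nat) :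
  band_complex w lam r = rep (X := bandX w) (bJ r lam (n := size w)).
Proof.
rewrite /band_complex /rep; congr Complex; apply/ffunP => -[[i a] [j b]].
rewrite !ffunE /=.
transitivity (\sum_(q < size w) bJ r lam q i j *: band_contrib q a b).
  case: eqP => [->|/eqP ne].
    by apply: eq_bigr => q _; rewrite /bJ; case: eqP => _; rewrite mxE ?eqxx.
  rewrite /band_super big_mkcond /=; case: eqP => [e|ne'].
    apply: eq_bigr => q _; rewrite /bJ; case: eqP => _; rewrite mxE.
      by rewrite (negPf ne) e eqxx scale1r.
    by rewrite eq_sym (negPf ne) scale0r.
  rewrite big1 // => q _; rewrite /bJ; case: eqP => _; rewrite mxE.
    by rewrite (negPf ne); case: eqP => //; rewrite scale0r.
  by rewrite eq_sym (negPf ne) scale0r.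
apply: eq_bigr => q _; rewrite /band_contrib /contrib /sfrom /sto /sst /=.
case: direct => /=; rewrite xpair_eqE; case: ifP => _ //; by rewrite scaler0.
Qed.

Definition stringX (u : hstring G) : sdata G :=
  let w := sletters u in
  @SData _ _ G 'I_(size w).+1 'I_(size w) (lift ord0) (widen_ord (leqnSn _))
    (fun q => direct (nth_letter q)) (fun q => lpath (nth_letter q))
    (fun r => if unlift ord0 r is Some q then ltgt (nth_letter q) else sbase u)
    (fun r => if unlift ord0 r is Some q then li (nth_letter q) else sdeg u).

Lemma stringX_sdata u : is_hstring u -> is_sdata (stringX u).
Proof.
case: u => x i w /andP[/= ll base].
have nt := fun q => nt_nth_letter q ll.
have lk (q q' : 'I_(size w)) : widen_ord (leqnSn _) q = lift ord0 q' ->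
    linked (nth_letter q) (nth_letter q').
  move=> /(congr1 val) /=; rewrite /bump /= add1n => qq'.
  have l0 := nth_letter q; rewrite !(nth_letterE l0) qq'.
  case/andP: ll => _ /(sortedP l0); apply.
  by rewrite -[X in (X < _)%N]qq'.
have base0 (q : 'I_(size w)) : q = 0%N :> nat ->
    x = lsrc (nth_letter q) /\ i = lj (nth_letter q).
  move=> q0; case: w q q0 base {ll nt lk} => [[//]|w1 w'] q q0.
  by rewrite (nth_letterE w1) q0 => /andP[/eqP -> /eqP ->].
set X := stringX _.
have vhi (q : sQ X) : svt (sst q true) = ltgt (nth_letter q) by rewrite /= liftK.
have dhi (q : sQ X) : sdg (sst q true) = li (nth_letter q) by rewrite /= liftK.
have vlo (q : sQ X) : svt (sst q false) = lsrc (nth_letter q).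
  rewrite /=; case: unliftP => [q' /lk /and3P[_ /eqP ->]//|/(congr1 val) /= q0].
  by case: (base0 q q0).
have dlo (q : sQ X) : sdg (sst q false) = lj (nth_letter q).
  rewrite /=; case: unliftP => [q' /lk /and3P[/eqP ->]//|/(congr1 val) /= q0].
  by case: (base0 q q0).
have lo_inj : injective (@slo _ _ _ X) by move=> q q' /(congr1 val) /= /val_inj.
have vst (q : sQ X) o : svt (sst q o) = if o then ltgt (nth_letter q) else lsrc (nth_letter q).
  by case: o.
have dst (q : sQ X) o : sdg (sst q o) = if o then li (nth_letter q) else lj (nth_letter q).
  by case: o.
split; [exact: lift_inj|exact: lo_inj|move=> q|].
  split; [exact: nt_npath|exact: nt_nnil|..].
  - by rewrite [LHS]lpath_src // /sto vst /=; case: direct.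
  - by rewrite [LHS]lpath_tgt // /sfrom vst /=; case: direct.
  - by have := nt_deg (nt q); rewrite /sto /sfrom !dst /=; case: direct.
have sE (q : sQ X) o : send q o = lend (nth_letter q) o by [].
move=> q q' o o'; rewrite !sE; case: o; case: o' => /= e ne.
- by case: ne; have /lift_inj -> := e.
- by apply: linked_ends => //; apply: lk.
- by rewrite same_sym; apply: linked_ends => //; apply: lk.
- by case: ne; have /lo_inj -> := e.
Qed.

(** The index type carries an extra factor ['I_1], so this is [string_complex u] only up to
    reindexing. *)
Definition string_rep (u : hstring G) : complex G :=
  rep (X := stringX u) (fun _ => 1%:M : 'M[k]_1).

Lemma string_rep_reindexing u :
  @reindexing _ _ _ (string_complex u) (string_rep u) snd.
Proof.
split=> [||| [i a] [j b]] //.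
  by exists (fun a => (ord0, a)) => [[i a]|//] /=; rewrite (ord1 i).
rewrite !ffunE /=; apply: eq_bigr => q _; rewrite !ord1 mxE eqxx scale1r.
by rewrite /contrib /sfrom /sto /sst /=; case: direct => /=; rewrite xpair_eqE.
Qed.

(* Following a matched pair moves the letter of a finite string monotonically,
   which must end. *)
Lemma no_perp_l u (Y : sdata G) : is_hstring u -> is_sdata Y ->
  forall e, ~~ @cperp _ _ _ (stringX u) Y e.
Proof.
move=> hu hY e; apply/negP => pe.
suff H n (f : sQ (stringX u) * sQ Y) : cperp f -> f.1 = n :> nat -> False by exact: (H _ _ pe).
elim: n f {e pe} => [|n IH] f pf fn;
  have [f' pf' [em _]] := cperp_step (stringX_sdata hu) hY pf;
  move: em => /(congr1 (fun z => val z.1)); rewrite /= /bump /= fn add1n => // -[].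
exact: IH.
Qed.

Lemma no_perp_r u (X : sdata G) : is_hstring u -> is_sdata X ->
  forall e, ~~ @cperp _ _ _ X (stringX u) e.
Proof.
move=> hu hX e; apply/negP => pe; set o := sense e.
pose m (f : sQ X * sQ (stringX u)) : nat :=
  if o then val f.2 else (size (sletters u) - val f.2)%N.
suff H n (f : sQ X * sQ (stringX u)) : cperp f -> sense f = o -> m f = n -> False.
  exact: (H _ _ pe).
have step g : cperp g -> sense g = o ->
    exists g', [/\ cperp g', sense g' = o & (m g').+1 = m g].
  move=> pg sg; have [g' pg' [em se]] := cperp_step hX (stringX_sdata hu) pg.
  exists g'; rewrite se sg; split=> //.
  move: em => /(congr1 (fun z => val z.2)); rewrite /= se sg /m.
  by case: (o); rewrite /= /bump /= add1n // => ->; have /= := ltn_ord g.2; lia.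
elim: n f {pe} => [|n IH] f pf sf fn; have [f' [pf' sf' mf]] := step f pf sf.
  by rewrite fn in mf.
by apply: (IH _ pf' sf'); move: mf; rewrite fn => -[].
Qed.

End StringBand.

(** * Normalised Jordan blocks *)

Section BandGauge.
Variable k : fieldType.

Definition bcoef (lam : k) n (q : 'I_n) : k := if q == 0%N :> nat then lam else 1.
Definition bexp n (q : 'I_n) : int := if q == 0%N :> nat then 1 else 0.
(** The unipotent factor of the block: the remaining scalar [lam] is kept in [bcoef], as it is the
    block of the one-dimensional band complex. *)
Definition bgauge r (lam : k) : 'M[k]_r := lam^-1 *: jord r lam.

Lemma bcoef_neq0 lam n (q : 'I_n) : lam != 0 -> bcoef lam q != 0.
Proof. by rewrite /bcoef; case: ifP => // _ _; rewrite oner_neq0. Qed.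

Lemma bgauge_unit r' lam : lam != 0 -> bgauge r'.+1 lam \is a GRing.unit.
Proof.
by move=> l0; rewrite -[_ \is a _]/(_ \in unitmx) unitmxZ ?unitfE ?invr_eq0 // jord_unit.
Qed.

Lemma bJ_gauge r' lam n : lam != 0 ->
  bJ r'.+1 lam (n := n) = fun q => bcoef lam q *: bgauge r'.+1 lam ^ bexp q.
Proof.
move=> l0; apply/funext => q; rewrite /bJ /bcoef /bexp; case: ifP => _.
  by rewrite expr1z /bgauge scalerA mulfV // scale1r.
by rewrite expr0z scale1r.
Qed.

Lemma bJ1 lam n : bJ 1 lam (n := n) = fun q => (bcoef lam q)%:M.
Proof.
apply/funext => q; rewrite /bJ /bcoef; case: ifP => // _.
by apply/matrixP => i j; rewrite !mxE !ord1 eqxx.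
Qed.

End BandGauge.

(** * Dimension formula for a pair of complexes *)

Section Formula.
Variables (k : fieldType) (A : falgType k) (G : quiver_in A).
Hypothesis hG : gentle_algebra G.
Variables (X Y : sdata G).
Hypotheses (hX : is_sdata X) (hY : is_sdata Y).

Local Notation dimC J K := (\dim (vspan (@cchain _ _ _ X Y _ _ J K))).
Local Notation dimCn J K := (\dim (vspan (@cnull _ _ _ X Y _ _ J K))).
Local Notation dimN J K := (\dim (vspan (@nchain _ _ _ X Y _ _ J K))).
Local Notation dimNn J K := (\dim (vspan (@nnull _ _ _ X Y _ _ J K))).

Lemma homD_split r s (J : sQ X -> 'M[k]_r) (K : sQ Y -> 'M[k]_s) :
  (homD (rep J) (rep K) + (dimNn J K + dimCn J K) = dimN J K + dimC J K)%N.
Proof.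
rewrite -(dim_chain_split hG hX hY) -(dim_null_split hG hX hY).
exact: (homDE hG (rep_complex hG hX J) (rep_complex hG hY K)).
Qed.

Lemma nnull_le r s (J : sQ X -> 'M[k]_r) (K : sQ Y -> 'M[k]_s) : (dimNn J K <= dimN J K)%N.
Proof.
have sN : subsp (@nnull _ _ _ X Y _ _ J K).
  by apply: subsp_and; [exact: (null_sub hG)|exact: (ncp_fix_sub hG)].
have sC : subsp (@nchain _ _ _ X Y _ _ J K).
  by apply: subsp_and; [exact: (chain_sub hG)|exact: (ncp_fix_sub hG)].
apply: dimvS; apply/subvP => f /(vspanE sN)[nf ff]; apply/(vspanE sC); split=> //.
exact: (null_chain hG (rep_complex hG hX J) (rep_complex hG hY K)).
Qed.

Section NoPerp.
Hypothesis np : forall e : sQ X * sQ Y, ~~ cperp e.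

Lemma no_perp_cyc (a : sN X) (b : sN Y) (p : qpath G) : ~~ cyc a b p.
Proof.
rewrite /cyc /tcyc; case: ifP => _; apply/existsPn => e; by rewrite (negPf (np e)).
Qed.

Variables (r s : nat) (J : sQ X -> 'M[k]_r) (K : sQ Y -> 'M[k]_s).

Lemma no_perp_ncp m (f : mor (rep J) (rep K)) : homogeneous m f -> ncp f = 0 -> f = 0.
Proof.
move=> /(homog_cmx hG) hf nf; apply: (cmx_inj hG) => a b p _; rewrite cmx0.
apply/eqP/negPn/negP => nz; have [tp sp _] := hf _ _ _ nz.
have := cmx_ncp hG f a b p; rewrite nf cmx0 /ncv tp sp !eqxx no_perp_cyc /= scale1r.
by move/esym/eqP; apply/negP.
Qed.

Lemma no_perp_dim0 (S : mor (rep J) (rep K) -> Prop) : subsp S ->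
  (forall f, S f -> chain_map f /\ ncp f = 0) -> \dim (vspan S) = 0%N.
Proof.
move=> sS h; apply/eqP; rewrite dimv_eq0; apply/eqP/vspaceP => f; rewrite memv0.
apply/idP/eqP => [/(vspanE sS)/h[[hf _] nf]|->]; last exact: mem0v.
exact: no_perp_ncp nf.
Qed.

Lemma no_perp_dims : dimC J K = 0%N /\ dimCn J K = 0%N.
Proof.
split; apply: no_perp_dim0.
- by apply: subsp_and; [exact: (chain_sub hG)|exact: (ncp_ker_sub hG)].
- by [].
- by apply: subsp_and; [exact: (null_sub hG)|exact: (ncp_ker_sub hG)].
move=> f [nf pf]; split=> //.
exact: (null_chain hG (rep_complex hG hX J) (rep_complex hG hY K)).
Qed.

End NoPerp.

Variables (r' s' : nat).
Local Notation r := r'.+1.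
Local Notation s := s'.+1.
Variables (U : 'M[k]_r) (V : 'M[k]_s).
Hypotheses (hU : U \is a GRing.unit) (hV : V \is a GRing.unit).
Variables (c : sQ X -> k) (d : sQ Y -> k) (dx : sQ X -> int) (dz : sQ Y -> int).

(** Only the non-perpetual part is reduced to scalars. The perpetual boundaries are added on the
    left, so that the only truncated subtraction is the one justified by [nnull_le]. *)
Lemma homD_gauge (J := fun q => c q *: U ^ dx q) (K := fun q => d q *: V ^ dz q)
    (J1 := fun q => (c q)%:M : 'M_1) (K1 := fun q => (d q)%:M : 'M_1) :
  (homD (rep J) (rep K) + dimCn J K
   = dimC J K + r * s * (dimN J1 K1 - dimNn J1 K1))%N.
Proof.
have := homD_split J K; rewrite (dim_nchain_gauge hG hX hY hU hV).
rewrite (dim_nnull_gauge hG hX hY hU hV) -/J -/K -/J1 -/K1 mulnBr.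
have := leq_mul (leqnn (r * s)) (nnull_le J1 K1).
move: (homD _ _) (dimC _ _) (dimCn _ _) (dimN _ _) (dimNn _ _) => x1 x2 x3 x4 x5.
move: (r * s * x4)%N (r * s * x5)%N => y1 y2; lia.
Qed.

Lemma homD_no_perp : (forall e : sQ X * sQ Y, ~~ cperp e) ->
  homD (rep (fun q => c q *: U ^ dx q)) (rep (fun q => d q *: V ^ dz q))
  = (r * s * homD (rep (fun q => (c q)%:M : 'M[k]_1)) (rep (fun q => (d q)%:M : 'M[k]_1)))%N.
Proof.
move=> np; have := homD_gauge; cbv zeta; have := homD_split (fun q => (c q)%:M : 'M[k]_1) (fun q => (d q)%:M : 'M[k]_1).
have dc r0 s0 (J : sQ X -> 'M[k]_r0) (K : sQ Y -> 'M[k]_s0) : dimC J K = 0%N.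
  by have [] := no_perp_dims np J K.
have dn r0 s0 (J : sQ X -> 'M[k]_r0) (K : sQ Y -> 'M[k]_s0) : dimCn J K = 0%N.
  by have [] := no_perp_dims np J K.
rewrite !dc !dn !addn0 add0n => <-.
by rewrite addnK.
Qed.

End Formula.

(** * Isomorphisms with a shift *)

Section BandPair.
Variables (k : fieldType) (A : falgType k) (G : quiver_in A).
Hypothesis hG : gentle_algebra G.

Lemma shift_iso (C D : complex G) (f : mor C D) (g : mor D C) :
    is_complex C -> is_complex D -> homogeneous (-1) f -> homogeneous 1 g ->
    mcomp f g = mid C -> mcomp g f = mid D ->
    mcomp (diff C) f + mcomp f (diff D) = 0 ->
  isoD D (shift C).
Proof.
move=> [hC _] [hD _] hf hg fg gf anti.
have h1 : homogeneous (1 + 1) (mcomp g (diff C)) := homogeneous_mcomp hG hg hC.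
have h2 : homogeneous (1 + 1) (mcomp (diff D) g) := homogeneous_mcomp hG hD hg.
have anti' : mcomp g (diff C) + mcomp (diff D) g = 0.
  rewrite -(mcomp1r hG h1) -fg -(mcomp1l hG h2) -gf mcompA -(mcompA (diff C)).
  rewrite (mcompA g f) -(mcompA f) -mcompDDr -mcompDDl anti mcomp0l mcomp0r.
  by [].
have negE (E : complex G) (h : mor E C) : mcomp h (- diff C) = - mcomp h (diff C).
  by rewrite -[- diff C]scaleN1r mcompZr scaleN1r.
have negE' (E : complex G) (h : mor C E) : mcomp (- diff C) h = - mcomp (diff C) h.
  by rewrite -[- diff C]scaleN1r mcompZl scaleN1r.
exists (g : mor D (shift C)); split.
  split; first by move=> a b; have [p d] := hg a b; split=> // /d /= ->; ring.
  change (mcomp g (- diff C) = mcomp (diff D) g); rewrite negE.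
  by apply/eqP; rewrite eq_sym -addr_eq0 addrC anti'.
exists (f : mor (shift C) D); split.
- split; first by move=> a b; have [p d] := hf a b; split=> // /d /= ->; ring.
  change (mcomp f (diff D) = mcomp (- diff C) f); rewrite negE'.
  by apply/eqP; rewrite -addr_eq0 addrC anti.
- change (homotopic (mcomp g f) (mid D)); rewrite gf; exact: homotopic_refl.
- change (@homotopic _ _ _ (shift C) (shift C) (mcomp f g) (mid C)); rewrite fg.
  exact: (@homotopic_refl _ _ _ hG (shift C) (shift C) (mid C)).
Qed.

End BandPair.

(** * The formula for two bands *)

Section BandPair.
Variables (k : fieldType) (A : falgType k) (G : quiver_in A).
Hypothesis hG : gentle_algebra G.
Variables (v w : seq (letter G)).
Hypotheses (hv : is_band v) (hw : is_band w).
Local Notation X := (bandX v).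
Local Notation Y := (bandX w).
Let hX : is_sdata X := bandX_sdata hG hv.
Let hY : is_sdata Y := bandX_sdata hG hw.
Variables (lam mu : k).
Hypotheses (lam0 : lam != 0) (mu0 : mu != 0).
Local Notation J r := (bJ r lam (n := size v) : sQ X -> 'M[k]_r).
Local Notation K s := (bJ s mu (n := size w) : sQ Y -> 'M[k]_s).
Local Notation C r := (rep (J r)).
Local Notation D s := (rep (K s)).
Local Notation cchains r s := (@cchain _ _ _ X Y r s (J r) (K s)).
Local Notation cnulls r s := (@cnull _ _ _ X Y r s (J r) (K s)).
Local Notation nchains r s := (@nchain _ _ _ X Y r s (J r) (K s)).
Local Notation nnulls r s := (@nnull _ _ _ X Y r s (J r) (K s)).

Lemma band_hom_gauge r' s' :
  (homD (C r'.+1) (D s'.+1) + \dim (vspan (cnulls r'.+1 s'.+1))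
   = \dim (vspan (cchains r'.+1 s'.+1))
     + r'.+1 * s'.+1 * (\dim (vspan (nchains 1 1)) - \dim (vspan (nnulls 1 1))))%N.
Proof.
rewrite (bJ1 lam) (bJ1 mu) (bJ_gauge r' (size v) lam0) (bJ_gauge s' (size w) mu0).
exact: (homD_gauge hG hX hY (bgauge_unit r' lam0) (bgauge_unit s' mu0)).
Qed.

Lemma band_not_iso (f : mor (C 1) (D 1)) (a : sN X) :
  (forall a b, cmx f a b (svt b, [::]) != 0 -> ~~ tcyc a b) -> ~ isoD_map f.
Proof.
move: f; rewrite (bJ1 lam) (bJ1 mu) => f.
by apply: (not_iso hG hv hw _ _ a) => q; exact: bcoef_neq0.
Qed.

Definition band_hom_formula r s := homD (C r) (D s) =
  (minn r s * `[< isoD (C 1) (D 1) >] + r * s * radD (C 1) (D 1))%N.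

(** All chain maps are then non-isomorphisms, and [band_hom_gauge] for [r = s = 1] identifies [radD]
    with the dimension of the non-perpetual part. *)
Lemma band_no_iso r' s' :
    (forall f : mor (C 1) (D 1), chain_map f -> ~ isoD_map f) ->
    (forall r' s', \dim (vspan (cchains r'.+1 s'.+1)) = \dim (vspan (cnulls r'.+1 s'.+1))) ->
  band_hom_formula r'.+1 s'.+1.
Proof.
move=> ni cn; rewrite /band_hom_formula asboolF => [|[f isf]]; last first.
  by have [cf _] := isf; exact: ni cf isf.
rewrite muln0 add0n; have -> : radD (C 1) (D 1) = homD (C 1) (D 1).
  congr dim_mod; apply/funext => f; apply/propext; split=> [[]//|cf].
  by split=> //; exact: ni.
have := band_hom_gauge r' s'; have := band_hom_gauge 0 0; rewrite !cn mul1n.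
by rewrite [RHS]addnC => /addIn ->; rewrite [RHS]addnC => /addIn ->; rewrite mul1n.
Qed.

Variables (i0 : 'I_(size v)) (j0 : 'I_(size w)).
Hypotheses (i00 : i0 = 0%N :> nat) (j00 : j0 = 0%N :> nat).

Lemma band_no_perp r' s' : (forall e : sQ X * sQ Y, ~~ cperp e) ->
  band_hom_formula r'.+1 s'.+1.
Proof.
move=> np; apply: band_no_iso => [f _|r1 s1].
  apply: (@band_not_iso f (i0 : sN X)) => a b _; apply/negP => t.
  have := @no_perp_cyc _ _ _ _ _ np a b (svt a, [::]); by rewrite /cyc /= t.
by have [-> ->] := no_perp_dims hG hX hY np (J r1.+1) (K s1.+1).
Qed.

Variables (o : bool) (rho : sQ X -> sQ Y).
Hypothesis rho_bij : bijective rho.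
Hypothesis rho_perp : forall (q : sQ X) (r : sQ Y), cperp (q, r) = (r == rho q).
Hypothesis rho_sense : forall q : sQ X, sense (q, rho q) = o.
Hypothesis rho_pred : forall q : 'I_(size v), rho (ord_pred q) = bnx o (rho q).

Local Notation off := (coff o rho (i0 : sN X)).
Local Notation e := (turn_sense rho i0 j0).

Let csol0 r' s' (u : {ffun 'I_(size v) -> 'M[k]_(r'.+1, s'.+1)}) : lam != muX mu e ->
  csol rho (J _) (K _) u -> u = 0.
Proof.
move=> ne su; apply: (csol_inj rho_bij i00 j00 mu0 su).
apply: (itw_neq mu0 ne); exact: (csol_itw rho_bij i00 j00 mu0 su).
Qed.

(** The transports of size 1 are nonzero scalars, so a solution vanishes everywhere or nowhere. *)
Let csol_nz (u : {ffun 'I_(size v) -> 'M[k]_1}) : csol rho (J 1) (K 1) u -> u != 0 ->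
  forall a, u a ord0 ord0 != 0.
Proof.
move=> su nz a; rewrite (csol_transport rho_bij i00 j00 mu0 su) mxE big_ord1.
apply: mulf_neq0.
  apply: contraNneq nz => z; apply/eqP/(csol_inj rho_bij i00 j00 mu0 su).
  by apply/matrixP => i j; rewrite !ord1 z mxE.
have := transport_unit rho i0 j0 0 mu0 a.
by rewrite unitmxE det_mx11 unitfE.
Qed.

Let csol_ex : lam = muX mu e -> exists2 u : {ffun 'I_(size v) -> 'M[k]_1},
  csol rho (J 1) (K 1) u & forall a, u a ord0 ord0 != 0.
Proof.
move=> le; pose M : 'M[k]_1 := 1%:M.
have itM : itw (jord 1 lam) (jordX 1 mu e) M.
  have [S _ ->] := jordXE 0 e mu0; rewrite jordE le /itw mulmx1 mul1mx.
  have -> : jord 1 0 = 0 :> 'M[k]_1 by have := @jord0_nilp k 0 1 isT; rewrite expr1.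
  by rewrite mul0r.
have su := itw_csol rho_bij i00 j00 mu0 itM.
exists (spread rho i0 j0 mu M) => //; apply: csol_nz => //.
apply/eqP => /ffunP/(_ i0); rewrite !ffunE transport0 // mulmx1.
by move/matrixP/(_ ord0 ord0)/eqP; rewrite !mxE (negPf (oner_neq0 _)).
Qed.

Let cv (f : mor (C 1) (D 1)) : {ffun 'I_(size v) -> 'M[k]_1} := cval o rho f.

Let chain_cv f : chain_map f -> csol rho (J 1) (K 1) (cv f).
Proof. exact: (chain_csol hG hv hw rho_perp rho_sense rho_pred). Qed.

Lemma band_iso_shift : lam = muX mu e -> off = -1 -> isoD (D 1) (shift (C 1)).
Proof.
move=> /csol_ex[u su u0] c1; pose u' : {ffun 'I_(size v) -> 'M[k]_1} :=
  [ffun a : sN X => (-1) ^ sdg a *: u a].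
have u'0 a : u' a ord0 ord0 != 0.
  by rewrite ffunE mxE mulf_neq0 // expfz_neq0 // oppr_eq0 oner_neq0.
have anti := csol_anti hG hv hw rho_perp rho_sense rho_pred c1 su; rewrite -/u' in anti.
have hom : homogeneous off (cmk o rho (J 1) (K 1) u').
  exact: (cmk_hom hG hv hw rho_perp rho_sense rho_pred).
rewrite c1 in hom; move: anti hom.
rewrite (bJ1 lam) (bJ1 mu) => anti hom.
apply: (shift_iso hG (g := cinv (bcoef lam (n := size v)) (bcoef mu (n := size w)) o rho u')
  (rep_complex hG hX _) (rep_complex hG hY _) hom).
- by rewrite -[1]opprK -c1; exact: (cinv_hom hG hv hw rho_perp rho_sense rho_pred).
- exact: (cmk_cinv hG hv hw).
- exact: (cinv_cmk hG hv hw).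
- exact: anti.
Qed.

(** The critical case is offset -1 with matching eigenvalue, where degree 0 of the perpetual part
    would carry homology; [band_iso_shift] rules it out. *)
Lemma band_neq r' s' : off <> 0 \/ lam != muX mu e ->
    ~ isoD (D 1) (shift (C 1)) ->
  band_hom_formula r'.+1 s'.+1.
Proof.
move=> h nsh.
have tE := tcycE rho_perp rho_sense.
apply: band_no_iso => [f cf|r1 s1].
  apply: (@band_not_iso f (i0 : sN X)) => a b nz; rewrite tE; apply/eqP => eb.
  have [ne|/eqP eoff] := eqVneq off 0; last first.
    have [hf _] := cf; have [_ _] := (homog_cmx hG _ _).1 hf _ _ _ nz.
    rewrite eb (sdg_cvtx hG hv hw rho_sense rho_pred a (i0 : sN X)).
    by move: eoff; lia.
  case: h => // /csol0/(_ (chain_cv cf)) z; move: nz; rewrite eb.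
  have := congr1 (fun u : {ffun 'I_(size v) -> 'M[k]_1} => u a) z; rewrite !ffunE => ->.
  by rewrite eqxx.
have [ne|/eqP eoff] := eqVneq off 0.
  case: h => // ne'; rewrite (dim_cchain hG hv hw rho_perp rho_sense rho_pred _ _ ne).
  rewrite (dim_cnull0 hG hv hw rho_perp rho_sense rho_pred _ _ ne).
  apply/eqP; rewrite dimv_eq0; apply/eqP/vspaceP => u; rewrite memv0.
  apply/idP/eqP => [/(vspanE (csol_sub _ _ _))|->]; last exact: mem0v.
  exact: csol0.
apply: dim_vspan_eq => [||f].
- by apply: subsp_and; [exact: (chain_sub hG)|exact: (ncp_ker_sub hG)].
- by apply: subsp_and; [exact: (null_sub hG)|exact: (ncp_ker_sub hG)].
split=> [|[nf pf]]; last first.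
  by split=> //; exact: (null_chain hG (rep_complex hG hX _) (rep_complex hG hY _)).
apply: (cchain_cnull hG hv hw rho_perp rho_sense rho_pred eoff) => c1 u su.
by apply: csol0 su; apply/eqP => le; apply: nsh; exact: band_iso_shift.
Qed.

(** For [r = s = 1] the non-isomorphisms are exactly the chain maps in the non-perpetual part, which
    also contains all null-homotopic maps. So [radD] counts that part, and the intertwiners add
    [minn r s]. *)
Lemma band_eq r' s' : off = 0 -> lam = muX mu e -> band_hom_formula r'.+1 s'.+1.
Proof.
move=> eoff le; have offE a : coff o rho a = 0.
  by rewrite -eoff; exact: (coff_const hG hv hw rho_sense rho_pred).
have cn r1 s1 : \dim (vspan (cnulls r1 s1)) = 0%N.
  exact: (dim_cnull0 hG hv hw rho_perp rho_sense rho_pred _ _ eoff).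
have cc r1 s1 : \dim (vspan (cchains r1.+1 s1.+1)) = minn r1.+1 s1.+1.
  rewrite (dim_cchain hG hv hw rho_perp rho_sense rho_pred _ _ eoff).
  by rewrite (dim_csol rho_bij i00 j00) // le dim_itw_eq.
have nciso f : ncp f = f -> ~ isoD_map (f : mor (C 1) (D 1)).
  move=> nf; apply: (@band_not_iso f (i0 : sN X)) => a b; rewrite -nf (cmx_ncp hG) /ncv.
  case: (boolP (tcyc a b)) => // t; rewrite /cyc /= t !andbF scale0r eqxx //.
have iso f : chain_map f -> cv f != 0 -> isoD_map (f : mor (C 1) (D 1)).
  move=> cf nz; have := csol_nz (chain_cv cf) nz; rewrite /cv; move: f cf {nz}.
  rewrite (bJ1 lam) (bJ1 mu) => f cf.
  apply: (cval_iso hG hv hw _ _ rho_bij rho_perp rho_sense rho_pred offE (i0 : sN X) cf) => q;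
    exact: bcoef_neq0.
have cv0 f : chain_map f -> cv f = 0 -> ncp f = f.
  move=> cf z.
  have [hn _] := ncp_chain hG hX hY cf; have [hf _] := cf.
  have z' a : cval o rho f a = 0.
    have := congr1 (fun u : {ffun 'I_(size v) -> 'M[k]_1} => u a) z.
    by rewrite [in RHS]ffunE.
  apply/eqP; rewrite eq_sym -subr_eq0 addrC -scaleN1r; apply/eqP.
  apply: (cyc_supp hG hv hw rho_perp rho_sense rho_pred (d := 0)).
  - exact: (homogeneous_sub hG _ _ 0).2.
  - by rewrite (ncp_lin hG) (ncpK hG) scaleN1r addNr.
  - move=> a _; rewrite ffunE (cmx_lin (-1)) (cmx_ncp hG); have := z' a.
    by rewrite ffunE => ->; rewrite !scaler0 addr0.
  - by move=> q; rewrite offE.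
have ncE : (fun f : mor (C 1) (D 1) => chain_map f /\ ~ isoD_map f) = nchains 1 1.
  apply/funext => f; apply/propext; split=> [[cf nf]|[cf nf]]; split=> //; last exact: nciso.
  by apply: cv0 => //; apply/eqP/negPn/negP => nz; exact: nf (iso _ cf nz).
have nullE : @null_homotopic _ _ _ (C 1) (D 1) = nnulls 1 1.
  apply/funext => f; apply/propext; split=> [nf|[//]]; split=> //.
  apply: cv0; first exact: (null_chain hG (rep_complex hG hX _) (rep_complex hG hY _)).
  by apply/ffunP => a; rewrite !ffunE (null_triv hG hX hY _ _ _ nf).
have isoT : isoD (C 1) (D 1).
  have [u su u0] := csol_ex le.
  exists (cmk o rho (J 1) (K 1) u); apply: iso.
    exact: (csol_chain hG hv hw rho_perp rho_sense rho_pred eoff).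
  rewrite /cv (cval_cmk hG); apply: contraNneq (u0 i0) => ->; by rewrite ffunE mxE.
rewrite /band_hom_formula asboolT // muln1; have := band_hom_gauge r' s'.
rewrite cn cc addn0 => ->; congr (_ + _ * _)%N.
have sC : subsp (nchains 1 1) by apply: subsp_and; [exact: (chain_sub hG)|exact: (ncp_fix_sub hG)].
have sN : subsp (nnulls 1 1) by apply: subsp_and; [exact: (null_sub hG)|exact: (ncp_fix_sub hG)].
rewrite /radD ncE nullE -(dim_mod_sub sC sN) ?addnK // => f [nf ff]; split=> //.
exact: (null_chain hG (rep_complex hG hX _) (rep_complex hG hY _)).
Qed.

End BandPair.

Unset Implicit Arguments.

Theorem theorem2 (k : closedFieldType) (A : falgType k) (G : quiver_in A)
  (hG : gentle_algebra G) (r s : nat) (hr : (0 < r)%N) (hs : (0 < s)%N)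
  (v w : seq (letter G)) (hv : is_band v) (hw : is_band w)
  (u : hstring G) (hu : is_hstring u)
  (lam mu : k) (hlam : lam != 0) (hmu : mu != 0)
  (hvw : ~ isoD (band_complex w mu 1) (shift (band_complex v lam 1))) :
  homD (band_complex v lam r) (band_complex w mu s)
    = (minn r s * `[< isoD (band_complex v lam 1) (band_complex w mu 1) >]
       + r * s * radD (band_complex v lam 1) (band_complex w mu 1))%N
  /\ homD (band_complex v lam r) (string_complex u)
       = (r * homD (band_complex v lam 1) (string_complex u))%N
  /\ homD (string_complex u) (band_complex v lam r)
       = (r * homD (string_complex u) (band_complex v lam 1))%N.
Proof.
have hV := bandX_sdata hG hv; have hW := bandX_sdata hG hw; have hS := stringX_sdata hG hu.
have i00 : (0 < size v)%N by case: hv => /andP[]; rewrite lt0n.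
have j00 : (0 < size w)%N by case: hw => /andP[]; rewrite lt0n.
case: r hr => // r' _; case: s hs => // s' _.
move: hvw; rewrite !band_rep => nsh; split.
  have [[e pe]|np] := pselect (exists e : sQ (bandX v) * sQ (bandX w), cperp e); last first.
    apply: (band_no_perp hG hv hw hlam hmu (Ordinal i00)) => e.
    by apply/negP => pe; apply: np; exists e.
  have [o [rho [rb rp rs rq]]] := cperp_struct hG hv hw pe.
  pose i0 := Ordinal i00; pose j0 := Ordinal j00.
  have [c0|/eqP c0] := eqVneq (coff o rho (i0 : sN (bandX v))) 0; last first.
    by apply: (band_neq hG hv hw hlam hmu (i0 := i0) (j0 := j0) _ _ rb rp rs rq); [| |left|].
  have [le|ne] := eqVneq lam (muX mu (turn_sense rho i0 j0)).
    exact: (band_eq hG hv hw hlam hmu (i0 := i0) (j0 := j0) _ _ rb rp rs rq).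
  by apply: (band_neq hG hv hw hlam hmu (i0 := i0) (j0 := j0) _ _ rb rp rs rq); [| |right|].
have [_ pres _] := hG; have cS := string_complexP pres hu.
have cR : is_complex (string_rep u) := rep_complex hG hS _.
have cB n : is_complex (rep (X := bandX v) (bJ n lam (n := size v))) := rep_complex hG hV _.
have rS := string_rep_reindexing u.
have toR n : homD (rep (X := bandX v) (bJ n lam (n := size v))) (string_complex u)
    = homD (rep (X := bandX v) (bJ n lam (n := size v))) (string_rep u).
  exact: (homD_reindex hG (cB n) (cB n) cS cR (reindexing_id _) rS).
have toL n : homD (string_complex u) (rep (X := bandX v) (bJ n lam (n := size v)))
    = homD (string_rep u) (rep (X := bandX v) (bJ n lam (n := size v))).
  exact: (homD_reindex hG cS cR (cB n) (cB n) rS (reindexing_id _)).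
have uB := bgauge_unit r' hlam; have u1 : (1 : 'M[k]_1) \is a GRing.unit := unitr1 _.
(* The string takes part in the gauge argument with unit matrix, coefficients 1 and exponents 0, so
   its blocks stay of size 1. *)
have S1 : string_rep u = rep (X := stringX u) (fun _ => 1 *: (1 : 'M[k]_1) ^ (0 : int)).
  by rewrite /string_rep; congr rep; apply/funext => q; rewrite scale1r expr0z.
rewrite !toR !toL (bJ_gauge r' _ hlam) (bJ1 lam).
split.
  rewrite {1}S1 (homD_no_perp hG hV hS uB u1); last exact: no_perp_r.
  by rewrite muln1.
rewrite {1}S1 (homD_no_perp hG hS hV u1 uB); last exact: no_perp_l.
by rewrite mul1n.
Qed.
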